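(* Let $\delta=\binom{n+1}{2}$ in the symmetric case, resp. $\delta=n(n+1)$ in the Hamiltonian case. Then there is a nonempty Zariski open subset $\mathcal{U}$ of $SRat_{\delta,n}(\mathbb{C})$ (resp. $Ham_{\delta,n}(\mathbb{C})$) such that for every $G\in\mathcal{U}$ and every monic polynomial $\varphi$ of degree $\delta$ (required to be even, $\varphi(s)=\varphi(-s)$, in the Hamiltonian case), the set of complex symmetric matrices $F\in\mathrm{Sym}(n)$ with $\varphi_F=\varphi$ is finite, and counted with multiplicities it has exactly $$d(n)=2^{\binom{n}{2}}\frac{\binom{n+1}{2}!\,1!\,2!\cdots(n-1)!}{1!\,3!\cdots(2n-1)!}=\frac{\binom{n+1}{2}!}{\prod_{i=0}^{n-1}(2i+1)^{n-i}}$$ elements.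
   Context: A strictly proper rational matrix $G(s)\in\mathbb{C}(s)^{n\times n}$ is symmetric if $G(s)=G(s)^t$ and Hamiltonian if $G(s)=G(-s)^t$. $SRat_{\delta,n}(\mathbb{C})$ and $Ham_{\delta,n}(\mathbb{C})$ denote the irreducible quasi-affine varieties of strictly proper complex symmetric, resp. Hamiltonian, $n\times n$ transfer functions of McMillan degree $\delta$. $\mathrm{Sym}(n)$ is the space of complex symmetric $n\times n$ matrices. For $F\in\mathrm{Sym}(n)$ the closed-loop transfer function is $G_F(s)=(I_n-G(s)F)^{-1}G(s)$ and its characteristic polynomial is $\varphi_F(s)=\det(sI_\delta-A-BFC)$ for any minimal realization $(A,B,C)$ of $G$. Multiplicities are those of the points in the fiber of the finite morphism $\mathbb{LG}(n)\to\mathbb{P}^\delta$ (resp. $\mathbb{P}^{\delta/2}$) sending a Lagrangian subspace to the class of its closed-loop characteristic polynomial (resp. its even part); $d(n)$ equals the degree of the Lagrangian Grassmannian $\mathbb{LG}(n)$ in its Plücker embedding. *)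

(* Defs.v *)
From HB Require Import structures.
From mathcomp Require Import all_boot all_order all_algebra.
From mathcomp Require Import Rstruct.
From mathcomp Require Import complex.
From mathcomp Require Import mpoly.

Set Implicit Arguments.
Unset Strict Implicit.
Unset Printing Implicit Defensive.

Import GRing.Theory Num.Theory.
Local Open Scope ring_scope.

Definition CC : closedFieldType := complex Rdefinitions.R.

Section Defs.
Variable K : fieldType.

Definition poly_refl (p : {poly K}) : {poly K} := p \Po (- 'X).

(* A realization (A,B,C) with state dimension d of an n x n transfer function
   G(s) = C (sI - A)^{-1} B = tf_num A B C / char_poly A. *)
Definition tf_num d n (A : 'M[K]_d) (B : 'M[K]_(d, n)) (C : 'M[K]_(n, d))
  : 'M[{poly K}]_n :=
  map_mx polyC C *m \adj (char_poly_mx A) *m map_mx polyC B.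

Definition controllable d n (A : 'M[K]_d) (B : 'M[K]_(d, n)) : bool :=
  (1%:M <= \sum_(k < d) <<(A ^+ k *m B)^T>>)%MS.

Definition observable d n (A : 'M[K]_d) (C : 'M[K]_(n, d)) : bool :=
  controllable A^T C^T.

(* minimal realization: its state dimension d is the McMillan degree of G *)
Definition minimal_real d n (A : 'M[K]_d) (B : 'M[K]_(d, n)) (C : 'M[K]_(n, d))
  : bool := controllable A B && observable A C.

(* G(s) = G(s)^t, as an identity of rational matrices with common
   denominator char_poly A *)
Definition sym_tf d n (A : 'M[K]_d) (B : 'M[K]_(d, n)) (C : 'M[K]_(n, d))
  : Prop := (tf_num A B C)^T = tf_num A B C.

(* G(s) = G(-s)^t, cross-multiplied:
   N(s) * den(-s) = N(-s)^t * den(s). *)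
Definition ham_tf d n (A : 'M[K]_d) (B : 'M[K]_(d, n)) (C : 'M[K]_(n, d))
  : Prop :=
  map_mx (fun p => p * poly_refl (char_poly A)) (tf_num A B C)
  = map_mx (fun p => poly_refl p * char_poly A) (tf_num A B C)^T.

Definition real_pt d n (A : 'M[K]_d) (B : 'M[K]_(d, n)) (C : 'M[K]_(n, d))
  : 'I_(d * d + d * n + n * d) -> K :=
  fun i => (row_mx (row_mx (mxvec A) (mxvec B)) (mxvec C)) 0 i.

Definition mx_pt n (F : 'M[K]_n) : 'I_(n * n) -> K := fun k => (mxvec F) 0 k.

Definition Xmx n : 'M[{mpoly K[n * n]}]_n :=
  \matrix_(i < n, j < n) 'X_(mxvec_index i j).

Definition clpoly d n (A : 'M[K]_d) (B : 'M[K]_(d, n)) (C : 'M[K]_(n, d))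
  : {poly {mpoly K[n * n]}} :=
  char_poly (map_mx (fun a => a%:MP) A
             + map_mx (fun a => a%:MP) B *m Xmx n *m map_mx (fun a => a%:MP) C).

Definition sym_eqs n : seq {mpoly K[n * n]} :=
  [seq 'X_(mxvec_index ij.1 ij.2) - 'X_(mxvec_index ij.2 ij.1)
  | ij <- enum (Finite.clone _ ('I_n * 'I_n)%type)].

Definition sym_fiber_eqs d n (A : 'M[K]_d) (B : 'M[K]_(d, n)) (C : 'M[K]_(n, d))
  (phi : {poly K}) : seq {mpoly K[n * n]} :=
  sym_eqs n ++ [seq (clpoly A B C)`_k - (phi`_k)%:MP | k <- iota 0 d].

Definition ham_fiber_eqs d n (A : 'M[K]_d) (B : 'M[K]_(d, n)) (C : 'M[K]_(n, d))
  (phi : {poly K}) : seq {mpoly K[n * n]} :=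
  sym_eqs n ++ [seq (clpoly A B C)`_(k.*2) - (phi`_(k.*2))%:MP
               | k <- iota 0 d./2].

Definition in_ideal N (gs : seq {mpoly K[N]}) (p : {mpoly K[N]}) : Prop :=
  exists qs : seq {mpoly K[N]},
    size qs = size gs /\ p = \sum_(i < size gs) qs`_i * gs`_i.

Definition in_local_ideal N (gs : seq {mpoly K[N]}) (x : 'I_N -> K)
  (p : {mpoly K[N]}) : Prop :=
  exists u : {mpoly K[N]}, u.@[x] != 0 /\ in_ideal gs (u * p).

(* local_mult gs x m : the local ring of the scheme V(gs) at x,
   K[X]_x / (gs)_x, has dimension exactly m as a K-vector space
   (b is a basis of it, with representatives chosen in K[X]). *)
Definition local_mult N (gs : seq {mpoly K[N]}) (x : 'I_N -> K) (m : nat) : Prop :=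
  exists b : m.-tuple {mpoly K[N]},
    (forall p : {mpoly K[N]}, exists c : 'I_m -> K,
        in_local_ideal gs x (p - \sum_(i < m) c i *: tnth b i)) /\
    (forall c : 'I_m -> K,
        in_local_ideal gs x (\sum_(i < m) c i *: tnth b i) -> forall i, c i = 0).

Definition count_with_mult n (P : 'M[K]_n -> Prop) (gs : seq {mpoly K[n * n]})
  (total : nat) : Prop :=
  exists s : seq 'M[K]_n,
    uniq s /\ (forall F, F \in s <-> P F) /\
    exists mult : 'M[K]_n -> nat,
      (forall F, F \in s -> local_mult gs (mx_pt F) (mult F)) /\
      \sum_(F <- s) mult F = total.

End Defs.

(* d(n) = binom(n+1,2)! / prod_{i=0}^{n-1} (2i+1)^(n-i)  (exact division) *)
Definition dLG (n : nat) : nat :=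
  ('C(n.+1, 2))`! %/ \prod_(i < n) (2 * i + 1) ^ (n - i).

(* Main.v *)
(** The coefficients of the closed-loop polynomial are linear forms in the Pluecker
    coordinates (maximal minors) of [I, F].  For a direct sum of n shift chains of
    lengths m, 2m, ..., nm (m = 1, resp. m = 2) these forms are, up to sign, the
    sums of the principal minors of F of a given weight, and the exchange relations
    together with the Lagrangian ones (F symmetric) force every Pluecker coordinate to
    be nilpotent modulo them: no Lagrangian subspace at infinity has vanishing
    closed-loop polynomial.  This amounts to a rank condition in finitely many degrees
    of the filtration of K[F] by products of Pluecker coordinates, so it persists on an
    open set of realizations.  Where it holds, the coefficients c_k form a regular
    sequence compatible with the filtration, hence all the rings K[F]/(c - phi) have
    the dimension they have at the chain realization.  There, the c_k are
    homogeneous of degree 2(d - k) when F_ij (0 <= i <= j < n) has weight i + j + 2, and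
    Bezout's count prod (2(d - k)) / prod (i + j + 2) gives d(n).  Finally, a
    finite-dimensional quotient of K[F] is the product of its local rings.  In the
    Hamiltonian case, uniqueness of minimal realizations shows that the closed-loop
    polynomial is even whenever F is symmetric, so that only half of the coefficients
    are constraints. *)

Require Import Defs.
From HB Require Import structures.
From mathcomp Require Import all_boot all_order all_algebra.
From mathcomp Require Import fingroup perm.
From mathcomp Require Import Rstruct complex mpoly.
From mathcomp Require Import zify ring.
From Stdlib Require Import Classical.

Set Implicit Arguments.
Unset Strict Implicit.
Unset Printing Implicit Defensive.

Import GRing.Theory Num.Theory.
Local Open Scope ring_scope.

(** * Linear algebra modulo a subspace *)

Section LinearAlgebra.
Variables (K : fieldType) (V : lmodType K).
Implicit Types (J U : V -> Prop) (I : finType).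

(** The filtration by products of minors of [I, F] is preferred to the degree in F because every
    closed-loop coefficient has degree 1 in it, whatever the realization. For the ordinary degree
    and n > 1, the top forms of several coefficients of a general realization are multiples of det F
    and have common zeros, so Bezout's bound is not attained. Flatness and intersection theory are
    replaced by counting: if the filtered ring K[F] lies, up to bounded shifts of degree, between r
    copies and r copies of K[c], then r is determined by growth alone, and two systems c, c' with
    the same degrees in the same filtration have the same r. The lower bound is freeness over K[c];
    it rests on Koszul homology and not on a theory of dimension or depth. Bezout's count needs
    homogeneous equations, hence a second filtration, by weights, used at the chain realization
    only. Subspaces, ideals and filtrations are predicates, and no quotient is ever formed. *)

Definition subsp J := J 0 /\ forall a x y, J x -> J y -> J (a *: x + y).

(** Here and in [spanned] the vectors stand for their classes in the quotient of V by J. *)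
Definition indep I J (v : I -> V) :=
  forall l : I -> K, J (\sum_i l i *: v i) -> forall i, l i = 0.

Definition spanned I J (v : I -> V) (x : V) :=
  exists l : I -> K, J (x - \sum_i l i *: v i).

Lemma subspD J x y : subsp J -> J x -> J y -> J (x + y).
Proof. by move=> [_ h] Jx Jy; rewrite -[x]scale1r; apply: h. Qed.

Lemma subspZ J a x : subsp J -> J x -> J (a *: x).
Proof. by move=> [J0 h] Jx; rewrite -[_ *: _]addr0; apply: h. Qed.

Lemma subspB J x y : subsp J -> J x -> J y -> J (x - y).
Proof. by move=> sJ Jx Jy; apply: subspD => //; rewrite -scaleN1r; apply: subspZ. Qed.

Lemma subsp_sum J (T : Type) (r : seq T) (P : pred T) (F : T -> V) :
  subsp J -> (forall i, P i -> J (F i)) -> J (\sum_(i <- r | P i) F i).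
Proof.
move=> sJ hF; elim/big_ind: _ => //; first by case: sJ.
by move=> x y; apply: subspD.
Qed.

Lemma subsp_eq0 : subsp (fun x : V => x = 0).
Proof. by split=> // a x y -> ->; rewrite scaler0 addr0. Qed.

(** With fewer [v'] than [v], the coefficient matrix [M] has a nonzero row in its left kernel, and
    that row is a relation among the [v] modulo J. *)
Lemma indep_card_le I I' J (v : I -> V) (v' : I' -> V) :
  subsp J -> indep J v -> (forall i, spanned J v' (v i)) -> (#|I| <= #|I'|)%N.
Proof.
move=> sJ iv /fin_all_exists [l hl]; rewrite leqNgt; apply/negP => ltII.
pose M := \matrix_(i < #|I|, j < #|I'|) l (enum_val i) (enum_val j).
have kM : kermx M != 0.
  rewrite kermx_eq0 /row_free neq_ltn; apply/orP; left.
  by apply: leq_ltn_trans (rank_leq_col _) ltII.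
have [i ui] : exists i, row i (kermx M) != 0.
  apply/existsP; apply: contraR kM; rewrite negb_exists => /forallP h.
  apply/eqP/row_matrixP => i; rewrite row0; apply/eqP.
  by have := h i; rewrite negbK.
set u := row i (kermx M) in ui.
have uM : u *m M = 0 by rewrite /u -row_mul mulmx_ker row0.
case/negP: ui; apply/eqP/rowP => j; rewrite [RHS]mxE -[j]enum_valK.
apply: (iv (fun i => u 0 (enum_rank i))).
have -> : \sum_i0 u 0 (enum_rank i0) *: v i0 =
  \sum_i0 u 0 (enum_rank i0) *: (v i0 - \sum_j0 l i0 j0 *: v' j0).
  rewrite -[LHS]subr0 -[X in _ - X](_ : \sum_j0 (u *m M) 0 (enum_rank j0) *: v' j0 = _); last first.
    by rewrite uM big1 // => j0 _; rewrite mxE scale0r.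
  under [X in _ = X]eq_bigr do rewrite scalerBr.
  rewrite sumrB; congr (_ - _).
  under eq_bigr do rewrite mxE scaler_suml.
  rewrite exchange_big /= (reindex_onto enum_rank enum_val) /=; last by move=> *; rewrite enum_valK.
  apply: eq_big => [k|k _]; first by rewrite enum_rankK eqxx.
  rewrite scaler_sumr; apply: eq_bigr => j0 _.
  by rewrite !mxE !enum_rankK scalerA.
by apply: subsp_sum => // k _; apply: subspZ.
Qed.

Lemma indep_inj_card I I' J (v : I -> V) (v' : I' -> V) (s : V -> V) :
  subsp J -> indep (fun x => x = 0) v ->
  (forall l : I -> K, s (\sum_i l i *: v i) = \sum_i l i *: s (v i)) ->
  (forall x, J (s x) -> x = 0) ->
  (forall i, spanned J v' (s (v i))) -> (#|I| <= #|I'|)%N.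
Proof.
move=> sJ iv slin sinj; apply: (@indep_card_le I I' J (fun i => s (v i))) => // l.
by rewrite -slin => /sinj; apply: iv.
Qed.

(** If no independent family spanned U, each could be lengthened by one vector, and a family of
    length [#|I|.+1] would contradict the spanning by [v]. *)
Lemma exists_basis_of J U I (v : I -> V) :
  subsp J -> subsp U -> (forall x, U x -> spanned J v x) ->
  exists r, exists b : 'I_r -> V,
    [/\ forall i, U (b i), indep J b & forall x, U x -> spanned J b x].
Proof.
move=> sJ sU spv; apply: NNPP => nobasis.
have step k : exists b : 'I_k -> V, (forall i, U (b i)) /\ indep J b.
  elim: k => [|k [b [Ub ib]]].
    by exists (fun i => 0); split=> [[]|l _ []].
  have [x [Ux nx]] : exists x, U x /\ ~ spanned J b x.
    apply: NNPP => nx; apply: nobasis; exists k, b; split=> // x Ux.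
    by apply: NNPP => nsx; apply: nx; exists x.
  exists (fun i => if unlift ord0 i is Some j then b j else x); split.
    by move=> i; case: unliftP => [j|] _.
  move=> l; rewrite big_ord_recl unlift_none.
  under eq_bigr do rewrite liftK.
  set S := \sum_j _ => JS; have l0 : l ord0 = 0.
    apply/eqP/negP => /negP l0; apply: nx.
    exists (fun j => - (l ord0)^-1 * l (lift ord0 j)).
    have -> : x - \sum_j (- (l ord0)^-1 * l (lift ord0 j)) *: b j
      = (l ord0)^-1 *: (l ord0 *: x + S).
      rewrite scalerDr scalerA mulVf // scale1r; congr (_ + _).
      rewrite -sumrN scaler_sumr; apply: eq_bigr => j _.
      by rewrite scalerA mulNr scaleNr opprK.
    exact: subspZ.
  move: JS; rewrite l0 scale0r add0r => JS i.
  by case: (unliftP ord0 i) => [j ->|->] //; apply: (ib (fun j => l (lift ord0 j))).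
have [b [Ub ib]] := step #|I|.+1.
have := indep_card_le sJ ib (fun i => spv _ (Ub i)).
by rewrite card_ord ltnn.
Qed.

Lemma spannedZ I J (v : I -> V) a x : subsp J -> spanned J v x -> spanned J v (a *: x).
Proof.
move=> sJ [l hl]; exists (fun i => a * l i).
have -> : a *: x - \sum_i (a * l i) *: v i = a *: (x - \sum_i l i *: v i).
  by rewrite scalerBr scaler_sumr; congr (_ - _); apply: eq_bigr => i _; rewrite scalerA.
exact: subspZ.
Qed.

Lemma spannedD I J (v : I -> V) x y :
  subsp J -> spanned J v x -> spanned J v y -> spanned J v (x + y).
Proof.
move=> sJ [l hl] [l' hl']; exists (fun i => l i + l' i).
have -> : x + y - \sum_i (l i + l' i) *: v i
        = (x - \sum_i l i *: v i) + (y - \sum_i l' i *: v i).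
  under eq_bigr do rewrite scalerDl.
  by rewrite big_split /= opprD addrACA.
exact: subspD.
Qed.

Lemma spanned0 I J (v : I -> V) x : subsp J -> J x -> spanned J v x.
Proof.
move=> sJ Jx; exists (fun=> 0); rewrite big1 ?subr0 // => i _.
by rewrite scale0r.
Qed.

Lemma spanned_subsp I J (v : I -> V) : subsp J -> subsp (spanned J v).
Proof.
move=> sJ; split; first by apply: spanned0 => //; case: sJ.
by move=> a x y hx hy; apply: spannedD => //; apply: spannedZ.
Qed.

Lemma spanned_gen I J (v : I -> V) i : subsp J -> spanned J v (v i).
Proof.
move=> sJ; exists (fun k => (k == i)%:R); rewrite (bigD1 i) //= eqxx scale1r big1.
  by rewrite addr0 subrr; case: sJ.
by move=> k /negPf ->; rewrite scale0r.
Qed.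

Lemma spanned_sub I J J' (v : I -> V) x :
  (forall x, J x -> J' x) -> spanned J v x -> spanned J' v x.
Proof. by move=> JJ [l /JJ hl]; exists l. Qed.

End LinearAlgebra.

(** * Ideals generated by lists, and radicals *)

Section Ideals.
Variable R : comNzRingType.
Implicit Types (J : R -> Prop) (l : seq R) (x y a f : R).

Definition ideal J :=
  [/\ J 0, forall x y, J x -> J y -> J (x + y) & forall a x, J x -> J (a * x)].

Lemma ideal0 J : ideal J -> J 0. Proof. by case. Qed.
Lemma idealD J x y : ideal J -> J x -> J y -> J (x + y).
Proof. by case=> _ h _; apply: h. Qed.
Lemma idealMl J a x : ideal J -> J x -> J (a * x).
Proof. by case=> _ _; apply. Qed.
Lemma idealMr J a x : ideal J -> J x -> J (x * a).
Proof. by move=> iJ Jx; rewrite mulrC; apply: idealMl. Qed.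
Lemma idealN J x : ideal J -> J x -> J (- x).
Proof. by move=> iJ Jx; rewrite -mulN1r; apply: idealMl. Qed.
Lemma idealB J x y : ideal J -> J x -> J y -> J (x - y).
Proof. by move=> iJ Jx Jy; apply: idealD => //; apply: idealN. Qed.
Lemma ideal_sum J (I : Type) (r : seq I) (P : pred I) (F : I -> R) :
  ideal J -> (forall i, P i -> J (F i)) -> J (\sum_(i <- r | P i) F i).
Proof.
move=> iJ hF; elim/big_ind: _ => //; first exact: ideal0.
by move=> x y; apply: idealD.
Qed.

(** The recursion on the list of generators matches that of the Koszul complex below. *)
Fixpoint idl l x : Prop :=
  if l is f :: l' then exists a y, idl l' y /\ x = a * f + y else x = 0.

Lemma idl_ideal l : ideal (idl l).
Proof.
elim: l => [|f l ih]; split => //=.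
- by move=> x y -> ->; rewrite addr0.
- by move=> a x ->; rewrite mulr0.
- by exists 0, 0; split; [apply: ideal0|rewrite mul0r addr0].
- move=> x y [a [u [hu ->]]] [b [v [hv ->]]].
  by exists (a + b), (u + v); split; [apply: idealD|rewrite mulrDl addrACA].
- move=> a x [b [u [hu ->]]]; exists (a * b), (a * u).
  by split; [apply: idealMl|rewrite mulrDr mulrA].
Qed.

Lemma idl_cons f l x : idl l x -> idl (f :: l) x.
Proof. by exists 0, x; rewrite mul0r add0r. Qed.

Lemma idl_mem l f : f \in l -> idl l f.
Proof.
elim: l => // g l ih; rewrite inE => /predU1P [->|/ih]; last exact: idl_cons.
by exists 1, 0; split; [apply: ideal0 (idl_ideal l)|rewrite mul1r addr0].
Qed.

Lemma idl_least l J x : ideal J -> (forall f, f \in l -> J f) -> idl l x -> J x.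
Proof.
move=> iJ; elim: l x => [|f l ih] x hl /=; first by move->; apply: ideal0.
move=> [a [y [hy ->]]]; apply: idealD => //.
  by apply: idealMl => //; apply: hl; rewrite mem_head.
by apply: ih => // g gl; apply: hl; rewrite inE gl orbT.
Qed.

Definition nil_mod J x := exists e, J (x ^+ e).

Lemma nil_mod_weaken J x e k : ideal J -> (e <= k)%N -> J (x ^+ e) -> J (x ^+ k).
Proof. by move=> iJ /subnKC <- h; rewrite exprD; apply: idealMr. Qed.

(** For sums: in the binomial expansion of exponent e + k every term contains x^e or y^k. *)
Lemma nil_mod_ideal J : ideal J -> ideal (nil_mod J).
Proof.
move=> iJ; split.
- by exists 1%N; rewrite expr1; apply: ideal0.
- move=> x y [e he] [k hk]; exists (e + k)%N.
  rewrite exprDn; apply: ideal_sum => // i _; rewrite -mulr_natl; apply: idealMl => //.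
  have [lek|lke] := leqP k i.
    by apply: idealMl => //; apply: nil_mod_weaken hk.
  apply: idealMr => //; apply: nil_mod_weaken he => //.
  by rewrite -addnBA ?leq_addr // ltnW.
- by move=> a x [e he]; exists e; rewrite exprMn; apply: idealMl.
Qed.

End Ideals.

(** * Koszul homology and unmixedness *)

Section Koszul.
Variable R : comNzRingType.

Fixpoint kos (n : nat) : lmodType R :=
  if n is n'.+1 then (kos n' * kos n')%type : lmodType R else R^o.

Fixpoint kosd (l : seq R) : kos (size l) -> kos (size l) :=
  match l return kos (size l) -> kos (size l) with
  | [::] => fun=> 0
  | f :: l' => fun z => (kosd z.1 + f *: z.2, - kosd z.2)
  end.

(* Contraction against [t]: [kosd \o kosh + kosh \o kosd] is multiplication by
   [sum t_i l_i], so every element of the ideal kills the homology. *)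
Fixpoint kosh (t : nat -> R) n : kos n -> kos n :=
  match n return kos n -> kos n with
  | 0 => fun=> 0
  | n'.+1 => fun z => (kosh (fun i => t i.+1) z.1, t 0%N *: z.1 - kosh (fun i => t i.+1) z.2)
  end.

Fixpoint dotp (t : nat -> R) (l : seq R) : R :=
  if l is f :: l' then t 0%N * f + dotp (fun i => t i.+1) l' else 0.

Fixpoint kosdeg n (i : nat) : kos n -> Prop :=
  match n return kos n -> Prop with
  | 0 => fun z => (0 < i)%N -> z = 0
  | n'.+1 => fun z => kosdeg i z.1 /\ if i is i'.+1 then kosdeg i' z.2 else z.2 = 0
  end.

(** Coordinatewise membership: computing modulo [kosin J] is computing in the Koszul complex of
    R/J. *)
Fixpoint kosin (J : R -> Prop) n : kos n -> Prop :=
  match n return kos n -> Prop with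
  | 0 => fun z => J z
  | n'.+1 => fun z => kosin J z.1 /\ kosin J z.2
  end.

Lemma kosd_lin l a (x y : kos (size l)) : kosd (a *: x + y) = a *: kosd x + kosd y.
Proof.
elim: l x y => [|f l ih] x y /=; first by rewrite scaler0 addr0.
congr pair => /=.
  rewrite ih !scalerDr !scalerA [f * a]mulrC -!addrA; congr (_ + _).
  by rewrite addrCA.
by rewrite ih opprD scalerN.
Qed.

Lemma kosd0 l : kosd (0 : kos (size l)) = 0.
Proof.
have := kosd_lin 1 (0 : kos (size l)) 0.
by rewrite !scale1r addr0 -{1}[kosd 0]addr0 => /addrI.
Qed.

Lemma kosdD l (x y : kos (size l)) : kosd (x + y) = kosd x + kosd y.
Proof. by have := kosd_lin 1 x y; rewrite !scale1r. Qed.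
Lemma kosdZ l a (x : kos (size l)) : kosd (a *: x) = a *: kosd x.
Proof. by have := kosd_lin a x 0; rewrite kosd0 !addr0. Qed.
Lemma kosdN l (x : kos (size l)) : kosd (- x) = - kosd x.
Proof. by rewrite -scaleN1r kosdZ scaleN1r. Qed.
Lemma kosdB l (x y : kos (size l)) : kosd (x - y) = kosd x - kosd y.
Proof. by rewrite kosdD kosdN. Qed.

Lemma kosh_lin t n a (x y : kos n) : kosh t (a *: x + y) = a *: kosh t x + kosh t y.
Proof.
elim: n t x y => [|n ih] t x y /=; first by rewrite scaler0 addr0.
congr pair => /=; first exact: ih.
rewrite ih !scalerDr !scalerA [t 0%N * a]mulrC scalerN opprD -!addrA; congr (_ + _).
by rewrite addrCA.
Qed.

Lemma koshD t n (x y : kos n) : kosh t (x + y) = kosh t x + kosh t y.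
Proof. by have := kosh_lin t 1 x y; rewrite !scale1r. Qed.
Lemma kosh0 t n : kosh t (0 : kos n) = 0.
Proof. by have := koshD t (0 : kos n) 0; rewrite addr0 -{1}[kosh t 0]addr0 => /addrI. Qed.
Lemma koshZ t n a (x : kos n) : kosh t (a *: x) = a *: kosh t x.
Proof. by have := kosh_lin t a x 0; rewrite kosh0 !addr0. Qed.
Lemma koshN t n (x : kos n) : kosh t (- x) = - kosh t x.
Proof. by rewrite -scaleN1r koshZ scaleN1r. Qed.

Lemma kosd_sq l (z : kos (size l)) : kosd (kosd z) = 0.
Proof.
elim: l z => //= f l ih z; congr pair; last by rewrite kosdN ih !oppr0.
by rewrite kosdD kosdZ ih add0r scalerN subrr.
Qed.

Lemma kos_homotopy t l (z : kos (size l)) :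
  kosd (kosh t z) + kosh t (kosd z) = dotp t l *: z.
Proof.
elim: l t z => [|f l ih] t z /=; first by rewrite addr0 scale0r.
set t' := fun i => t i.+1; case: z => a b /=.
congr pair => /=.
  rewrite koshD koshZ scalerBr scalerA scalerDl -ih [f * _]mulrC addrACA subrK.
  by rewrite addrC.
rewrite kosdB kosdZ koshN scalerDl -ih scalerDr scalerA opprB opprK -/t' -!addrA.
by rewrite addKr addrCA.
Qed.

Lemma kosdeg0 n i : kosdeg i (0 : kos n).
Proof. by elim: n i => [|n ih] [|i] //=; split=> //; apply: ih. Qed.

Lemma kosdegD n i (x y : kos n) : kosdeg i x -> kosdeg i y -> kosdeg i (x + y).
Proof.
elim: n i x y => [|n ih] i x y /=.
  by move=> hx hy i0; rewrite hx // hy // addr0.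
move=> [x1 x2] [y1 y2]; split; first exact: ih.
by case: i x2 y2 {x1 y1} => [-> ->|i x2 y2] /=; rewrite ?addr0 //; apply: ih.
Qed.

Lemma kosdegZ n i a (x : kos n) : kosdeg i x -> kosdeg i (a *: x).
Proof.
elim: n i x => [|n ih] i x /=; first by move=> hx i0; rewrite hx // scaler0.
move=> [x1 x2]; split; first exact: ih.
by case: i x2 {x1} => [->|i x2] /=; rewrite ?scaler0 //; apply: ih.
Qed.

Lemma kosdegN n i (x : kos n) : kosdeg i x -> kosdeg i (- x).
Proof. by rewrite -scaleN1r; apply: kosdegZ. Qed.

Lemma kosdegB n i (x y : kos n) : kosdeg i x -> kosdeg i y -> kosdeg i (x - y).
Proof. by move=> hx hy; apply: kosdegD => //; apply: kosdegN. Qed.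

Lemma kosdeg_big n i (x : kos n) : (n < i)%N -> kosdeg i x -> x = 0.
Proof.
elim: n i x => [|n ih] [|i] //= x ni; first exact.
move=> [/(ih _ _ (ltnW ni)) h1 /(ih _ _ ni) h2].
by rewrite [x]surjective_pairing h1 h2.
Qed.

Lemma kosd_deg0 l (z : kos (size l)) : kosdeg 0 z -> kosd z = 0.
Proof.
by elim: l z => //= f l ih z [h1 h2]; rewrite h2 ih // scaler0 kosd0 addr0 oppr0.
Qed.

Lemma kosd_deg l i (z : kos (size l)) : kosdeg i.+1 z -> kosdeg i (kosd z).
Proof.
elim: l i z => [|f l ih] i z /=; first by move=> _ _.
move=> [h1 h2]; split.
  by apply: kosdegD; [apply: ih|apply: kosdegZ].
case: i h1 h2 => [|i] h1 h2; last by apply: kosdegN; apply: ih.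
by rewrite kosd_deg0 // oppr0.
Qed.

Lemma kosh_deg t n i (z : kos n) : kosdeg i z -> kosdeg i.+1 (kosh t z).
Proof.
elim: n t i z => [|n ih] t i z //= [h1 h2]; split; first exact: ih.
apply: kosdegB; first exact: kosdegZ.
case: i h1 h2 => [|i] h1 h2; last exact: ih.
by rewrite h2 kosh0; apply: kosdeg0.
Qed.

Section In.
Variable J : R -> Prop.
Hypothesis iJ : ideal J.

Lemma kosin0 n : kosin J (0 : kos n).
Proof. by elim: n => //=; apply: ideal0. Qed.

Lemma kosinD n (x y : kos n) : kosin J x -> kosin J y -> kosin J (x + y).
Proof.
elim: n x y => [|n ih] x y /=; first exact: idealD.
by move=> [? ?] [? ?]; split; apply: ih.
Qed.

Lemma kosinZ n a (x : kos n) : kosin J x -> kosin J (a *: x).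
Proof.
elim: n x => [|n ih] x /=; first exact: idealMl.
by move=> [? ?]; split; apply: ih.
Qed.

Lemma kosinN n (x : kos n) : kosin J x -> kosin J (- x).
Proof. by rewrite -scaleN1r; apply: kosinZ. Qed.

Lemma kosinB n (x y : kos n) : kosin J x -> kosin J y -> kosin J (x - y).
Proof. by move=> hx hy; apply: kosinD => //; apply: kosinN. Qed.

Lemma kosin_d l (z : kos (size l)) : kosin J z -> kosin J (kosd z).
Proof.
elim: l z => [|f l ih] z /=; first by move=> _; apply: ideal0.
move=> [h1 h2]; split; last by apply: kosinN; apply: ih.
by apply: kosinD; [apply: ih|apply: kosinZ].
Qed.

Lemma kosin_h t n (z : kos n) : kosin J z -> kosin J (kosh t z).
Proof.
elim: n t z => [|n ih] t z /=; first by move=> _; apply: ideal0.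
move=> [h1 h2]; split; first exact: ih.
by apply: kosinB; [apply: kosinZ|apply: ih].
Qed.

Lemma kosin_cancel n y (z : kos n) :
  (forall a, J (a * y) -> J a) -> kosin J (y *: z) -> kosin J z.
Proof.
move=> hy; elim: n z => [|n ih] z /=.
  by move=> h; apply: hy; rewrite mulrC.
by move=> [? ?]; split; apply: ih.
Qed.

(** Division by y modulo J has to respect the degree; where the degree forces a coordinate of z to
    vanish, that of v is taken to be zero. *)
Lemma kosin_split y J' n i (z : kos n) :
  (forall x, J' x -> exists a, J (x - a * y)) ->
  kosdeg i z -> kosin J' z -> exists v : kos n, kosdeg i v /\ kosin J (z - y *: v).
Proof.
move=> hJ'; elim: n i z => [|n ih] i z /=.
  move=> dz /hJ' [a ha]; case: (posnP i) => [i0|i0].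
    by exists a; split=> //; rewrite [_ *: _]mulrC.
  exists 0; split=> //; rewrite scaler0 subr0 dz //; exact: ideal0.
move=> [d1 d2] [h1 h2]; have [v1 [dv1 hv1]] := ih _ _ d1 h1.
case: i d1 d2 dv1 => [|i] d1 d2 dv1.
  exists (v1, 0); split=> //=; split=> //.
  by rewrite scaler0 subr0 d2; apply: kosin0.
have [v2 [dv2 hv2]] := ih _ _ d2 h2.
by exists (v1, v2).
Qed.

End In.

Lemma idl_dotp l x : idl l x -> exists t, x = dotp t l.
Proof.
elim: l x => [|f l ih] x /=; first by move=> ->; exists (fun=> 0).
move=> [a [y [/ih [t ->] ->]]].
by exists (fun i => if i is i'.+1 then t i' else a).
Qed.

(** A weakly regular sequence on R/J: the last quotient is allowed to be zero. *)
Fixpoint regular_mod (J : R -> Prop) (ys : seq R) : Prop :=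
  if ys is y :: ys' then (forall a, J (a * y) -> J a) /\ regular_mod (fun x => exists a, J (x - a * y)) ys'
  else True.

Lemma ideal_extend J y : ideal J -> ideal (fun x : R => exists a, J (x - a * y)).
Proof.
move=> iJ; split.
- by exists 0; rewrite mul0r subr0; apply: ideal0.
- move=> x x' [a ha] [b hb]; exists (a + b).
  by rewrite mulrDl opprD addrACA; apply: idealD.
- move=> c x [a ha]; exists (c * a).
  by rewrite -mulrA -mulrBr; apply: idealMl.
Qed.

(* The step from [J] to [J + (y)] is the long exact sequence of
   0 -> M -> M -> M/yM -> 0: as [y] kills the Koszul homology of M = R/J,
   the homology of M in degree i embeds in that of M/yM in degree i + 1. *)
Lemma koszul_acyclic l (ys : seq R) (J : R -> Prop) i (z : kos (size l)) :
  ideal J -> (forall y, y \in ys -> idl l y) -> regular_mod J ys ->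
  (size l < i + size ys)%N -> kosdeg i z -> kosin J (kosd z) ->
  exists u : kos (size l), kosdeg i.+1 u /\ kosin J (z - kosd u).
Proof.
elim: ys J i z => [|y ys ih] J i z iJ ysl; rewrite ?addn0 ?addnS.
  (* With no y left, the degree i exceeds the length of [l], so z itself is zero. *)
  move=> _ li dz _; exists 0; split; first exact: kosdeg0.
  by rewrite kosd0 (kosdeg_big li dz) subr0; apply: kosin0.
move=> [nzd reg] li dz cz.
have /idl_dotp [t yt] : idl l y by apply: ysl; rewrite mem_head.
have iJ' := ideal_extend y iJ.
set J' := (fun x => _) in reg iJ'.
have hom : kosin J (y *: z - kosd (kosh t z)).
  by rewrite yt -(kos_homotopy t z) addrAC subrr add0r; apply: kosin_h.
have cw : kosin J' (kosd (kosh t z)).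
  have JJ' n (x : kos n) : kosin J x -> kosin J' x.
    elim: n x => [|n ihn] x /=; first by move=> Jx; exists 0; rewrite mul0r subr0.
    by move=> [? ?]; split; apply: ihn.
  rewrite -[kosd _](subKr (y *: z)); apply: kosinB => //; last exact: JJ'.
  elim: (size l) (z) => [|n ihn] x /=; last by split; apply: ihn.
  by exists x; rewrite [_ *: _]mulrC subrr; apply: ideal0.
have [||u [du hu]] := ih J' i.+1 (kosh t z) iJ' _ reg _ (kosh_deg t dz) cw.
- by move=> y' y'l; apply: ysl; rewrite inE y'l orbT.
- by rewrite addSn.
have [v [dv hv]] := kosin_split iJ (fun x h => h) (kosdegB (kosh_deg t dz) (kosd_deg du)) hu.
(* Modulo J, h z - d u is y v; applying d turns this into d h z = y d v. Since also d h z = y z, the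
   factor y can be cancelled from y (z - d v). *)
exists v; split=> //.
apply: (kosin_cancel nzd).
have -> : y *: (z - kosd v) = (y *: z - kosd (kosh t z)) +
    kosd (kosh t z - kosd u - y *: v).
  by rewrite !kosdB kosd_sq subr0 kosdZ addrA subrK scalerBr.
by apply: kosinD => //; apply: kosin_d.
Qed.

Lemma kosin_eq0 n (z : kos n) : kosin (fun x => x = 0) z -> z = 0.
Proof. by elim: n z => //= n ih [a b] /= [/ih -> /ih ->]. Qed.

Fixpoint kemb n (x : R) : kos n :=
  match n return kos n with 0 => x | n'.+1 => (kemb n' x, 0) end.

Lemma kembZ n a x : kemb n (a * x) = a *: kemb n x.
Proof. by elim: n => //= n ->; congr pair; rewrite /= scaler0. Qed.

Lemma kembD n x y : kemb n (x + y) = kemb n x + kemb n y.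
Proof. by elim: n => //= n ->; congr pair; rewrite /= addr0. Qed.

Lemma kemb_inj n : injective (kemb n).
Proof. by elim: n => // n ih x y /= [/ih]. Qed.

Lemma kemb_deg n x : kosdeg 0 (kemb n x).
Proof. by elim: n. Qed.

Lemma kosdeg0_emb n (z : kos n) : kosdeg 0 z -> exists x, z = kemb n x.
Proof.
elim: n z => [|n ih] z /=; first by exists z.
by case: z => a b /= [/ih [x ->] ->]; exists x.
Qed.

Lemma kosd_deg1 l (z : kos (size l)) : kosdeg 1 z ->
  exists2 x, idl l x & kosd z = kemb (size l) x.
Proof.
elim: l z => [|f l ih] z /=; first by move=> _; exists 0.
case: z => a b /= [/ih [x hx ->] db]; have [y yb] := kosdeg0_emb db.
exists (y * f + x); first by exists y, x.
rewrite kosd_deg0 // oppr0; congr pair => /=.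
by rewrite yb addrC mulrC kembD kembZ.
Qed.

(** A relation a f = sum t_i l_i is a cycle of degree 1 in the Koszul complex on f :: l. There is no
    homology in that degree when the ideal contains a regular sequence at least as long as f :: l,
    and the e_f-component of a bounding element then puts a into the ideal of [l]. *)
Theorem koszul_nonzerodivisor f l ys a :
  (forall y, y \in ys -> idl (f :: l) y) -> regular_mod (fun x => x = 0) ys ->
  (size l < size ys)%N -> idl l (a * f) -> idl l a.
Proof.
move=> ysl reg sz /idl_dotp [t ht].
pose z : kos (size (f :: l)) := (kosh t (kemb (size l) 1), - kemb (size l) a).
have dz : kosdeg 1 z.
  by split=> /=; [apply: kosh_deg; apply: kemb_deg | apply: kosdegN; apply: kemb_deg].
have cz : kosd z = 0.
  rewrite /= kosdN (kosd_deg0 (kemb_deg _ _)) oppr0; congr pair; last by rewrite /= oppr0.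
  have := kos_homotopy t (kemb (size l) 1).
  rewrite (kosd_deg0 (kemb_deg _ _)) kosh0 addr0 => ->.
  by rewrite -ht -!kembZ mulr1 scalerN -kembZ mulrC subrr.
have [|||u [du /kosin_eq0 hu]] := @koszul_acyclic (f :: l) ys (fun x => x = 0) 1 z _ ysl reg _ dz _.
- split=> //; first by move=> x y -> ->; rewrite addr0.
  by move=> c x ->; rewrite mulr0.
- by rewrite add1n ltnS.
- by rewrite cz; elim: (size _) => //= n ihn; split.
have {hu} /(congr1 snd) /= /eqP := hu; rewrite opprK addrC subr_eq0 => /eqP hu.
case: u du hu => u1 u2 /= [_ du2].
have [x hx ->] := kosd_deg1 du2.
by move/kemb_inj <-.
Qed.

End Koszul.

(** * Polynomial rings and one-variable annihilators *)

Section MpolyMorphisms.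
Variables (K : comNzRingType) (N : nat).

Lemma mpoly_ring_ind (P : {mpoly K[N]} -> Prop) :
  (forall c, P c%:MP) -> (forall i, P 'X_i) ->
  (forall p q, P p -> P q -> P (p + q)) -> (forall p q, P p -> P q -> P (p * q)) ->
  forall p, P p.
Proof.
move=> PC PX PD PM p; rewrite [p]mpolyE.
elim/big_ind: _ => [||m _]; [by rewrite -mpolyC0|exact: PD|].
rewrite -mul_mpolyC; apply: (PM) => //; rewrite mpolyXE_id.
elim/big_ind: _ => [||i _]; [by rewrite -mpolyC1|exact: PM|].
by elim: (m i) => [|k ih]; rewrite ?expr0 -?mpolyC1 // exprS; apply: PM.
Qed.

Lemma mpoly_rmorph_ext (S : nzRingType) (f g : {rmorphism {mpoly K[N]} -> S}) :
  (forall c, f c%:MP = g c%:MP) -> (forall i, f 'X_i = g 'X_i) -> f =1 g.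
Proof.
move=> hC hX; apply: mpoly_ring_ind => // p q hp hq.
  by rewrite !rmorphD hp hq.
by rewrite !rmorphM hp hq.
Qed.

End MpolyMorphisms.

Section Univariate.
Variables (K : fieldType) (N : nat).
Local Notation R := {mpoly K[N]}.
Implicit Types (J : R -> Prop) (q : {poly K}).

Definition univ (i : 'I_N) q : R := (map_poly (@mpolyC N K) q).['X_i].

(** A polynomial read as a polynomial in X_i over the other variables. The coefficients stay in the
    full ring R, so no ring in N - 1 variables is needed and evaluation at X_i is a left inverse. *)
Definition split_var_map (i : 'I_N) : R -> {poly R} :=
  mmap (polyC \o @mpolyC N K) (fun k => if k == i then 'X else ('X_k)%:P).
HB.instance Definition _ i := GRing.RMorphism.on (split_var_map i).

Lemma split_var_mapC i c : split_var_map i c%:MP = c%:MP%:P.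
Proof. by rewrite /split_var_map mmapC. Qed.

Lemma split_var_mapX i k : split_var_map i 'X_k = if k == i then 'X else ('X_k)%:P.
Proof. by rewrite /split_var_map mmapX mmap1U. Qed.

Lemma split_var_map_univ i k q :
  split_var_map i (univ k q) =
  if k == i then map_poly (@mpolyC N K) q else (univ k q)%:P.
Proof.
rewrite /univ -horner_map /= split_var_mapX -map_poly_comp /=.
have -> : map_poly (split_var_map i \o @mpolyC N K) q =
    map_poly polyC (map_poly (@mpolyC N K) q).
  rewrite -map_poly_comp; apply: eq_map_poly => c /=.
  by rewrite split_var_mapC.
case: eqP => [ki|_].
  by rewrite -[RHS]comp_polyXr /comp_poly.
by rewrite horner_map.
Qed.

Lemma split_var_map_horner i x : (split_var_map i x).['X_i] = x.
Proof.
pose g := horner_eval ('X_i : R) \o split_var_map i.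
apply: (@mpoly_rmorph_ext _ _ _ g idfun) => [c|k] /=.
  by rewrite /g /= split_var_mapC /horner_eval hornerC.
rewrite /g /= split_var_mapX /horner_eval; case: eqP => [->|_].
  by rewrite hornerX.
by rewrite hornerC.
Qed.

(** For an ideal this says that it is generated by polynomials free of X_i. *)
Definition var_graded i J := forall x, J x -> forall j, J (split_var_map i x)`_j.

(** Descending induction on the coefficients of a in X_i: modulo those already known to be in J, the
    top coefficient of a q(X_i) is the one of a times the leading coefficient of q, an invertible
    constant. *)
Lemma univ_nonzerodivisor J i q a :
  ideal J -> var_graded i J -> q != 0 -> J (a * univ i q) -> J a.
Proof.
move=> iJ gJ q0 Jaq.
suff coefJ k j : (size (split_var_map i a) <= j + k)%N -> J (split_var_map i a)`_j.
  rewrite -[a](split_var_map_horner i) horner_coef; apply: ideal_sum => // j _.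
  by apply: idealMr => //; apply: (coefJ (size (split_var_map i a))); rewrite leq_addl.
elim: k j => [|k ih] j; first by rewrite addn0 => /(nth_default _) ->; apply: ideal0.
rewrite addnS => sz; set A := split_var_map i a in ih sz *.
pose Q : {poly R} := map_poly (@mpolyC N K) q.
have sQ : size Q = size q by rewrite size_map_poly_id0 // mpolyC_eq0 lead_coef_eq0.
have := gJ _ Jaq (j + (size q).-1)%N.
rewrite rmorphM /= split_var_map_univ eqxx -/Q -/A coefM.
have lt : (j < (j + (size q).-1).+1)%N by rewrite ltnS leq_addr.
rewrite (bigD1 (Ordinal lt)) //= addKn => JS.
have JT : J (A`_j * (lead_coef q)%:MP).
  have -> : A`_j * (lead_coef q)%:MP = A`_j * Q`_(size q).-1.
    by rewrite coef_map.
  rewrite -[X in J X](addrK (\sum_(i0 < (j + (size q).-1).+1 | i0 != Ordinal lt)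
    A`_i0 * Q`_(j + (size q).-1 - i0))).
  apply: idealB => //; apply: ideal_sum => // t /negP nt.
  have [ltj|gtj|eqj] := ltngtP t j.
  - rewrite [Q`__]nth_default ?mulr0; first exact: ideal0.
    rewrite sQ; have : (0 < size q)%N by rewrite size_poly_gt0.
    by lia.
  - apply: idealMr => //; apply: ih; lia.
  - by case: nt; apply/eqP/val_inj.
rewrite -[A`_j]mulr1 -mpolyC1 -(divff (x := lead_coef q)) ?lead_coef_eq0 //.
by rewrite mpolyCM mulrA; apply: idealMr.
Qed.

(** Adjoining [univ i (q i)] keeps the ideal graded in the variables still to come, so the previous
    lemma can be iterated. *)
Lemma univ_regular (q : 'I_N -> {poly K}) (s : seq 'I_N) J :
  (forall i, q i != 0) -> uniq s -> ideal J -> (forall i, i \in s -> var_graded i J) ->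
  regular_mod J [seq univ i (q i) | i <- s].
Proof.
move=> q0; elim: s J => //= i s ih J /andP [iNs us] iJ gJ; split.
  by move=> a; apply: univ_nonzerodivisor => //; apply: gJ; rewrite mem_head.
apply: ih => //; first exact: ideal_extend.
move=> k ks x [a Ja] j; exists (split_var_map k a)`_j.
have := gJ k _ _ Ja j; rewrite inE ks orbT => /(_ isT).
rewrite rmorphB rmorphM /= split_var_map_univ.
have -> : (i == k) = false by apply/negP => /eqP ik; rewrite ik ks in iNs.
by rewrite coefB coefMC.
Qed.

(** For an ideal this amounts to a finite-dimensional quotient; in this form it supplies the regular
    sequence used in [unmixed]. *)
Definition algebraic_mod J := forall i, exists q, q != 0 /\ J (univ i q).

Lemma ideal_subsp J : ideal J -> subsp J.
Proof.
move=> iJ; split; first exact: ideal0.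
by move=> a x y Jx Jy; apply: idealD => //; rewrite -mul_mpolyC; apply: idealMl.
Qed.

Lemma univX i k : univ i 'X^k = 'X_i ^+ k.
Proof. by rewrite /univ map_polyXn hornerXn. Qed.

Lemma univZ i a q : univ i (a *: q) = a *: univ i q.
Proof. by rewrite /univ map_polyZ hornerZ mul_mpolyC. Qed.

Lemma univM i p q : univ i (p * q) = univ i p * univ i q.
Proof. by rewrite /univ rmorphM hornerM. Qed.

Lemma univD i p q : univ i (p + q) = univ i p + univ i q.
Proof. by rewrite /univ rmorphD hornerD. Qed.

Lemma univ0 i : univ i 0 = 0.
Proof. by rewrite /univ rmorph0 horner0. Qed.

Lemma univXk i q k : univ i (q ^+ k) = univ i q ^+ k.
Proof. by rewrite /univ rmorphXn /= horner_exp. Qed.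

Lemma spanned_algebraic J (I : finType) (b : I -> R) :
  ideal J -> (forall x, spanned J b x) -> algebraic_mod J.
Proof.
move=> iJ sp i; apply: NNPP => nq.
have : indep J (fun k : 'I_(#|I|.+1) => ('X_i : R) ^+ k).
  move=> l Jl k; apply/eqP/negP => /negP lk; apply: nq.
  exists (\sum_k l k *: 'X^k); split.
    apply: contra lk => /eqP /(congr1 (fun p : {poly K} => p`_k)).
    rewrite coef_sum coef0 (bigD1 k) //= coefZ coefXn eqxx mulr1 big1 ?addr0.
      by move->.
    move=> t tk; rewrite coefZ coefXn eq_sym.
    by have /negPf -> : (t != k :> nat) by []; rewrite mulr0.
  suff -> : univ i (\sum_k l k *: 'X^k) = \sum_k l k *: 'X_i ^+ k by [].
  elim/big_ind2: _ => [|x x' y y' <- <-|t _]; [exact: univ0|exact: univD|].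
  by rewrite univZ univX.
move/(indep_card_le (ideal_subsp iJ))/(_ (fun k => sp _)).
by rewrite card_ord ltnn.
Qed.

Definition idealOf (P : pred 'I_N) (f : 'I_N -> R) := idl [seq f i | i in P].

Lemma idealOf_ideal P f : ideal (idealOf P f).
Proof. exact: idl_ideal. Qed.

Lemma idealOf_mem (P : pred 'I_N) f i : P i -> idealOf P f (f i).
Proof. by move=> Pi; apply: idl_mem; apply: image_f. Qed.

Lemma idealOf_least (P : pred 'I_N) f J x :
  ideal J -> (forall i, P i -> J (f i)) -> idealOf P f x -> J x.
Proof.
move=> iJ h; apply: idl_least => // y /imageP [i Pi ->]; exact: h.
Qed.

(* Unmixedness: [N] elements of a polynomial ring in [N] variables with
   finite-dimensional quotient form a regular sequence in any order. *)
Lemma unmixed (f : 'I_N -> R) j a :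
  algebraic_mod (idealOf predT f) ->
  idealOf (predC1 j) f (a * f j) -> idealOf (predC1 j) f a.
Proof.
move=> alg; have [q hq] : exists q : 'I_N -> {poly K},
    forall i, q i != 0 /\ idealOf predT f (univ i (q i)).
  by apply: (@fin_all_exists _ (fun=> {poly K}) (fun i q => q != 0 /\ _ (univ i q))).
(* The N one-variable annihilators are a regular sequence in the ideal of [f], one longer than the
   list of the generators other than [f j]. *)
apply: (@koszul_nonzerodivisor _ (f j) _ [seq univ i (q i) | i <- enum 'I_N]).
- move=> y /mapP [i _ ->]; have [_] := hq i.
  apply: idealOf_least; first exact: idl_ideal.
  move=> k _; apply: idl_mem; rewrite inE.
  by have [->|kj] := eqVneq k j; rewrite ?eqxx // image_f ?orbT.
- apply: univ_regular => //; first by move=> i; case: (hq i).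
  + exact: enum_uniq.
  + split=> //; first by move=> x y -> ->; rewrite addr0.
    by move=> b x ->; rewrite mulr0.
  + by move=> i _ x -> k; rewrite rmorph0 coef0.
- rewrite size_map size_image -cardE card_ord cardC1 card_ord.
  by case: (N) j => [[]|].
Qed.

End Univariate.

(** * Quasi-regularity: independence over K[c] *)

Section QuasiRegular.
Variables (K : fieldType) (N : nat).
Local Notation R := {mpoly K[N]}.
Implicit Types (J : R -> Prop) (c : 'I_N -> R).

Definition mev c : {mpoly K[N]} -> R := mmap (@mpolyC N K) c.
HB.instance Definition _ c := GRing.RMorphism.on (mev c).

Lemma mevC c a : mev c a%:MP = a%:MP.
Proof. by rewrite /mev mmapC. Qed.

Lemma mevXU c i : mev c 'X_i = c i.
Proof. by rewrite /mev mmapX mmap1U. Qed.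

Lemma mevZ c a g : mev c (a *: g) = a *: mev c g.
Proof. by rewrite /mev mmapZ mul_mpolyC. Qed.

Lemma algebraic_mod_pow c (e : 'I_N -> nat) J :
  algebraic_mod (idealOf predT c) -> ideal J -> (forall i, J (c i ^+ e i)) ->
  algebraic_mod J.
Proof.
move=> alg iJ hJ i; have [q [q0 hq]] := alg i.
have [k hk] : nil_mod J (univ i q).
  by move: hq; apply: idealOf_least; [apply: nil_mod_ideal|move=> j _; exists (e j)].
by exists (q ^+ k); rewrite univXk expf_neq0.
Qed.

Lemma idealOf_D1 (f : 'I_N -> R) j x :
  idealOf predT f x -> exists z, idealOf (predC1 j) f (x - z * f j).
Proof.
apply: (@idealOf_least _ _ _ _ (fun x => exists z, idealOf (predC1 j) f (x - z * f j))).
  by apply: ideal_extend; apply: idealOf_ideal.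
move=> i _; have [->|ij] := eqVneq i j.
  by exists 1; rewrite mul1r subrr; apply: ideal0; apply: idealOf_ideal.
by exists 0; rewrite mul0r subr0; apply: idealOf_mem.
Qed.

(** One index at a time: if x u c_j^k = z c_j^(k+1) modulo the other generators, unmixedness with
    c_j^k in position j cancels c_j^k and leaves x u in the ideal that has c_j itself in that
    position. *)
Lemma pow_strip c k (s : seq 'I_N) x :
  algebraic_mod (idealOf predT c) -> uniq s ->
  idealOf predT (fun i => c i ^+ (if i \in s then k.+1 else 1%N))
    (x * \prod_(i <- s) c i ^+ k) ->
  idealOf predT c x.
Proof.
move=> alg; elim: s => [|j s ih] /=.
  move=> _; rewrite big_nil mulr1; apply: idealOf_least; first exact: idealOf_ideal.
  by move=> i _; rewrite expr1; apply: idealOf_mem.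
move=> /andP [jNs us]; rewrite big_cons mulrCA.
set u := \prod_(i <- s) _; set e := fun i : 'I_N => if i \in j :: s then k.+1 else 1%N.
move=> /(idealOf_D1 j) [z]; rewrite -/e mem_head.
have -> : c j ^+ k * (x * u) - z * c j ^+ k.+1 = (x * u - z * c j) * c j ^+ k.
  by rewrite exprSr; ring.
move=> hz.
apply: ih => //; rewrite -/u.
pose f i := if i == j then c j ^+ k else c i ^+ e i.
have /unmixed hf : algebraic_mod (idealOf predT f).
  apply: (@algebraic_mod_pow c (fun i => if i == j then k else e i)) => //.
    exact: idealOf_ideal.
  move=> i; have -> : c i ^+ (if i == j then k else e i) = f i.
    by rewrite /f; case: eqP => // ->.
  exact: idealOf_mem.
have {hz} : idealOf (predC1 j) f (x * u - z * c j).
  apply: hf; rewrite {2}/f eqxx.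
  move: hz; apply: idealOf_least; first exact: idealOf_ideal.
  move=> i ij; have -> : c i ^+ e i = f i by rewrite /f (negPf ij).
  exact: idealOf_mem.
set f' := (fun i => _) => h.
rewrite -[x * u](subrK (z * c j)); apply: idealD; first exact: idealOf_ideal.
  move: h; apply: idealOf_least; first exact: idealOf_ideal.
  move=> i ij; have -> : f i = f' i.
    by rewrite /f /f' /e (negPf ij) inE (negPf ij).
  exact: idealOf_mem.
apply: idealMl; first exact: idealOf_ideal.
have -> : c j = f' j by rewrite /f' (negPf jNs).
exact: idealOf_mem.
Qed.

(** The family [b] is independent over K[c]. Coefficients are killed by increasing degree: for an
    exponent a of the current degree, the factor W = prod c_t^(k - a_t) sends every other monomial
    of at least that degree into the ideal of the c_t^(k+1), since one of its exponents exceeds that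
    of a. What remains is a combination of the b_i times prod c_t^k, which [pow_strip] removes. *)
Lemma quasi_regular c (I : finType) (b : I -> R) (g : I -> {mpoly K[N]}) :
  algebraic_mod (idealOf predT c) -> indep (idealOf predT c) b ->
  \sum_i b i * mev c (g i) = 0 -> forall i, g i = 0.
Proof.
move=> alg ib rel; set k := \max_(i : I) msize (g i).
suff low n i m : (mdeg m < n)%N -> (g i)@_m = 0.
  by move=> i; apply/mpolyP => m; rewrite mcoeff0; apply: (low (mdeg m).+1).
elim: n i m => // n ih i a lea.
have lowa i' m : (mdeg m < mdeg a)%N -> (g i')@_m = 0.
  by move=> lt; apply: ih; apply: leq_trans lt lea.
(* Exponents of degree at least k lie outside all supports; for the others k bounds every a_t, so
   the subtractions in W are exact. *)
have [ka|ka] := leqP k (mdeg a).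
  apply: memN_msupp_eq0; apply: msize_mdeg_ge; apply: leq_trans ka.
  exact: (leq_bigmax_cond i).
have ak t : (a t <= k)%N.
  by apply: leq_trans (ltnW ka); rewrite mdegE (bigD1 t) //= leq_addr.
pose W := \prod_(t < N) c t ^+ (k - a t)%N.
pose Q := idealOf predT (fun t => c t ^+ k.+1).
have iQ : ideal Q by exact: idealOf_ideal.
have higher m : m != a -> (mdeg a <= mdeg m)%N -> Q (mmap1 c m * W).
  move=> ma dm; have [t tm] : exists t, (a t < m t)%N.
    apply/existsP; apply: contraR ma; rewrite negb_exists => /forallP h.
    have hle t : (m t <= a t)%N by rewrite leqNgt; apply: h.
    apply/eqP/mnmP => t; apply/eqP; rewrite eqn_leq hle /=.
    rewrite leqNgt; apply/negP => mt; move: dm; rewrite !mdegE leqNgt => /negP; apply.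
    rewrite (bigD1 t) //= [X in (_ < X)%N](bigD1 t) //= -addSn leq_add //.
    by apply: leq_sum.
  rewrite /mmap1 /W -big_split /= (bigD1 t) //=; apply: idealMr => //.
  rewrite -exprD; have -> : (m t + (k - a t) = k.+1 + (m t - (a t).+1))%N.
    by have := ak t; lia.
  rewrite exprD; apply: idealMr => //.
  exact: (@idealOf_mem _ _ predT (fun t => c t ^+ k.+1)).
have red i' : Q (mev c (g i') * W - (g i')@_a *: \prod_t c t ^+ k).
  have aW : mmap1 c a * W = \prod_t c t ^+ k.
    rewrite /mmap1 /W -big_split /=; apply: eq_bigr => t _.
    by rewrite -exprD subnKC.
  have -> : mev c (g i') * W - (g i')@_a *: \prod_t c t ^+ k =
    \sum_(m <- msupp (g i') | m != a) ((g i')@_m)%:MP * mmap1 c m * W.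
    rewrite /mev /mmap mulr_suml.
    have [ain|aN] := boolP (a \in msupp (g i')).
      rewrite (bigD1_seq a) ?msupp_uniq //= -mulrA aW mul_mpolyC.
      by rewrite addrAC subrr add0r.
    rewrite (memN_msupp_eq0 aN) scale0r subr0 [RHS]big_mkcond /=.
    rewrite big_seq [RHS]big_seq; apply: eq_bigr => m min.
    by case: eqP aN => // <-; rewrite min.
  apply: ideal_sum => // m ma; rewrite -mulrA.
  have [lt|ge] := ltnP (mdeg m) (mdeg a).
    by rewrite lowa // mpolyC0 mul0r; apply: ideal0.
  by apply: idealMl => //; apply: higher.
apply: (ib (fun i' => (g i')@_a)).
apply: (@pow_strip c k (enum 'I_N)) => //; first exact: enum_uniq.
have -> : \prod_(t <- enum 'I_N) c t ^+ k = \prod_t c t ^+ k by rewrite big_enum.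
have : Q (\sum_i' b i' * ((g i')@_a *: \prod_t c t ^+ k)).
  have -> : \sum_i' b i' * ((g i')@_a *: \prod_t c t ^+ k) =
     (\sum_i' b i' * mev c (g i')) * W -
     \sum_i' b i' * (mev c (g i') * W - (g i')@_a *: \prod_t c t ^+ k).
    rewrite mulr_suml -sumrB; apply: eq_bigr => i' _.
    by rewrite mulrBr mulrA opprB addrC subrK.
  rewrite rel mul0r sub0r; apply: idealN => //.
  by apply: ideal_sum => // i' _; apply: idealMl.
have -> : \sum_i' b i' * ((g i')@_a *: \prod_t c t ^+ k) =
   (\sum_i' (g i')@_a *: b i') * \prod_t c t ^+ k.
  rewrite mulr_suml; apply: eq_bigr => i' _.
  by rewrite -scalerAr scalerAl.
apply: idealOf_least; first exact: idealOf_ideal.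
move=> t _; set F := (fun t => _).
have -> : c t ^+ k.+1 = F t by rewrite /F mem_enum.
exact: idealOf_mem.
Qed.

Lemma mevX c m : mev c 'X_[m] = mmap1 c m.
Proof. by rewrite /mev mmapX. Qed.

End QuasiRegular.
#[global] Opaque mev.

(** * Filtrations and the dimension of fibers *)

Section WeightedDegree.
Variables (K : fieldType) (N : nat) (e : 'I_N -> nat).
Local Notation P := {mpoly K[N]}.

Definition wt (m : 'X_{1..N}) := (\sum_k m k * e k)%N.

Lemma wtD m1 m2 : wt (m1 + m2)%MM = (wt m1 + wt m2)%N.
Proof. by rewrite /wt -big_split /=; apply: eq_bigr => k _; rewrite mnmDE mulnDl. Qed.

Lemma wt0 : wt 0%MM = 0%N.
Proof. by rewrite /wt big1 // => k _; rewrite mnm0E. Qed.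

Lemma wtU k : wt U_(k)%MM = e k.
Proof.
rewrite /wt (bigD1 k) //= mnm1E eqxx mul1n big1 ?addn0 // => j jk.
by rewrite mnm1E eq_sym (negPf jk).
Qed.

Definition wle t (g : P) := forall m, m \in msupp g -> (wt m <= t)%N.

Lemma wle_leq t t' g : (t <= t')%N -> wle t g -> wle t' g.
Proof. by move=> tt h m /h mt; apply: leq_trans mt tt. Qed.

Lemma wleC t a : wle t a%:MP.
Proof. by move=> m; rewrite msuppC; case: eqP => // _; rewrite inE => /eqP ->; rewrite wt0. Qed.

Lemma wle0 t : wle t 0.
Proof. by rewrite -mpolyC0; apply: wleC. Qed.

Lemma wleD t p q : wle t p -> wle t q -> wle t (p + q).
Proof. by move=> hp hq m /msuppD_le; rewrite mem_cat => /orP [/hp|/hq]. Qed.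

Lemma wle_sum t (I : Type) (r : seq I) (Q : pred I) (F : I -> P) :
  (forall i, Q i -> wle t (F i)) -> wle t (\sum_(i <- r | Q i) F i).
Proof. by move=> h; elim/big_ind: _ => //; [apply: wle0|move=> x y; apply: wleD]. Qed.

Lemma wleM t t' p q : wle t p -> wle t' q -> wle (t + t') (p * q).
Proof.
move=> hp hq m /msuppM_le /allpairsP [[m1 m2] /= [h1 h2 ->]].
by rewrite wtD leq_add //; [apply: hp|apply: hq].
Qed.

Lemma wleX k : wle (e k) 'X_k.
Proof. by move=> m; rewrite msuppX inE => /eqP ->; rewrite wtU. Qed.

Lemma wle_exists (g : P) : exists t, wle t g.
Proof.
exists (\sum_(m <- msupp g) wt m)%N => m mg.
by rewrite (bigD1_seq m) ?msupp_uniq //= leq_addr.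
Qed.

Lemma wle_exists_fin (I : finType) (g : I -> P) : exists t, forall i, wle t (g i).
Proof.
have [t ht] := @fin_all_exists _ _ _ (fun i => wle_exists (g i)).
exists (\max_i t i) => i; apply: wle_leq (ht i); exact: leq_bigmax.
Qed.

(** The cap t on the exponents makes the type finite and loses nothing when the weights are
    positive. *)
Definition mon t := {a : N.-tuple 'I_t.+1 | (\sum_k tnth a k * e k <= t)%N}.
HB.instance Definition _ t := Finite.on (mon t).

Definition mon_mnm t (a : mon t) : 'X_{1..N} := [multinom (tnth (val a) k : nat) | k < N].

Lemma mon_mnm_inj t : injective (@mon_mnm t).
Proof.
move=> a b ab; apply/val_inj/eq_from_tnth => k; apply/val_inj.
by move/mnmP: ab => /(_ k); rewrite !mnmE.
Qed.

Lemma wt_mon t (a : mon t) : (wt (mon_mnm a) <= t)%N.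
Proof.
have := valP a; rewrite /wt; congr (_ <= _)%N; apply: eq_bigr => k _.
by rewrite mnmE.
Qed.

Lemma mon_mnm_surj t m : (forall k, 0 < e k)%N -> (wt m <= t)%N ->
  exists a : mon t, mon_mnm a = m.
Proof.
move=> e0 mt; have mk k : (m k < t.+1)%N.
  rewrite ltnS; apply: leq_trans mt; rewrite /wt (bigD1 k) //=.
  by apply: leq_trans (leq_addr _ _); rewrite leq_pmulr.
have ha : (\sum_k tnth [tuple Ordinal (mk k) | k < N] k * e k <= t)%N.
  apply: leq_trans mt; rewrite /wt; apply: leq_sum => k _.
  by rewrite tnth_mktuple.
exists (exist (fun a : N.-tuple (ordinal t.+1) => is_true (\sum_k tnth a k * e k <= t)%N) _ ha).
by apply/mnmP => k; rewrite mnmE /= tnth_mktuple.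
Qed.

End WeightedDegree.

Section Growth.
Variables (K : fieldType) (N : nat).
Local Notation R := {mpoly K[N]}.
Local Notation zero := (fun x : R => x = 0).
Implicit Types (c : 'I_N -> R) (e : 'I_N -> nat) (Fil : nat -> R -> Prop).

Record filtration Fil : Prop := Filtration {
  fil_subsp : forall m, subsp (Fil m);
  fil_mono : forall m x, Fil m x -> Fil m.+1 x;
  fil_mul : forall a b x y, Fil a x -> Fil b y -> Fil (a + b)%N (x * y);
  fil_one : Fil 0%N 1;
  fil_exh : forall x, exists m, Fil m x;
  fil_fin : forall m, exists r, exists v : 'I_r -> R, forall x, Fil m x -> spanned zero v x }.

(** The field [adm_gen] says that beyond degree B the associated graded ring vanishes modulo the
    symbols of the c_k, that is, c has no common zero at infinity. The bound e k <= B keeps m - e k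
    an exact subtraction. *)
Record admissible Fil e c : Prop := Admissible {
  adm_pos : forall k, (0 < e k)%N;
  adm_deg : forall k, Fil (e k) (c k);
  adm_gen : exists B, (forall k, e k <= B)%N /\ forall m x, (B < m)%N -> Fil m x ->
    exists x0, exists y : 'I_N -> R,
      [/\ Fil m.-1 x0, forall k, Fil (m - e k)%N (y k) & x = x0 + \sum_k c k * y k] }.

Lemma fil_leq Fil m m' x : filtration Fil -> (m <= m')%N -> Fil m x -> Fil m' x.
Proof.
move=> hF /subnKC <-; elim: (m' - m)%N => [|k ih]; first by rewrite addn0.
by move=> /ih; rewrite addnS; apply: fil_mono.
Qed.

Lemma fil_const Fil m a : filtration Fil -> Fil m a%:MP.
Proof.
move=> hF; apply: (fil_leq hF (leq0n m)).
rewrite -[a%:MP]mulr1 mul_mpolyC; apply: subspZ; [exact: fil_subsp|exact: fil_one].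
Qed.

(** K[F] is a finite module over K[c], with control of degrees: [adm_gen] is iterated down to degree
    B, where finitely many vectors suffice. *)
Lemma fil_expand Fil e c : filtration Fil -> admissible Fil e c ->
  exists r, exists v : 'I_r -> R, forall m x, Fil m x ->
  exists g : 'I_r -> {mpoly K[N]},
    (forall j, wle e m (g j)) /\ x = \sum_j v j * mev c (g j).
Proof.
move=> hF [epos cdeg [B [eB gen]]]; have [r [v hv]] := fil_fin hF B.
exists r, v => m; elim/ltn_ind: m => m ih x xm.
have [mB|Bm] := leqP m B.
  have [l hl] := hv _ (fil_leq hF mB xm).
  exists (fun j => (l j)%:MP); split; first by move=> j; apply: wleC.
  move/eqP: hl; rewrite subr_eq0 => /eqP ->; apply: eq_bigr => j _.
  by rewrite mevC mulrC mul_mpolyC.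
have [x0 [y [hx0 hy ->]]] := gen m x Bm xm.
have [|g0 [wg0 ->]] := ih m.-1 _ x0 hx0; first by lia.
have /fin_all_exists [g hg] : forall k, exists gk : 'I_r -> {mpoly K[N]},
    (forall j, wle e (m - e k) (gk j)) /\ y k = \sum_j v j * mev c (gk j).
  by move=> k; apply: ih (hy k); have := epos k; have := eB k; lia.
exists (fun j => g0 j + \sum_k 'X_k * g k j); split.
  move=> j; apply: wleD; first by apply: wle_leq (wg0 j); lia.
  apply: wle_sum => k _; have [wk _] := hg k.
  have -> : m = (e k + (m - e k))%N by have := eB k; lia.
  by apply: wleM; [apply: wleX|apply: wk].
have eqj j : v j * mev c (g0 j + \sum_k 'X_k * g k j) =
    v j * mev c (g0 j) + \sum_k v j * mev c ('X_k * g k j).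
  by rewrite rmorphD rmorph_sum mulrDr -mulr_sumr.
under [RHS]eq_bigr do rewrite eqj.
rewrite big_split [X in _ = _ + X]exchange_big /=; congr (_ + _); apply: eq_bigr => k _.
have [_ ->] := hg k; rewrite mulr_sumr; apply: eq_bigr => j _.
by rewrite rmorphM /= mevXU mulrCA.
Qed.

Lemma mev_shift_ideal c (p : 'I_N -> K) g :
  idealOf predT (fun k => c k - (p k)%:MP) (mev c g - (g.@[p])%:MP).
Proof.
set J := idealOf _ _; have iJ : ideal J by exact: idealOf_ideal.
elim/mpoly_ring_ind: g => [a|k|x y hx hy|x y hx hy].
- by rewrite mevC mevalC subrr; apply: ideal0.
- by rewrite mevXU mevalXU; apply: (@idealOf_mem _ _ predT).
- by rewrite rmorphD mevalD mpolyCD opprD addrACA; apply: idealD.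
rewrite rmorphM /= mevalM mpolyCM.
set u := (x.@[p])%:MP in hx *; set w := (y.@[p])%:MP in hy *.
have -> : mev c x * mev c y - u * w = mev c x * (mev c y - w) + (mev c x - u) * w by ring.
by apply: idealD => //; [apply: idealMl|apply: idealMr].
Qed.

Lemma fiber_spanned Fil e c (p : 'I_N -> K) : filtration Fil -> admissible Fil e c ->
  exists r, exists v : 'I_r -> R, forall x,
    spanned (idealOf predT (fun k => c k - (p k)%:MP)) v x.
Proof.
move=> hF hc; have [r [v hv]] := fil_expand hF hc; exists r, v => x.
have [m xm] := fil_exh hF x; have [g [_ ->]] := hv _ _ xm.
exists (fun j => (g j).@[p]); rewrite -sumrB; apply: ideal_sum => [|j _].
  exact: idealOf_ideal.
rewrite -mul_mpolyC [_ * v j]mulrC -mulrBr.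
by apply: idealMl; [apply: idealOf_ideal|apply: mev_shift_ideal].
Qed.

(** Constants have lower filtration degree than the c_k, so the condition at infinity is the same
    for all fibers. *)
Lemma admissible_shift Fil e c (p : 'I_N -> K) : filtration Fil ->
  admissible Fil e c -> admissible Fil e (fun k => c k - (p k)%:MP).
Proof.
move=> hF [epos cdeg [B [eB gen]]]; split=> //.
  by move=> k; apply: subspB; [apply: fil_subsp|apply: cdeg|apply: fil_const].
exists B; split=> // m x Bm xm; have [x0 [y [hx0 hy ->]]] := gen m x Bm xm.
exists (x0 + \sum_k (p k)%:MP * y k), y; split=> //.
  apply: subspD => //; first exact: fil_subsp.
  apply: subsp_sum => [|k _]; first exact: fil_subsp.
  rewrite mul_mpolyC; apply: subspZ; first exact: fil_subsp.
  by apply: fil_leq (hy k) => //; have := epos k; lia.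
rewrite -addrA -big_split /=; congr (_ + _); apply: eq_bigr => k _.
by rewrite mulrBl addrC subrK.
Qed.

Lemma fiber_algebraic Fil e c (p : 'I_N -> K) : filtration Fil -> admissible Fil e c ->
  algebraic_mod (idealOf predT (fun k => c k - (p k)%:MP)).
Proof.
move=> hF hc; have [r [v hv]] := fiber_spanned p hF hc.
by apply: spanned_algebraic hv; apply: idealOf_ideal.
Qed.

(** The c_k are algebraically independent. Shifting by p = c(0) puts the origin on the fiber; then 1
    is independent modulo the shifted ideal, and [quasi_regular] applies to the family consisting of
    1. *)
Lemma mev_neq0 Fil e c (s : {mpoly K[N]}) : filtration Fil -> admissible Fil e c ->
  s.@[fun=> 0] != 0 -> mev c s != 0.
Proof.
move=> hF hc s0; apply/negP => /eqP cs0.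
pose p k := (c k).@[fun=> 0].
have alg := fiber_algebraic p hF hc; set c' := (fun k => _) in alg.
pose sh := mev (fun k : 'I_N => 'X_k + (p k)%:MP : R).
have i1 : indep (idealOf predT c') (fun _ : 'I_1 => 1 : R).
  move=> l; rewrite big_ord1 => hl i; rewrite ord1.
  suff : (l ord0 *: (1 : R)).@[fun=> 0] = 0 by rewrite mevalZ meval1 mulr1.
  move: hl; apply: (@idealOf_least _ _ _ _ (fun x : R => x.@[fun=> 0] = 0)).
    split; first by rewrite meval0.
      by move=> x y hx hy; rewrite mevalD hx hy addr0.
    by move=> a x hx; rewrite mevalM hx mulr0.
  by move=> k _; rewrite mevalB mevalC subrr.
have comp : mev c' (sh s) = mev c s.
  apply: (@mpoly_rmorph_ext _ _ _ (mev c' \o sh) (mev c)) => [a|k] /=.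
    by rewrite /sh !mevC.
  by rewrite /sh !mevXU rmorphD /= mevC mevXU subrK.
have sh0 : sh s = 0.
  by apply: (quasi_regular alg i1 (g := fun=> sh s) _ ord0); rewrite big_ord1 mul1r comp.
move/negP: s0; apply; apply/eqP.
have <- : (sh s).@[fun k => - p k] = s.@[fun=> 0].
  apply: (@mpoly_rmorph_ext _ _ _ (meval (fun k => - p k) \o sh) (meval (fun=> 0))) => [a|k] /=.
    by rewrite /sh mevC !mevalC.
  by rewrite /sh mevXU mevalD mevalXU mevalC mevalXU addNr.
by rewrite sh0 meval0.
Qed.

(** The products b_i c^a are independent by [quasi_regular]; E bounds the degrees of the b_i. *)
Lemma growth_lower Fil e c r (b : 'I_r -> R) :
  filtration Fil -> admissible Fil e c -> indep (idealOf predT c) b ->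
  exists E, forall m, exists v : 'I_r * mon e m -> R,
    indep zero v /\ forall i, Fil (m + E)%N (v i).
Proof.
move=> hF hc ib; have [d hd] := @fin_all_exists _ _ _ (fun i => fil_exh hF (b i)).
exists (\max_i d i) => m; exists (fun ia => b ia.1 * mmap1 c (mon_mnm ia.2)); split.
  move=> l hl [i a].
  have alg : algebraic_mod (idealOf predT c).
    have := fiber_algebraic (fun=> 0) hF hc.
    have h k : c k - 0%:MP = c k by rewrite mpolyC0 subr0.
    move=> hq i'; have [q [q0 hi]] := hq i'; exists q; split=> //.
    move: hi; apply: idealOf_least; first exact: idealOf_ideal.
    by move=> k _; rewrite h; apply: (@idealOf_mem _ _ predT).
  have : \sum_a0 l (i, a0) *: 'X_[mon_mnm a0] = 0 :> {mpoly K[N]}.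
    apply: (quasi_regular alg ib (g := fun i => \sum_a l (i, a) *: 'X_[mon_mnm a])).
    rewrite -[RHS]hl [RHS](eq_bigr (fun ia => l (ia.1, ia.2) *: (b ia.1 * mmap1 c (mon_mnm ia.2))));
      last by case.
    rewrite -(pair_bigA _ (fun i a => l (i, a) *: (b i * mmap1 c (mon_mnm a)))) /=.
    apply: eq_bigr => i' _; rewrite rmorph_sum mulr_sumr; apply: eq_bigr => a' _.
    by rewrite /= mevZ mevX scalerAr.
  move/(congr1 (mcoeff (mon_mnm a))); rewrite raddf_sum mcoeff0 (bigD1 a) //=.
  rewrite mcoeffZ mcoeffX eqxx mulr1 big1 ?addr0 // => a' aa'.
  rewrite mcoeffZ mcoeffX; case: eqP => [/mon_mnm_inj eaa|_]; last by rewrite mulr0.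
  by rewrite eaa eqxx in aa'.
move=> [i a] /=; rewrite addnC; apply: (fil_mul hF).
  by apply: fil_leq (hd i) => //; apply: leq_bigmax.
apply: (fil_leq hF (wt_mon a)); rewrite /wt /mmap1.
elim/big_ind2: _ => [|x1 x2 y1 y2 h1 h2|k _].
- exact: fil_one.
- exact: fil_mul.
elim: (mon_mnm a k) => [|n ihn]; first by rewrite expr0; apply: fil_one.
by rewrite exprS mulSn; apply: fil_mul => //; apply: (adm_deg hc).
Qed.

Lemma idealOf_sum c x : idealOf predT c x -> exists y : 'I_N -> R, x = \sum_k c k * y k.
Proof.
apply: (@idealOf_least _ _ _ _ (fun x => exists y : 'I_N -> R, x = \sum_k c k * y k)).
  split; first by exists (fun=> 0); rewrite big1 // => k _; rewrite mulr0.
    move=> x1 x2 [y1 ->] [y2 ->]; exists (fun k => y1 k + y2 k).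
    by rewrite -big_split /=; apply: eq_bigr => k _; rewrite mulrDr.
  move=> a x1 [y ->]; exists (fun k => a * y k); rewrite mulr_sumr.
  by apply: eq_bigr => k _; rewrite mulrCA.
move=> i _; exists (fun k => (k == i)%:R); rewrite (bigD1 i) //= eqxx mulr1 big1 ?addr0 //.
by move=> k /negPf ->; rewrite mulr0.
Qed.

(* Nakayama: expressing generators v of R over K[c] through a basis b of R/(c)
   gives (1 - T) v = L b with T = 0 at the origin, so that det (1 - T)
   multiplies R into the span of the b_i over K[c]. *)
Lemma growth_upper Fil e c r (b : 'I_r -> R) :
  filtration Fil -> admissible Fil e c -> (forall x, spanned (idealOf predT c) b x) ->
  exists E, forall m (I : finType) (w : I -> R),
    indep zero w -> (forall i, Fil m (w i)) -> (#|I| <= r * #|{: mon e (m + E)}|)%N.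
Proof.
move=> hF hc sb; have [M [v hv]] := fil_expand hF hc.
have /fin_all_exists [L hL] : forall j, exists Lj : 'I_r -> K,
    idealOf predT c (v j - \sum_i Lj i *: b i) by move=> j; apply: sb.
have /fin_all_exists [T hT] : forall j, exists Tj : 'I_M -> {mpoly K[N]},
    (forall l, (Tj l).@[fun=> 0] = 0) /\
    v j - \sum_i L j i *: b i = \sum_l v l * mev c (Tj l).
  move=> j.
  have [y ->] := idealOf_sum (hL j).
  have /fin_all_exists [g hg] : forall k, exists gk : 'I_M -> {mpoly K[N]},
      y k = \sum_l v l * mev c (gk l).
    by move=> k; have [m ym] := fil_exh hF (y k); have [g [_ ->]] := hv _ _ ym; exists g.
  exists (fun l => \sum_k 'X_k * g k l); split.
    move=> l; rewrite raddf_sum big1 // => k _.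
    by rewrite /= mevalM mevalXU mul0r.
  have eql l : v l * mev c (\sum_k 'X_k * g k l) = \sum_k v l * mev c ('X_k * g k l).
    by rewrite rmorph_sum -mulr_sumr.
  under [RHS]eq_bigr do rewrite eql.
  rewrite exchange_big /=; apply: eq_bigr => k _.
  rewrite hg mulr_sumr; apply: eq_bigr => l _.
  by rewrite rmorphM /= mevXU mulrCA.
pose U : 'M[{mpoly K[N]}]_M := 1%:M - \matrix_(j, l) T j l.
pose vv : 'cV[R]_M := \col_j v j.
pose bb : 'cV[R]_r := \col_i b i.
pose LL : 'M[{mpoly K[N]}]_(M, r) := \matrix_(j, i) (L j i)%:MP.
have UL : map_mx (mev c) U *m vv = map_mx (mev c) LL *m bb.
  rewrite map_mxB map_mx1 mulmxBl mul1mx; apply/colP => j; rewrite !mxE.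
  have hj : v j - \sum_l v l * mev c (T j l) = \sum_i L j i *: b i.
    by have [_ <-] := hT j; rewrite subKr.
  transitivity (\sum_i L j i *: b i).
    rewrite -hj; congr (_ - _); apply: eq_bigr => l _.
    by rewrite !mxE mulrC.
  by apply: eq_bigr => i _; rewrite !mxE mevC mul_mpolyC.
set s := \det U.
have s0 : s.@[fun=> 0] != 0.
  rewrite -det_map_mx (_ : map_mx _ _ = 1%:M) ?det1 ?oner_eq0 //.
  apply/matrixP => j l; rewrite !mxE rmorphB /=; have [-> _] := hT j.
  by rewrite subr0; case: (j == l); rewrite ?mulr1n ?mulr0n ?meval1 ?meval0.
have cs0 := mev_neq0 hF hc s0.
pose h := \adj U *m LL.
have hsv : mev c s *: vv = map_mx (mev c) h *m bb.
  rewrite map_mxM -mulmxA -UL mulmxA -map_mxM mul_adj_mx.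
  by rewrite map_scalar_mx mul_scalar_mx.
have [E hE] := wle_exists_fin e (fun ji : 'I_M * 'I_r => h ji.1 ji.2).
exists E => m I w iw Fw.
pose bc (ia : 'I_r * mon e (m + E)) := b ia.1 * mmap1 c (mon_mnm ia.2).
have -> : (r * #|{: mon e (m + E)}|)%N = #|{: 'I_r * mon e (m + E)}|.
  by rewrite card_prod card_ord.
(* Multiplication by s(c), nonzero by [mev_neq0], is injective and carries w into the span of the
   products b_i c^a with a of weight at most m + E. *)
apply: (@indep_inj_card _ _ _ _ zero w bc (fun x => mev c s * x)) => //.
- exact: subsp_eq0.
- by move=> l; rewrite mulr_sumr; apply: eq_bigr => i _; rewrite scalerAr.
- by move=> x /eqP; rewrite mulf_eq0 (negPf cs0) => /eqP.
move=> i; have [g [wg ->]] := hv _ _ (Fw i).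
have sv j : mev c s * v j = \sum_i b i * mev c (h j i).
  move/colP: hsv => /(_ j); rewrite !mxE => ->; apply: eq_bigr => i' _.
  by rewrite !mxE mulrC.
rewrite mulr_sumr; have ss : subsp (spanned zero bc) by apply: spanned_subsp; apply: subsp_eq0.
apply: subsp_sum => [|j _]; first exact: ss.
rewrite mulrA sv mulr_suml; apply: subsp_sum => [|i' _].
  exact: ss.
rewrite -mulrA -rmorphM /=.
have : wle e (m + E) (h j i' * g j).
  by rewrite addnC; apply: wleM; [apply: (hE (j, i'))|apply: wg].
move: (_ * _) => p wp; rewrite [p]mpolyE rmorph_sum mulr_sumr /= big_seq.
apply: subsp_sum => [|mm /wp]; first exact: ss.
case/(mon_mnm_surj (adm_pos hc)) => a <-.
rewrite mevZ mevX -scalerAr; apply: spannedZ; first exact: subsp_eq0.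
exact: (@spanned_gen _ _ _ zero bc (i', a) (subsp_eq0 _)).
Qed.

End Growth.

(** * Counting monomials of bounded weight *)

Section Counting.
Variable N : nat.
Implicit Types (e w : 'I_N -> nat).

Lemma leq_card_rel (A B : finType) (P : A -> B -> Prop) :
  (forall a, exists b, P a b) -> (forall a a' b, P a b -> P a' b -> a = a') ->
  (#|A| <= #|B|)%N.
Proof.
move=> /fin_all_exists [f hf] inj; apply: (@leq_card _ _ f) => a a' fa.
by apply: (inj a a' (f a)) => //; rewrite fa.
Qed.

Definition cnt e t := #|{: mon e t}|.

(** Dividing each exponent by e k with remainder compares ordinary with weighted monomials. Together
    with [cnt1_ge] it shows that [cnt e t] grows like t^N / (N! prod e k). *)
Lemma cnt1_le e t : (forall k, 0 < e k)%N -> (cnt (fun=> 1%N) t <= \prod_k e k * cnt e t)%N.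
Proof.
move=> e0; have -> : (\prod_k e k * cnt e t)%N =
    #|{: {dffun forall k : 'I_N, 'I_(e k)} * mon e t}|.
  rewrite card_prod card_dep_ffun foldrE big_map big_enum /=; congr (_ * _)%N.
  by apply: eq_bigr => k _; rewrite card_ord.
apply: (@leq_card_rel _ _ (fun a (rb : {dffun forall k : 'I_N, 'I_(e k)} * mon e t) =>
  forall k, mon_mnm a k = (e k * mon_mnm rb.2 k + rb.1 k)%N)).
  move=> a; have [|b hb] := @mon_mnm_surj _ e t [multinom mon_mnm a k %/ e k | k < N] e0.
    apply: leq_trans (wt_mon a); rewrite /wt; apply: leq_sum => k _.
    by rewrite mnmE muln1 leq_divM.
  exists ([ffun k => Ordinal (ltn_pmod (mon_mnm a k) (e0 k))], b) => k /=.
  by rewrite hb mnmE ffunE /= mulnC -divn_eq.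
move=> a a' [r b] ha ha'; apply/mon_mnm_inj/mnmP => k.
by rewrite ha ha'.
Qed.

Lemma cnt1_ge e t : (forall k, 0 < e k)%N ->
  (\prod_k e k * cnt e t <= cnt (fun=> 1%N) (t + \sum_k e k))%N.
Proof.
move=> e0; have -> : (\prod_k e k * cnt e t)%N =
    #|{: {dffun forall k : 'I_N, 'I_(e k)} * mon e t}|.
  rewrite card_prod card_dep_ffun foldrE big_map big_enum /=; congr (_ * _)%N.
  by apply: eq_bigr => k _; rewrite card_ord.
apply: (@leq_card_rel _ _ (fun (rb : {dffun forall k : 'I_N, 'I_(e k)} * mon e t)
    (a : mon (fun=> 1%N) (t + \sum_k e k)) =>
  forall k, mon_mnm a k = (e k * mon_mnm rb.2 k + rb.1 k)%N)).
  move=> [r b] /=; have [//||a ha] := @mon_mnm_surj _ (fun=> 1%N) (t + \sum_k e k)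
    [multinom (e k * mon_mnm b k + r k)%N | k < N].
    rewrite /wt; under eq_bigr do rewrite mnmE muln1.
    rewrite big_split leq_add //=.
      by apply: leq_trans (wt_mon b); apply: leq_sum => k _; rewrite mulnC.
    by apply: leq_sum => k _; apply: ltnW.
  by exists a => k; rewrite ha mnmE.
move=> [r b] [r' b'] a /= h h'; have hk k := etrans (esym (h k)) (h' k).
congr pair.
  apply/ffunP => k; apply/val_inj; have := congr1 (fun x => x %% e k)%N (hk k).
  by rewrite /= ![(e k * _)%N]mulnC !modnMDl !modn_small.
apply/mon_mnm_inj/mnmP => k; have := congr1 (fun x => x %/ e k)%N (hk k).
by rewrite /= ![(e k * _)%N]mulnC !divnMDl // !divn_small ?addn0.
Qed.

Lemma cnt1E t : cnt (fun=> 1%N) t = 'C(N + t, N).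
Proof.
rewrite -card_partial_ord_partitions /cnt card_sig; apply: eq_card => a.
rewrite !inE big_tuple; congr (_ <= _)%N.
by apply: eq_bigr => k _; rewrite muln1.
Qed.

Lemma bin_bounds t : ((t.+1) ^ N <= 'C(N + t, N) * N`! <= (N + t) ^ N)%N.
Proof.
have pe x : (x ^ N = \prod_(i < N) x)%N by rewrite prod_nat_const card_ord.
rewrite bin_ffact ffact_prod !pe; apply/andP; split.
  by apply: leq_prod => i _; have := ltn_ord i; lia.
by apply: leq_prod => i _; lia.
Qed.

(** Bernoulli's inequality (1 - 1/(M+1))^N >= 1 - N/(M+1), cleared of denominators. *)
Lemma bernoulli M : ((M.+1) ^ N * M.+1 <= M ^ N * M.+1 + N * (M.+1) ^ N)%N.
Proof.
elim: N => [|k ih]; first by rewrite !expn0 mul0n addn0.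
have le : (M ^ k <= M.+1 ^ k)%N by case: (k) => // k'; rewrite leq_exp2r.
rewrite !expnS; set X := (M.+1 ^ k)%N in ih le *; set Y := (M ^ k)%N in ih le *.
nia.
Qed.

(** Both counts grow like t^N / N!, and the shift by E does not affect the leading coefficient. *)
Lemma leq_of_growth a b E :
  (forall t, a * cnt (fun _ : 'I_N => 1) t <= b * cnt (fun _ : 'I_N => 1) (t + E))%N ->
  (a <= b)%N.
Proof.
move=> h; rewrite leqNgt; apply/negP => ltba.
(* For t + 1 = M S the choice of S gives N + t + E <= (M+1) S, so the bounds on binomials yield a
   M^N <= b (M+1)^N. The choice M > (b+1) N lets Bernoulli's inequality exclude b < a. *)
pose S := (N + E).+1; pose M := (b.+1 * N).+1.
have t1 : (M * S).-1.+1 = (M * S)%N by rewrite prednK // muln_gt0.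
have hX : (a * M ^ N <= b * M.+1 ^ N)%N.
  have := h (M * S).-1; rewrite !cnt1E => ht.
  have SN : (0 < S ^ N)%N by rewrite expn_gt0.
  rewrite -(leq_pmul2r SN) -!mulnA -!expnMn.
  have [lo _] := andP (bin_bounds (M * S).-1); rewrite t1 in lo.
  have [_ hi] := andP (bin_bounds ((M * S).-1 + E)).
  apply: leq_trans (leq_mul (leqnn a) lo) _; rewrite mulnA.
  apply: leq_trans (leq_mul ht (leqnn N`!)) _; rewrite -mulnA.
  apply: leq_mul => //; apply: leq_trans hi _.
  have le : (N + ((M * S).-1 + E) <= M.+1 * S)%N by rewrite mulSn /S; lia.
  by case: (N) le => // k le; rewrite leq_exp2r.
have := bernoulli M; set X := (M.+1 ^ N)%N in hX *; set Y := (M ^ N)%N in hX *.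
have X0 : (0 < X)%N by rewrite expn_gt0.
move=> bern.
have h1 : (b.+1 * Y <= b * X)%N by apply: leq_trans hX; rewrite leq_mul2r ltba orbT.
have h2 : (b.+1 * (X * M.+1) <= M.+1 * (b * X) + b.+1 * N * X)%N.
  apply: leq_trans (leq_mul (leqnn _) bern) _; rewrite mulnDr !mulnA leq_add2r.
  by rewrite -[X in (_ <= X)%N]mulnA [X in (_ <= X)%N]mulnC leq_mul2r h1 orbT.
have h3 : (X * M.+1 <= b.+1 * N * X)%N.
  by move: h2; rewrite mulSn [(b * (X * _))%N]mulnA [(M.+1 * _)%N]mulnC addnC leq_add2l.
by move: h3; rewrite mulnC leq_pmul2r // /M; lia.
Qed.

Lemma cnt_leq a b E e : (forall k, 0 < e k)%N ->
  (forall t, a * cnt e t <= b * cnt e (t + E))%N -> (a <= b)%N.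
Proof.
move=> e0 h; apply: (@leq_of_growth _ _ (E + \sum_k e k)) => t.
apply: leq_trans (leq_mul (leqnn a) (cnt1_le t e0)) _.
rewrite mulnCA; apply: leq_trans (leq_mul (leqnn _) (h t)) _.
by rewrite mulnCA addnA leq_mul // cnt1_ge.
Qed.

(** Comparison of leading terms: r / prod e k = 1 / prod w k. *)
Lemma cnt_ratio r e w E E' : (forall k, 0 < e k)%N -> (forall k, 0 < w k)%N ->
  (forall t, r * cnt e t <= cnt w (t + E))%N ->
  (forall t, cnt w t <= r * cnt e (t + E'))%N ->
  (r * \prod_k w k = \prod_k e k)%N.
Proof.
move=> e0 w0 h1 h2; set W := (\prod_k w k)%N; set D := (\prod_k e k)%N.
apply/eqP; rewrite eqn_leq; apply/andP; split.
  apply: (@leq_of_growth _ _ (E + \sum_k w k)) => t.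
  apply: leq_trans (leq_mul (leqnn _) (cnt1_le t e0)) _.
  rewrite mulnCA leq_mul // mulnAC mulnC.
  apply: leq_trans (leq_mul (leqnn _) (h1 t)) _.
  by rewrite addnA cnt1_ge.
apply: (@leq_of_growth _ _ (E' + \sum_k e k)) => t.
apply: leq_trans (leq_mul (leqnn _) (cnt1_le t w0)) _.
rewrite mulnA [(D * _)%N]mulnC -mulnA [(r * _)%N]mulnC -mulnA leq_mul //.
apply: leq_trans (leq_mul (leqnn _) (h2 t)) _.
by rewrite mulnCA addnA leq_mul // cnt1_ge.
Qed.

End Counting.

Section FiberDegree.
Variables (K : fieldType) (N : nat).
Local Notation R := {mpoly K[N]}.

(** In one filtration there is room for r copies of the monomials in c and for at most r' copies of
    those in c', up to bounded shifts; both are counted by the same degrees e. *)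
Lemma fiber_degree_le (Fil : nat -> R -> Prop) e (c c' : 'I_N -> R) r r'
    (b : 'I_r -> R) (b' : 'I_r' -> R) :
  filtration Fil -> admissible Fil e c -> admissible Fil e c' ->
  indep (idealOf predT c) b -> (forall x, spanned (idealOf predT c') b' x) ->
  (r <= r')%N.
Proof.
move=> hF hc hc' ib sb'; have [E hE] := growth_lower hF hc ib.
have [E' hE'] := growth_upper hF hc' sb'.
apply: (@cnt_leq N _ _ (E + E') e (adm_pos hc)) => t.
have [v [iv Fv]] := hE t; have := hE' _ _ _ iv Fv.
by rewrite card_prod card_ord addnA.
Qed.

End FiberDegree.

(** * Local multiplicities *)

Section LocalDecomposition.
Variables (K : closedFieldType) (N : nat).
Local Notation R := {mpoly K[N]}.
Implicit Types (J : R -> Prop) (v : 'I_N -> K) (q : {poly K}).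

Definition codim J D := exists b : 'I_D -> R, indep J b /\ forall x, spanned J b x.

Definition in_local J v p := exists u : R, u.@[v] != 0 /\ J (u * p).

Definition local_dim J v m := exists b : m.-tuple R,
  (forall p, exists c : 'I_m -> K, in_local J v (p - \sum_(i < m) c i *: tnth b i)) /\
  (forall c : 'I_m -> K, in_local J v (\sum_(i < m) c i *: tnth b i) -> forall i, c i = 0).

Definition vanish J v := forall p, J p -> p.@[v] = 0.

Lemma meval_univ v i q : (univ i q).@[v] = q.[v i].
Proof.
rewrite /univ -[LHS]/(meval v _) -horner_map /= mevalXU -map_poly_comp.
by rewrite map_poly_id // => c _; rewrite /= mevalC.
Qed.

Lemma local_dim_ext J J' v v' m : (forall p, in_local J v p <-> in_local J' v' p) ->
  local_dim J v m -> local_dim J' v' m.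
Proof.
move=> JJ' [b [h1 h2]]; exists b; split.
  by move=> p; have [c /JJ' hc] := h1 p; exists c.
by move=> c /JJ'; apply: h2.
Qed.

Lemma codim0 J : ideal J -> codim J 0 -> J 1.
Proof. by move=> iJ [b [_ /(_ 1) [l]]]; rewrite big_ord0 subr0. Qed.

(** When every X_i - v_i is nilpotent modulo J, a polynomial u with u(v) != 0 is a nonzero constant
    plus a nilpotent, hence a unit modulo J: localizing at v changes nothing. *)
Lemma local_ideal_eq J v p : ideal J ->
  (forall i, nil_mod J (univ i ('X - (v i)%:P))) -> in_local J v p -> J p.
Proof.
move=> iJ nilX [u [u0 Jup]].
have iN := nil_mod_ideal iJ.
have [e he] : nil_mod J (u - (u.@[v])%:MP).
  elim/mpoly_ring_ind: u {u0 Jup} => [c|i|x y hx hy|x y hx hy].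
  - by rewrite mevalC subrr; apply: ideal0.
  - by have := nilX i; rewrite /univ rmorphB /= map_polyX map_polyC /= hornerXsubC mevalXU.
  - by rewrite mevalD mpolyCD opprD addrACA; apply: idealD.
  rewrite mevalM mpolyCM.
  set a := (x.@[v])%:MP in hx *; set b := (y.@[v])%:MP in hy *.
  have -> : x * y - a * b = x * (y - b) + (x - a) * b by ring.
  by apply: idealD => //; [apply: idealMl|apply: idealMr].
set a := (u.@[v])%:MP in he; set n := u - a in he.
have hk k : J (a ^+ k * p - (- n) ^+ k * p).
  elim: k => [|k ih]; first by rewrite !expr0 subrr; apply: ideal0.
  have -> : a ^+ k.+1 * p - (- n) ^+ k.+1 * p =
    a * (a ^+ k * p - (- n) ^+ k * p) + (- n) ^+ k * (u * p).
    by rewrite /n !exprS; ring.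
  by apply: idealD => //; apply: idealMl.
have : J (a ^+ e * p).
  rewrite -[_ * p](subrK ((- n) ^+ e * p)); apply: idealD => //.
  by rewrite exprNn mulrAC; apply: idealMl.
have ae : a ^+ e = (u.@[v] ^+ e)%:MP by rewrite /a rmorphXn.
move/(idealMl ((u.@[v] ^+ e)^-1)%:MP iJ).
by rewrite mulrA ae -mpolyCM mulVf ?expf_neq0 // mpolyC1 mul1r.
Qed.

Lemma decomposition_local J D v : ideal J -> codim J D -> ~ J 1 ->
  (forall i, nil_mod J (univ i ('X - (v i)%:P))) ->
  [/\ vanish J v, forall w, vanish J w -> w =1 v & local_dim J v D].
Proof.
move=> iJ [b [ib sb]] J1 nilX; split.
- move=> p Jp; apply/eqP/negP => /negP pv; apply: J1.
  by apply: (local_ideal_eq iJ nilX); exists p; rewrite mulr1.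
- move=> w Jw i; have [e he] := nilX i; have := Jw _ he.
  rewrite -univXk meval_univ horner_exp hornerXsubC => /eqP.
  by rewrite expf_eq0 subr_eq0 => /andP [_ /eqP].
exists [tuple b i | i < D]; split.
  move=> p; have [l hl] := sb p; exists l, 1; rewrite meval1 oner_eq0 mul1r; split=> //.
  by under eq_bigr do rewrite tnth_mktuple.
move=> c /(local_ideal_eq iJ nilX); under eq_bigr do rewrite tnth_mktuple.
exact: ib.
Qed.

(** Chinese remainder theorem: be g and al f are complementary idempotents modulo J, and they glue
    bases of the two quotients into one of R/J. *)
Lemma codim_split J D (f g al be : R) : ideal J -> codim J D ->
  J (f * g) -> al * f + be * g = 1 ->
  exists D1 D2, [/\ D = (D1 + D2)%N, codim (fun x => exists a, J (x - a * f)) D1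
    & codim (fun x => exists a, J (x - a * g)) D2].
Proof.
move=> iJ [b [ib sb]] Jfg fg1.
have iJ1 := ideal_extend f iJ; set J1 := (fun x => _) in iJ1 *.
have iJ2 := ideal_extend g iJ; set J2 := (fun x => _) in iJ2 *.
have sub1 x : J x -> J1 x by exists 0; rewrite mul0r subr0.
have sub2 x : J x -> J2 x by exists 0; rewrite mul0r subr0.
have sT : subsp (fun _ : R => True) by [].
have [D1 [b1 [_ ib1 sb1]]] := exists_basis_of (ideal_subsp iJ1) sT
  (fun x _ => spanned_sub sub1 (sb x)).
have [D2 [b2 [_ ib2 sb2]]] := exists_basis_of (ideal_subsp iJ2) sT
  (fun x _ => spanned_sub sub2 (sb x)).
exists D1, D2; split; [|by exists b1; split=> // x; apply: sb1|
  by exists b2; split=> // x; apply: sb2].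
have bg : be * g = 1 - al * f by rewrite -fg1; ring.
have af : al * f = 1 - be * g by rewrite -fg1; ring.
pose bb (k : 'I_D1 + 'I_D2) := match k with
  inl i => b1 i * (be * g) | inr j => b2 j * (al * f) end.
have bbE (l : 'I_D1 + 'I_D2 -> K) : \sum_k l k *: bb k =
    (\sum_i l (inl i) *: b1 i) * (be * g) + (\sum_j l (inr j) *: b2 j) * (al * f).
  rewrite big_sumType /= !mulr_suml.
  by congr (_ + _); apply: eq_bigr => i _; rewrite scalerAl.
have sbb x : spanned J bb x.
  have [l1 [a1 h1]] := sb1 x I; have [l2 [a2 h2]] := sb2 x I.
  exists (fun k => match k with inl i => l1 i | inr j => l2 j end).
  rewrite bbE /=; set S1 := \sum_i _ in h1 *; set S2 := \sum_i _ in h2 *.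
  have -> : x - (S1 * (be * g) + S2 * (al * f)) =
     (be * g) * (x - S1 - a1 * f) + (al * f) * (x - S2 - a2 * g) +
     (a1 * be + a2 * al) * (f * g).
    by rewrite -[x in LHS]mulr1 -fg1; ring.
  by apply: idealD => //; [apply: idealD => //|]; apply: idealMl.
have ibb : indep J bb.
  move=> l; rewrite bbE; set S1 := \sum_i _; set S2 := \sum_i _ => JS.
  have l1 : J1 S1.
    exists (al * (S1 - S2)).
    have -> : S1 - al * (S1 - S2) * f = S1 * (be * g) + S2 * (al * f) by
      rewrite bg; ring.
    by [].
  have l2 : J2 S2.
    exists (be * (S2 - S1)).
    have -> : S2 - be * (S2 - S1) * g = S1 * (be * g) + S2 * (al * f) by
      rewrite af; ring.
    by [].
  by case=> i; [apply: (ib1 (fun i => l (inl i)))|apply: (ib2 (fun i => l (inr i)))].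
have cardE : #|{: 'I_D1 + 'I_D2}| = (D1 + D2)%N by rewrite card_sum !card_ord.
have sJ := ideal_subsp iJ.
apply/eqP; rewrite eqn_leq -cardE; apply/andP; split.
  by have := indep_card_le sJ ib (fun i => sbb (b i)); rewrite card_ord.
by have := indep_card_le sJ ibb (fun k => sb (bb k)); rewrite card_ord.
Qed.

Lemma minimal_annihilator J i : algebraic_mod J ->
  exists q, [/\ q != 0, J (univ i q) &
    forall q', q' != 0 -> J (univ i q') -> (size q <= size q')%N].
Proof.
move=> /(_ i) [q [q0 Jq]].
elim: {q}(size q) {-2}q (leqnn (size q)) q0 Jq => [|n ih] q sq q0 Jq.
  by move: q0; rewrite -size_poly_gt0 lt0n -leqn0 sq.
have [hmin|] := classic (forall q', q' != 0 -> J (univ i q') -> (size q <= size q')%N).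
  by exists q.
move=> /not_all_ex_not [q' h]; have [q'0 h'] := imply_to_and _ _ h.
have [Jq' /negP] := imply_to_and _ _ h'; rewrite -ltnNge => lt; apply: (ih q') => //.
by rewrite -ltnS; apply: leq_trans lt sq.
Qed.

(** A minimal annihilator q of X_i has a root a, K being algebraically closed. Write q = q2 (X -
    a)^m with q2(a) != 0: either (X - a)^m already annihilates X_i, or neither coprime factor does,
    q2 being excluded by minimality. *)
Lemma local_or_split J i : ideal J -> ~ J 1 -> algebraic_mod J ->
  (exists a, nil_mod J (univ i ('X - a%:P))) \/
  exists a m q, [/\ ~ J (univ i (('X - a%:P) ^+ m)), ~ J (univ i q),
    J (univ i (('X - a%:P) ^+ m) * univ i q), ~~ root q a & (0 < m)%N].
Proof.
move=> iJ J1 alg; have [q [q0 Jq qmin]] := minimal_annihilator i alg.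
have sq1 : size q != 1%N.
  apply/negP => /size_poly1P [c c0 qc]; apply: J1; move: Jq.
  rewrite qc /univ map_polyC hornerC /= => /(idealMl (c^-1)%:MP iJ).
  by rewrite -mpolyCM mulVf // mpolyC1.
have /closed_rootP [a qa] := sq1.
have [m [q2]] := multiplicity_XsubC q a; rewrite q0 /= => q2a qE.
have m0 : (0 < m)%N.
  by rewrite lt0n; apply: contra q2a => /eqP m0; move: qa; rewrite qE m0 expr0 mulr1.
have [Jf|nJf] := classic (J (univ i (('X - a%:P) ^+ m))).
  by left; exists a, m; rewrite -univXk.
right; exists a, m, q2; split=> //.
  have q20 : q2 != 0 by apply: contraNneq q2a => ->; rewrite root0.
  move=> /(qmin _ q20); rewrite qE size_Mmonic ?monic_exp ?monicXsubC //.
  by rewrite size_exp_XsubC addnS /=; have := q20; rewrite -size_poly_gt0; lia.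
by rewrite -univM mulrC -qE.
Qed.

(** The quotient is split as long as some coordinate is not a constant plus a nilpotent; both pieces
    are nonzero, so their dimensions drop. When no coordinate is left to split, the quotient is zero
    or local. *)
Theorem local_decomposition D J : ideal J -> codim J D ->
  exists s : seq 'rV[K]_N, [/\ uniq s, forall v : 'rV[K]_N, v \in s <-> vanish J (fun k => v 0 k)
  & exists mu : 'rV[K]_N -> nat,
    (forall v : 'rV[K]_N, v \in s -> local_dim J (fun k => v 0 k) (mu v)) /\
    \sum_(v <- s) mu v = D].
Proof.
elim/ltn_ind: D J => D ih J iJ cD.
have [J1|J1] := classic (J 1).
  exists [::]; split=> //.
    by move=> v; split=> // /(_ _ J1) /eqP; rewrite meval1 oner_eq0.
  exists (fun=> 0%N); split=> //; rewrite big_nil.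
  have [b [ib _]] := cD; case: (posnP D) => [-> //|D0].
  suff /eqP : (1 : K) = 0 by rewrite oner_eq0.
  apply: (ib (fun=> 1) _ (Ordinal D0)).
  by rewrite -[\sum_i _]mulr1; apply: idealMl.
have alg : algebraic_mod J.
  by have [b [_ sb]] := cD; apply: spanned_algebraic sb.
have [/fin_all_exists [v nilX]|/not_all_ex_not [i nloc]] :=
  classic (forall i, exists a, nil_mod J (univ i ('X - a%:P))).
  have [Jv uv dv] := decomposition_local iJ cD J1 nilX.
  pose vv : 'rV[K]_N := \row_k v k.
  have vvE : (fun k => vv 0 k) =1 v by move=> k; rewrite mxE.
  exists [:: vv]; split=> //.
    move=> w; rewrite inE; split.
      by move=> /eqP -> p /Jv; rewrite (meval_eq _ vvE).
    by move=> /uv h; apply/eqP/rowP => k; rewrite h mxE.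
  exists (fun=> D); split; last by rewrite big_seq1.
  move=> w; rewrite inE => /eqP ->; apply: local_dim_ext dv => p.
  by split=> -[u [u0 hu]]; exists u; move: u0; rewrite (meval_eq _ vvE).
have [//|[a [m [q [nJf nJg Jfg qa m0]]]]] := local_or_split i iJ J1 alg.
set f := univ i _ in nJf Jfg; set g := univ i q in nJg Jfg.
have [al [be fg1]] : exists al be, al * f + be * g = 1.
  have /Bezout_eq1_coprimepP [[u1 u2] /= e] : coprimep (('X - a%:P) ^+ m) q.
    by apply: coprimep_expl; rewrite coprimep_sym coprimep_XsubC.
  exists (univ i u1), (univ i u2); rewrite -!univM -univD e.
  by rewrite /univ rmorph1 hornerC.
have [D1 [D2 [DE c1 c2]]] := codim_split iJ cD Jfg fg1.
have iJ1 := ideal_extend f iJ; set J1' := (fun x => _) in iJ1 c1.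
have iJ2 := ideal_extend g iJ; set J2' := (fun x => _) in iJ2 c2.
have D10 : (0 < D1)%N.
  rewrite lt0n; apply/negP => /eqP z; move: c1; rewrite z => /(codim0 iJ1) [c hc].
  apply: nJg; have -> : g = g * (1 - c * f) + c * (f * g) by ring.
  by apply: idealD => //; apply: idealMl.
have D20 : (0 < D2)%N.
  rewrite lt0n; apply/negP => /eqP z; move: c2; rewrite z => /(codim0 iJ2) [c hc].
  apply: nJf; have -> : f = f * (1 - c * g) + c * (f * g) by ring.
  by apply: idealD => //; apply: idealMl.
have [|s1 [us1 hs1 [mu1 [hmu1 sum1]]]] := ih D1 _ _ iJ1 c1; first by rewrite DE; lia.
have [|s2 [us2 hs2 [mu2 [hmu2 sum2]]]] := ih D2 _ _ iJ2 c2; first by rewrite DE; lia.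
have fv v : (f.@[v] == 0) = (v i == a).
  by rewrite meval_univ horner_exp hornerXsubC expf_eq0 m0 subr_eq0.
have gv v : g.@[v] = q.[v i] by rewrite meval_univ.
have sub1 x : J x -> J1' x by exists 0; rewrite mul0r subr0.
have sub2 x : J x -> J2' x by exists 0; rewrite mul0r subr0.
have vf v : vanish J1' v -> v i = a.
  move=> /(_ f) h; apply/eqP; rewrite -fv; apply/eqP/h.
  by exists 1; rewrite mul1r subrr; apply: ideal0.
have vg v : vanish J2' v -> g.@[v] = 0.
  by apply; exists 1; rewrite mul1r subrr; apply: ideal0.
have va v : vanish J2' v -> v i != a.
  by move=> /vg; rewrite gv => h; apply: contraNneq qa => <-; apply/eqP.
have disj (v : 'rV[K]_N) : v \in s1 -> v \in s2 -> False.
  by move=> /hs1 /vf h /hs2 /va; rewrite h eqxx.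
exists (s1 ++ s2); split.
- rewrite cat_uniq us1 us2 andbT /=; apply/hasPn => v v2.
  by apply/negP => v1; apply: (disj v).
- move=> v; rewrite mem_cat; split.
    case/orP => [/hs1 h p /sub1|/hs2 h p /sub2]; exact: h.
  move=> Jv; have := Jv _ Jfg; rewrite mevalM => /eqP; rewrite mulf_eq0.
  case/orP => /eqP h0; apply/orP; [left; apply/hs1|right; apply/hs2] => p [c /Jv];
    by rewrite mevalB mevalM h0 mulr0 subr0.
exists (fun v : 'rV[K]_N => if v \in s1 then mu1 v else mu2 v); split.
  (* Localization does not see the other piece: g is nonzero at the zeros of J + (f), and f at those
     of J + (g), so they can be absorbed into the denominator u. *)
  move=> v; rewrite mem_cat; case: ifP => [v1 _|_ /= v2].
    apply: local_dim_ext (hmu1 _ v1) => p; split=> -[u [u0]].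
      move=> [c hc]; exists (g * u); split.
        rewrite mevalM mulf_neq0 // gv; move/hs1/vf: v1 => ->.
        by apply: contra qa.
      have -> : g * u * p = g * (u * p - c * f) + c * (f * g) by ring.
      by apply: idealD => //; apply: idealMl.
    by move=> hu; exists u; split=> //; apply: sub1.
  apply: local_dim_ext (hmu2 _ v2) => p; split=> -[u [u0]].
    move=> [c hc]; exists (f * u); split.
      by rewrite mevalM mulf_neq0 // fv; move/hs2/va: v2.
    have -> : f * u * p = f * (u * p - c * g) + c * (f * g) by ring.
    by apply: idealD => //; apply: idealMl.
  by move=> hu; exists u; split=> //; apply: sub2.
rewrite big_cat DE -sum1 -sum2 /=; congr (_ + _)%N; apply: eq_big_seq => v vs.
  by rewrite vs.
by case: ifP => // v1; case: (disj v).
Qed.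

End LocalDecomposition.

(** * Pluecker coordinates of symmetric matrices *)

Section PluckerCoordinates.
Variables (Q : comNzRingType) (n : nat).
Local Notation sel := {ffun 'I_n -> 'I_(n + n)}.
Implicit Types (A B : sel) (F : 'M[Q]_n).

Definition graph_mx F : 'M[Q]_(n, n + n) := row_mx 1%:M F.

(** Selections are arbitrary functions and not increasing ones, so that replacing one column ([upd])
    stays within the type; coordinates then vanish or change sign accordingly. *)
Definition plucker F A : Q := \det (colsub A (graph_mx F)).

Definition upd A (a : 'I_n) k : sel := [ffun b => if b == a then k else A b].

Lemma upd_id A a : upd A a (A a) = A.
Proof. by apply/ffunP => b; rewrite ffunE; case: eqP => // ->. Qed.

Lemma graph_mx_l F i j : graph_mx F i (lshift n j) = (i == j)%:R.
Proof. by rewrite row_mxEl mxE. Qed.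

Lemma graph_mx_r F i j : graph_mx F i (rshift n j) = F i j.
Proof. by rewrite row_mxEr. Qed.

(** Cramer's rule. All coordinates one exchange away from A become entries of a single matrix
    product, from which both families of relations follow. *)
Lemma cramer_plucker F A a k :
  (\adj (colsub A (graph_mx F)) *m graph_mx F) a k = plucker F (upd A a k).
Proof.
rewrite /plucker (expand_det_col _ a) mxE; apply: eq_bigr => i _.
rewrite [\adj _ _ _]mxE [RHS]mulrC !mxE ffunE eqxx; congr (_ * _).
rewrite /cofactor; congr (_ * \det _).
by apply/matrixP => r s; rewrite !mxE ffunE eq_sym (negPf (neq_lift _ _)).
Qed.

(** Isotropy of the row space of [I, F]: with D the adjugate of the selected columns, both sides are
    the entry (a, a') of D F D^T, the left one by symmetry of F. *)
Lemma plucker_lagrange F A a a' : F^T = F ->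
  \sum_j plucker F (upd A a (lshift n j)) * plucker F (upd A a' (rshift n j)) =
  \sum_j plucker F (upd A a (rshift n j)) * plucker F (upd A a' (lshift n j)).
Proof.
move=> sF; set D := \adj (colsub A (graph_mx F)).
have hl b j : plucker F (upd A b (lshift n j)) = D b j.
  by rewrite -cramer_plucker -/D mul_mx_row mulmx1 row_mxEl.
have hr b j : plucker F (upd A b (rshift n j)) = (D *m F) b j.
  by rewrite -cramer_plucker -/D mul_mx_row row_mxEr.
under eq_bigr do rewrite hl hr; under [RHS]eq_bigr do rewrite hl hr.
transitivity ((D *m (D *m F)^T) a a').
  by rewrite [RHS]mxE; apply: eq_bigr => j _; rewrite [_^T _ _]mxE.
rewrite trmx_mul sF mulmxA [LHS]mxE; apply: eq_bigr => j _.
by rewrite [_^T _ _]mxE.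
Qed.

(** The matrix of neighbours is adj(M_A) M_B, where M_A denotes the columns selected by A. The extra
    factor p_A turns det(adj M_A) into p_A^n without division. *)
Lemma plucker_exchange F A B :
  plucker F A * \det (\matrix_(a, b) plucker F (upd A a (B b))) =
  plucker F A ^+ n * plucker F B.
Proof.
have -> : \matrix_(a, b) plucker F (upd A a (B b)) =
    \adj (colsub A (graph_mx F)) *m colsub B (graph_mx F).
  apply/matrixP => a b; rewrite mxE -cramer_plucker [LHS]mxE [RHS]mxE.
  by apply: eq_bigr => i _; congr (_ * _); rewrite [RHS]mxE.
by rewrite det_mulmx mulrA -det_mulmx mul_mx_adj det_scalar.
Qed.

Lemma plucker_noninj F A : ~~ injectiveb A -> plucker F A = 0.
Proof.
move=> /injectivePn [a [b ab eab]]; rewrite /plucker -det_tr.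
by apply: (determinant_alternate ab) => k; rewrite !mxE eab.
Qed.

Lemma plucker_perm F A (s : {perm 'I_n}) :
  plucker F [ffun b => A (s b)] = (-1) ^+ s * plucker F A.
Proof.
have -> : plucker F [ffun b => A (s b)] = \det (colsub A (graph_mx F) *m perm_mx s^-1%g).
  rewrite -col_permE; congr (\det _); apply/matrixP => i j; by rewrite !mxE ffunE.
by rewrite det_mulmx det_perm odd_permV mulrC.
Qed.

Definition sel_id : sel := [ffun b => lshift n b].

Lemma plucker_id F : plucker F sel_id = 1.
Proof.
rewrite /plucker (_ : colsub _ _ = 1%:M) ?det1 //.
by apply/matrixP => i j; rewrite !mxE ffunE (unsplitK (inl _)) mxE.
Qed.

Lemma plucker_entry F i j : plucker F (upd sel_id i (rshift n j)) = F i j.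
Proof.
rewrite -cramer_plucker; have -> : colsub sel_id (graph_mx F) = 1%:M.
  by apply/matrixP => r s; rewrite !mxE ffunE (unsplitK (inl _)) mxE.
by rewrite adj1 mul1mx graph_mx_r.
Qed.

Definition sel_set (I : {set 'I_n}) : sel :=
  [ffun b => if b \in I then rshift n b else lshift n b].

(** This orders the columns as lshift (n-1), ..., lshift 0, rshift 0, ..., rshift (n-1) and skips
    the value n, so that each conjugate pair has total weight 2n and the Lagrangian relations are
    homogeneous. *)
Definition colwt (k : 'I_(n + n)) : nat :=
  match split k with inl i => n - i.+1 | inr i => n + i.+1 end.

Lemma colwtl i : colwt (lshift n i) = (n - i.+1)%N.
Proof. by rewrite /colwt (unsplitK (inl _)). Qed.
Lemma colwtr i : colwt (rshift n i) = (n + i.+1)%N.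
Proof. by rewrite /colwt (unsplitK (inr _)). Qed.

Lemma colwt_inj : injective colwt.
Proof.
move=> k l; case: (split_ordP k) => i ->; case: (split_ordP l) => j ->;
  rewrite ?colwtl ?colwtr => h; have := ltn_ord i; have := ltn_ord j => hj hi.
- by congr lshift; apply/val_inj => /=; lia.
- lia.
- lia.
- by congr rshift; apply/val_inj => /=; lia.
Qed.

Definition selwt A := (\sum_b colwt (A b))%N.

Lemma selwt_upd A a k : (selwt (upd A a k) + colwt (A a) = selwt A + colwt k)%N.
Proof.
rewrite /selwt (bigD1 a) //= [in RHS](bigD1 a) //= ffunE eqxx.
rewrite (eq_bigr (fun b => colwt (A b))); first by rewrite addnC [RHS]addnC addnCA.
by move=> b /negPf ba; rewrite ffunE ba.
Qed.

Lemma selwt_set (I J : {set 'I_n}) :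
  (\sum_(i in ~: I) i.+1 = \sum_(i in ~: J) i.+1)%N ->
  selwt (sel_set I) = selwt (sel_set J).
Proof.
have h (X : {set 'I_n}) :
    (selwt (sel_set X) + 2 * \sum_(i in ~: X) i.+1 = n * n + \sum_(i < n) i.+1)%N.
  rewrite /selwt [X in (_ + 2 * X)%N]big_mkcond /= big_distrr -big_split /=.
  have -> : (n * n = \sum_(i < n) n)%N by rewrite sum_nat_const card_ord.
  rewrite -big_split /=; apply: eq_bigr => i _; rewrite ffunE inE.
  by case: ifP => _; rewrite /= ?colwtl ?colwtr; have := ltn_ord i; lia.
by have := h I; have := h J; lia.
Qed.

(* A selection hitting no pair {lshift i, rshift i} twice picks exactly one
   column from each pair, i.e. it is a principal minor up to reordering. *)
Lemma sel_principal A : injective A ->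
  (forall a a' i, A a = lshift n i -> A a' = rshift n i -> False) ->
  exists (s : {perm 'I_n}) (I : {set 'I_n}), A = [ffun b => sel_set I (s b)].
Proof.
move=> iA nb; pose f b := match split (A b) with inl i => i | inr i => i end.
have fl b i : A b = lshift n i -> f b = i by rewrite /f => ->; rewrite (unsplitK (inl _)).
have fr b i : A b = rshift n i -> f b = i by rewrite /f => ->; rewrite (unsplitK (inr _)).
have fi : injective f.
  move=> b b' e; apply: iA; move: e.
  case: (split_ordP (A b)) => i hi; case: (split_ordP (A b')) => j hj;
    rewrite ?(fl _ _ hi) ?(fr _ _ hi) ?(fl _ _ hj) ?(fr _ _ hj) => ij; subst j.
  - by rewrite hi hj.
  - by case: (nb b b' i).
  - by case: (nb b' b i).
  - by rewrite hi hj.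
exists (perm fi), [set i | [exists b, A b == rshift n i]].
apply/ffunP => b; rewrite !ffunE permE inE.
case: (split_ordP (A b)) => i hi.
  rewrite (fl _ _ hi) hi; case: existsP => // -[b' /eqP hb'].
  by case: (nb b b' i).
rewrite (fr _ _ hi) hi; case: existsP => // h; case: h; exists b; exact/eqP.
Qed.

End PluckerCoordinates.

(** * The filtration by products and its Rees algebra *)

Section SpanFiltration.
Variables (K : fieldType) (N : nat) (I : finType).
Local Notation R := {mpoly K[N]}.
Variables (p : I -> R) (i0 : I).
Local Notation zero := (fun x : R => x = 0).

Fixpoint prodspan m (x : R) : Prop :=
  if m is m'.+1 then exists y : I -> R, (forall i, prodspan m' (y i)) /\ x = \sum_i p i * y i
  else exists a : K, x = a%:MP.

Lemma prodspan_subsp m : subsp (prodspan m).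
Proof.
elim: m => [|m ih] /=; split.
- by exists 0; rewrite mpolyC0.
- by move=> a x y [b ->] [c ->]; exists (a * b + c); rewrite mpolyCD mpolyCM mul_mpolyC.
- by exists (fun=> 0); split; [move=> _; case: ih|rewrite big1 // => i _; rewrite mulr0].
move=> a x y [x' [hx ->]] [y' [hy ->]]; exists (fun i => a *: x' i + y' i); split.
  by move=> i; case: ih => _; apply.
rewrite scaler_sumr -big_split /=; apply: eq_bigr => i _.
by rewrite mulrDr scalerAr.
Qed.

Lemma prodspan0 m : prodspan m 0.
Proof. by case: (prodspan_subsp m). Qed.

Lemma prodspan_sum m (T : Type) (r : seq T) (P : pred T) (F : T -> R) :
  (forall i, P i -> prodspan m (F i)) -> prodspan m (\sum_(i <- r | P i) F i).
Proof. by apply: subsp_sum; apply: prodspan_subsp. Qed.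

Lemma prodspan_gen m i x : prodspan m x -> prodspan m.+1 (p i * x).
Proof.
move=> hx; exists (fun j => if j == i then x else 0); split.
  by move=> j; case: eqP => _ //; apply: prodspan0.
rewrite (bigD1 i) //= eqxx big1 ?addr0 // => j /negPf ->.
by rewrite mulr0.
Qed.

Lemma prodspan1 i : prodspan 1 (p i).
Proof.
rewrite -[p i]mulr1; apply: prodspan_gen; exists 1; by rewrite mpolyC1.
Qed.

Lemma prodspan_mul a b x y : prodspan a x -> prodspan b y -> prodspan (a + b) (x * y).
Proof.
elim: a x => [|a ih] x /=.
  move=> [c ->] hy; rewrite mul_mpolyC; apply: subspZ => //; exact: prodspan_subsp.
move=> [x' [hx ->]] hy; rewrite mulr_suml; exists (fun i => x' i * y); split.
  by move=> i; apply: ih.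
by apply: eq_bigr => i _; rewrite mulrA.
Qed.

Lemma prodspan_fin m : exists (T : finType) (v : T -> R),
  (forall t, prodspan m (v t)) /\ forall x, prodspan m x -> spanned zero v x.
Proof.
elim: m => [|m [T [v [hv sv]]]].
  exists 'I_1, (fun=> 1); split; first by exists 1; rewrite mpolyC1.
  by move=> x [a ->]; exists (fun=> a); rewrite big_ord1 -mul_mpolyC mulr1 subrr.
exists (I * T)%type, (fun it => p it.1 * v it.2); split.
  by move=> [i t]; apply: prodspan_gen.
move=> x [y [hy ->]].
have ss : subsp (spanned zero (fun it : I * T => p it.1 * v it.2)).
  by apply: spanned_subsp; apply: subsp_eq0.
apply: subsp_sum => // i _; have [l /eqP] := sv _ (hy i).
rewrite subr_eq0 => /eqP ->; rewrite mulr_sumr; apply: subsp_sum => // t _.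
rewrite -scalerAr; apply: subspZ => //.
exact: (@spanned_gen _ _ _ zero (fun it : I * T => p it.1 * v it.2) (i, t) (subsp_eq0 _)).
Qed.

Hypothesis p1 : p i0 = 1.

Lemma prodspan_mono m x : prodspan m x -> prodspan m.+1 x.
Proof. by rewrite -[x in prodspan _.+1 x]mul1r -p1; apply: prodspan_gen. Qed.

Lemma prodspan_leq m k x : (m <= k)%N -> prodspan m x -> prodspan k x.
Proof.
move=> /subnKC <-; elim: (k - m)%N => [|j ih]; first by rewrite addn0.
by move=> /ih; rewrite addnS; apply: prodspan_mono.
Qed.

Hypothesis pX : forall t, exists m, prodspan m 'X_t.

Lemma prodspan_filtration : filtration prodspan.
Proof.
split.
- exact: prodspan_subsp.
- exact: prodspan_mono.
- exact: prodspan_mul.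
- by exists 1; rewrite mpolyC1.
- move=> x; elim/mpoly_ring_ind: x => [c|t|x y [a ha] [b hb]|x y [a ha] [b hb]].
  + by exists 0%N, c.
  + exact: pX.
  + exists (maxn a b); apply: subspD; first exact: prodspan_subsp.
      by apply: prodspan_leq ha; rewrite leq_maxl.
    by apply: prodspan_leq hb; rewrite leq_maxr.
  + by exists (a + b)%N; apply: prodspan_mul.
move=> m; have [T [v [_ sv]]] := prodspan_fin m.
exists #|T|, (fun k => v (enum_val k)) => x /sv [l hl].
exists (fun k => l (enum_val k)).
rewrite (_ : \sum_(k < #|T|) _ = \sum_t l t *: v t) //.
by rewrite [RHS](reindex (@enum_val T predT)) //; apply: onW_bij; apply: enum_val_bij.
Qed.

(** The filtration is generated in degree 1, so solving the equation in the single degree B+1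
    suffices: multiplication by the p_i carries it to all higher degrees. *)
Lemma prodspan_admissible (c : 'I_N -> R) B :
  (forall k, prodspan 1 (c k)) ->
  (forall x, prodspan B.+1 x -> exists x0, exists y : 'I_N -> R,
    [/\ prodspan B x0, forall k, prodspan B (y k) & x = x0 + \sum_k c k * y k]) ->
  admissible prodspan (fun=> 1%N) c.
Proof.
move=> c1 cert; split=> //; exists B.+1; split=> // m x Bm; rewrite subn1.
have -> : m = (B.+1 + (m.-1 - B))%N by lia.
elim: (m.-1 - B)%N x => [|j ih] x; first by rewrite addn0; apply: cert.
rewrite addnS => -[y [hy ->]].
have /fin_all_exists [f hf] : forall i, exists f : R * ('I_N -> R),
  [/\ prodspan (B.+1 + j).-1 f.1, forall k, prodspan (B.+1 + j).-1 (f.2 k) &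
   y i = f.1 + \sum_k c k * f.2 k].
  by move=> i; have [x0 [z h]] := ih _ (hy i); exists (x0, z).
exists (\sum_i p i * (f i).1), (fun k => \sum_i p i * (f i).2 k); split=> [|k|].
- by exists (fun i => (f i).1); split=> // i; case: (hf i).
- by exists (fun i => (f i).2 k); split=> // i; case: (hf i).
under [X in _ = _ + X]eq_bigr do rewrite mulr_sumr.
rewrite exchange_big -big_split /=; apply: eq_bigr => i _.
have [_ _ {1}->] := hf i; rewrite mulrDr mulr_sumr; congr (_ + _).
by apply: eq_bigr => k _; rewrite mulrCA.
Qed.

Section Rees.
Variables (L : finType) (c : L -> R).
Hypothesis c1 : forall k, prodspan 1 (c k).

(* The polynomial ring in variables z_i, mapped onto the Rees algebra of the
   filtration by z_i |-> p_i h; [rees_ideal] is the preimage of (h c_k)_k. *)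
Definition rees : {mpoly K[#|I|]} -> {poly R} :=
  mmap (polyC \o @mpolyC N K) (fun k => (p (enum_val k))%:P * 'X).
HB.instance Definition _ := GRing.RMorphism.on rees.

Definition zvar (i : I) : {mpoly K[#|I|]} := 'X_(enum_rank i).

Lemma rees_zvar i : rees (zvar i) = (p i)%:P * 'X.
Proof. by rewrite /rees mmapX mmap1U enum_rankK. Qed.

Lemma reesC a : rees a%:MP = a%:MP%:P.
Proof. by rewrite /rees mmapC. Qed.

Lemma reesM x y : rees (x * y) = rees x * rees y.
Proof. exact: rmorphM. Qed.
Lemma reesD x y : rees (x + y) = rees x + rees y.
Proof. exact: rmorphD. Qed.
Lemma reesB x y : rees (x - y) = rees x - rees y.
Proof. exact: rmorphB. Qed.
Lemma rees0 : rees 0 = 0.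
Proof. exact: rmorph0. Qed.
Lemma rees1 : rees 1 = 1.
Proof. exact: rmorph1. Qed.
Lemma rees_sum (T : Type) (r : seq T) (P : pred T) F :
  rees (\sum_(i <- r | P i) F i) = \sum_(i <- r | P i) rees (F i).
Proof. exact: rmorph_sum. Qed.

Lemma reesX x k : rees (x ^+ k) = rees x ^+ k.
Proof. exact: rmorphXn. Qed.
Lemma rees_sign k : rees ((-1) ^+ k) = (-1) ^+ k.
Proof. exact: rmorph_sign. Qed.
Lemma rees_det k (M : 'M_k) : rees (\det M) = \det (map_mx rees M).
Proof. by rewrite det_map_mx. Qed.

Opaque rees.

Lemma prodspan_rees q m : prodspan m (rees q)`_m.
Proof.
elim/mpoly_ring_ind: q m => [a|k|q q' hq hq'|q q' hq hq'] m.
- rewrite reesC coefC; case: eqP => [->|_]; last exact: prodspan0.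
  by exists a.
- rewrite -[k]enum_valK -/(zvar _) rees_zvar coefMX coefC.
  by case: m => [|[|m]]; [apply: prodspan0|apply: prodspan1|apply: prodspan0].
- rewrite reesD coefD; apply: (subspD (prodspan_subsp m)); [exact: hq|exact: hq'].
rewrite reesM coefM; apply: prodspan_sum => i _.
have mE : m = (i + (m - i))%N by rewrite subnKC // -ltnS.
by rewrite [X in prodspan X _]mE; apply: prodspan_mul; [apply: hq|apply: hq'].
Qed.

Definition rees_ideal (t : {mpoly K[#|I|]}) : Prop :=
  exists q : L -> {mpoly K[#|I|]}, rees t = \sum_k rees (q k) * ((c k)%:P * 'X).

Lemma rees_idealP : ideal rees_ideal.
Proof.
split.
- exists (fun=> 0); rewrite rees0 big1 // => k _.
  by rewrite ?rees0 mul0r.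
- move=> x y [q hq] [q' hq']; exists (fun k => q k + q' k).
  rewrite reesD hq hq' -big_split /=; apply: eq_bigr => k _.
  by rewrite reesD mulrDl.
- move=> a x [q hq]; exists (fun k => a * q k).
  rewrite reesM hq [LHS]mulr_sumr; apply: eq_bigr => k _.
  by rewrite reesM mulrA.
Qed.

Lemma rees_ker x y : rees x = rees y -> rees_ideal (x - y).
Proof.
move=> xy; exists (fun=> 0); rewrite reesB xy subrr; apply/esym/big1 => k _.
by rewrite rees0 mul0r.
Qed.

Lemma rees_ideal_gen k t : rees t = (c k)%:P * 'X -> rees_ideal t.
Proof.
move=> ht; exists (fun j => (j == k)%:R); rewrite (bigD1 k) // eqxx rees1 mul1r ht big1; first by rewrite /= addr0.
by move=> j /= /negPf ->; rewrite rees0 mul0r.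
Qed.

Lemma nil_mod_power (T : comNzRingType) (J : T -> Prop) (s : seq T) :
  ideal J -> (forall x, x \in s -> nil_mod J x) ->
  exists B, forall l, {subset l <= s} -> (B <= size l)%N -> J (\prod_(x <- l) x).
Proof.
move=> iJ; elim: s => [|a s ih] nils.
  exists 1%N => -[|x l] //= sub _; by have := sub x (mem_head _ _).
have [|B hB] := ih; first by move=> x xs; apply: nils; rewrite inE xs orbT.
have [e he] := nils a (mem_head _ _).
exists (B + e)%N => l sub sz.
rewrite (bigID (pred1 a)) /=.
have -> : \prod_(x <- l | x == a) x = a ^+ count_mem a l.
  rewrite -big_filter -size_filter.
  elim: l {sub sz} => [|x l ihl] /=; first by rewrite big_nil expr0.
  by case: eqP => [->|_] //=; rewrite big_cons exprS ihl.
have [lt|ge] := ltnP (count_mem a l) e.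
  apply: idealMl => //; rewrite -big_filter; apply: hB.
    move=> x; rewrite mem_filter => /andP [xa /sub]; rewrite inE.
    by rewrite (negPf xa).
  rewrite size_filter; have := count_predC (pred1 a) l.
  move: sz lt; rewrite /= (_ : count (predC (pred1 a)) l = count (fun x => x != a) l) //.
  by lia.
by apply: idealMr => //; apply: nil_mod_weaken he.
Qed.

(** The m-th power of the ideal of the variables z_i, by the same recursion as [prodspan], so that
    elements lift factor by factor. *)
Fixpoint zpower m (t : {mpoly K[#|I|]}) : Prop :=
  if m is m'.+1 then exists y, (forall i, zpower m' (y i)) /\ t = \sum_i zvar i * y i
  else True.

Lemma zpower_rees m x : prodspan m x -> exists t, zpower m t /\ rees t = x%:P * 'X^m.
Proof.
elim: m x => [|m ih] x /=.
  by move=> [a ->]; exists a%:MP; rewrite reesC expr0 mulr1.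
move=> [y [hy ->]]; have /fin_all_exists [t ht] : forall i, exists t,
    zpower m t /\ rees t = (y i)%:P * 'X^m by move=> i; apply: ih.
exists (\sum_i zvar i * t i); split.
  by exists t; split=> // i; case: (ht i).
rewrite rees_sum rmorph_sum mulr_suml /=; apply: eq_bigr => i _.
have [_ e] := ht i; rewrite reesM rees_zvar e polyCM exprS; ring.
Qed.

(** Nilpotency of all z_i puts a power of the ideal they generate into [rees_ideal]. An element of
    degree B+1 is lifted to that power, and the coefficients of h^(B+1) are compared. *)
Lemma nilpotent_admissible : (forall i, nil_mod rees_ideal (zvar i)) ->
  exists B, forall x, prodspan B.+1 x -> exists y : L -> R,
    (forall k, prodspan B (y k)) /\ x = \sum_k c k * y k.
Proof.
move=> nilz; have [B hB] := @nil_mod_power _ _ [seq zvar i | i : I] rees_idealP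
  (fun x => fun h => let: ex_intro2 i _ e := imageP h in
    eq_ind_r (nil_mod rees_ideal) (nilz i) e).
have hJ m t (l : seq {mpoly K[#|I|]}) : zpower m t -> {subset l <= [seq zvar i | i : I]} ->
    (B <= size l + m)%N -> rees_ideal ((\prod_(x <- l) x) * t).
  elim: m t l => [|m ih] t l /=.
    by move=> _ sub; rewrite addn0 => sz; apply: (idealMr _ rees_idealP); apply: hB.
  move=> [y [hy ->]] sub sz; rewrite mulr_sumr; apply: ideal_sum => [|i _]; first exact: rees_idealP.
  have -> : \prod_(x <- l) x * (zvar i * y i) = (\prod_(x <- zvar i :: l) x) * y i.
    by rewrite big_cons mulrA [zvar i * _]mulrC.
  apply: ih => //; last by rewrite /= addSnnS.
  by move=> x; rewrite inE => /predU1P [->|/sub //]; apply: image_f.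
exists B => x /zpower_rees [t [zt ht]].
have := hJ _ t [::] zt (fun x => _); rewrite big_nil mul1r add0n => /(_ _ (leqnSn B)).
case=> [//|q hq]; exists (fun k => (rees (q k))`_B); split.
  by move=> k; apply: prodspan_rees.
move: hq; rewrite ht => /(congr1 (fun q : {poly R} => q`_B.+1)).
rewrite coefCM coefXn eqxx mulr1 => ->; rewrite coef_sum; apply: eq_bigr => k _.
by rewrite mulrA coefMX /= coefMC mulrC.
Qed.

End Rees.
End SpanFiltration.

(** * Coordinates on symmetric matrices *)

Section SymmetricIndex.
Variable n : nat.

Definition upair := {ij : 'I_n * 'I_n | (ij.1 <= ij.2)%N}.
HB.instance Definition _ := Finite.on upair.

Lemma sum_succ : (\sum_(i < n) i.+1 = 'C(n.+1, 2))%N.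
Proof.
rewrite -bin2_sum big_mkord big_ord_recl add0n; apply: eq_bigr => i _.
by rewrite lift0.
Qed.

Lemma card_upair : #|{: upair}| = 'C(n.+1, 2).
Proof.
rewrite -sum_succ card_sig -sum1_card.
rewrite (eq_bigl (fun ij : 'I_n * 'I_n => true && (ij.1 <= ij.2)%N)) //.
rewrite -(pair_big_dep xpredT (fun i j : 'I_n => (i <= j)%N) (fun _ _ => 1%N)) /=.
rewrite (exchange_big_dep xpredT) //=; apply: eq_bigr => j _.
rewrite sum1_card -[RHS]card_ord.
have lt (i : 'I_j.+1) : (i < n)%N by apply: leq_trans (ltn_ord i) (ltn_ord j).
rewrite -(card_imset 'I_j.+1 (f := fun i => Ordinal (lt i))); last first.
  by move=> i i' /(congr1 val) /= h; apply/val_inj.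
apply: eq_card => i; rewrite unfold_in /=; apply/idP/imsetP.
  by move=> ij; exists (Ordinal (ij : (i < j.+1)%N)) => //; apply/val_inj.
by move=> [k _ ->]; have := ltn_ord k; rewrite ltnS.
Qed.

Definition upos (t : 'I_('C(n.+1, 2))) : 'I_n * 'I_n :=
  val (enum_val (cast_ord (esym card_upair) t)).

Lemma sort_pair (i j : 'I_n) :
  ((if (i <= j)%N then (i, j) else (j, i)).1 <= (if (i <= j)%N then (i, j) else (j, i)).2)%N.
Proof. by case: ifP => //= h; have := leq_total i j; rewrite h. Qed.

Definition vidx (i j : 'I_n) : 'I_('C(n.+1, 2)) :=
  cast_ord card_upair
    (enum_rank (exist (fun ij : 'I_n * 'I_n => is_true (ij.1 <= ij.2)%N) _ (sort_pair i j) : upair)).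

Lemma upos_vidx i j : upos (vidx i j) = if (i <= j)%N then (i, j) else (j, i).
Proof. by rewrite /upos /vidx cast_ordK enum_rankK. Qed.

Lemma upos_le t : ((upos t).1 <= (upos t).2)%N.
Proof. by rewrite /upos; case: (enum_val _). Qed.

Lemma upos_inj : injective upos.
Proof. by move=> s t /val_inj /enum_val_inj /cast_ord_inj. Qed.

Lemma vidxC i j : vidx i j = vidx j i.
Proof.
apply: upos_inj; rewrite !upos_vidx.
by case: ltngtP => // /val_inj ->.
Qed.

Lemma vidx_upos t : vidx (upos t).1 (upos t).2 = t.
Proof. by apply: upos_inj; rewrite upos_vidx upos_le -surjective_pairing. Qed.

Definition symX (K : comNzRingType) : 'M[{mpoly K['C(n.+1, 2)]}]_n := \matrix_(i, j) 'X_(vidx i j).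

Lemma symX_sym (K : comNzRingType) : (symX K)^T = symX K.
Proof. by apply/matrixP => i j; rewrite !mxE vidxC. Qed.

Lemma prod_upos (W : nat -> nat -> nat) :
  (\prod_t W (upos t).1 (upos t).2 = \prod_(j < n) \prod_(i < n | (i <= j)%N) W i j)%N.
Proof.
rewrite [RHS](exchange_big_dep xpredT) //= pair_big_dep /=.
rewrite (eq_bigl (fun ij : 'I_n * 'I_n => (ij.1 <= ij.2)%N)) //.
rewrite (reindex_onto upos (fun ij => vidx ij.1 ij.2)) /=; last first.
  by move=> [i j] /= ij; rewrite upos_vidx ij.
by apply: eq_bigl => t; rewrite upos_le vidx_upos eqxx.
Qed.

End SymmetricIndex.

Lemma polyMX2 (T : comNzRingType) (a b : T) : a%:P * 'X * (b%:P * 'X) = (a * b)%:P * 'X ^+ 2.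
Proof. by rewrite polyCM; ring. Qed.

(** * Nilpotency of the Pluecker coordinates at the chain realization *)

Section BaseNilpotency.
Variables (K : fieldType) (n N : nat).
Local Notation d := ('C(n.+1, 2)).
Local Notation R := {mpoly K[N]}.
Local Notation sel := {ffun 'I_n -> 'I_(n + n)}.
Variable p : sel -> R.
Hypothesis p_id : p (sel_id n) = 1.
Hypothesis p_lagrange : forall A a a',
  \sum_j p (upd A a (lshift n j)) * p (upd A a' (rshift n j)) =
  \sum_j p (upd A a (rshift n j)) * p (upd A a' (lshift n j)).
Hypothesis p_exchange : forall A B : sel,
  p A * \det (\matrix_(a, b) p (upd A a (B b))) = p A ^+ n * p B.
Hypothesis p_noninj : forall A : sel, ~~ injectiveb A -> p A = 0.
Hypothesis p_perm : forall (A : sel) (s : {perm 'I_n}),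
  p [ffun b => A (s b)] = (-1) ^+ s * p A.

Definition setwt (X : {set 'I_n}) : nat := (\sum_(i in ~: X) i.+1)%N.

Lemma setwt_le X : (setwt X <= d)%N.
Proof.
by rewrite -sum_succ /setwt big_mkcond /=; apply: leq_sum => i _; case: ifP.
Qed.

(** The coefficient of degree k in the determinant of diag(X^(i+1)) - F: the subset records the
    columns taken from -F, and its complement contributes the exponent [setwt]. *)
Definition base_coef (k : nat) : R :=
  \sum_(X : {set 'I_n} | setwt X == k) (-1) ^+ #|X| * p (sel_set X).

Lemma prodspan_base k : prodspan p 1 (base_coef k).
Proof.
apply: prodspan_sum => X _; rewrite -signr_odd; case: (odd _).
  rewrite expr1 mulN1r -scaleN1r; apply: subspZ; first exact: prodspan_subsp.
  exact: prodspan1.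
by rewrite mul1r; apply: prodspan1.
Qed.

Lemma base_coef_lead : base_coef d = 1.
Proof.
rewrite /base_coef (bigD1 set0) /=; last first.
  by rewrite /setwt setC0 -sum_succ; apply/eqP; apply: eq_bigl => i; rewrite inE.
rewrite cards0 expr0 mul1r (_ : sel_set set0 = sel_id n); last first.
  by apply/ffunP => b; rewrite !ffunE inE.
rewrite p_id big1 ?addr0 // => X /andP [/eqP wX /set0Pn [i iX]].
suff : (setwt X < d)%N by rewrite wX ltnn.
rewrite -sum_succ /setwt big_mkcond (bigD1 i) //= [X in (_ < X)%N](bigD1 i) //= inE iX /=.
by rewrite add0n ltnS -[X in (X <= _)%N]add0n leq_add // leq_sum // => j _; case: ifP.
Qed.

Local Notation z := (@zvar K sel).
(** The index runs up to d, where the coefficient is 1: its homogenization is h itself, so only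
    points at infinity remain. *)
Local Notation J := (rees_ideal p (fun k : 'I_d.+1 => base_coef k)).
Local Notation rs := (rees p).

Let iJ : ideal J. Proof. exact: rees_idealP. Qed.
Let iN : ideal (nil_mod J). Proof. exact: nil_mod_ideal. Qed.

Let J_nil x : J x -> nil_mod J x. Proof. by exists 1%N; rewrite expr1. Qed.

Let nil_eq x y : rs x = rs y -> nil_mod J y -> nil_mod J x.
Proof.
move=> xy ny; rewrite -[x](subrK y); apply: (idealD iN _ ny); apply: J_nil.
exact: rees_ker.
Qed.

Let nil_pow x k : nil_mod J (x ^+ k) -> nil_mod J x.
Proof. by move=> [e he]; exists (k * e)%N; rewrite exprM. Qed.

Lemma nil_plucker_zero A : p A = 0 -> nil_mod J (z A).
Proof.
by move=> pA; apply: (@nil_eq _ 0); [rewrite rees_zvar pA rees0 polyC0 mul0r|apply: ideal0].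
Qed.

(** In the Lagrangian relation for a and a', the term j = i on the left is p_A squared. Every other
    term has a factor of smaller weight: on the left the two weights change by i - j and j - i, on
    the right by i + j + 2 and its opposite. *)
Lemma nil_plucker_pair A a a' i :
  (forall B : sel, (selwt B < selwt A)%N -> nil_mod J (z B)) ->
  A a = lshift n i -> A a' = rshift n i -> nil_mod J (z A).
Proof.
move=> ih Aa Aa'; apply: (@nil_pow _ 2).
pose t := \sum_j z (upd A a (rshift n j)) * z (upd A a' (lshift n j)) -
  \sum_(j | j != i) z (upd A a (lshift n j)) * z (upd A a' (rshift n j)).
have wa k := selwt_upd A a k; have wa' k := selwt_upd A a' k.
rewrite Aa in wa; rewrite Aa' in wa'; rewrite colwtl in wa; rewrite colwtr in wa'.
apply: (@nil_eq _ t).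
  have e (f g : 'I_n -> sel) (P : pred 'I_n) :
      rs (\sum_(j | P j) z (f j) * z (g j)) = (\sum_(j | P j) p (f j) * p (g j))%:P * 'X ^+ 2.
    rewrite rees_sum (rmorph_sum polyC) [RHS]mulr_suml; apply: eq_bigr => j _ /=.
    by rewrite reesM !rees_zvar polyMX2.
  have h := p_lagrange A a a'.
  rewrite (bigD1 i isT) /= -{1}Aa -Aa' !upd_id in h.
  rewrite /t reesB !e -h -mulrBl -polyCB addrK expr2 reesM rees_zvar.
  exact: polyMX2.

rewrite /t; apply: (idealB iN); (apply: ideal_sum => [|j hj]; first exact: iN).
  have lt : (selwt (upd A a (rshift n j)) < selwt A)%N \/
            (selwt (upd A a' (lshift n j)) < selwt A)%N.
    have := wa (rshift n j); have := wa' (lshift n j); rewrite colwtl colwtr.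
    by have := ltn_ord i; have := ltn_ord j; lia.
  by case: lt => /ih h; [apply: (idealMr _ iN h)|apply: (idealMl _ iN h)].
have lt : (selwt (upd A a (lshift n j)) < selwt A)%N \/
          (selwt (upd A a' (rshift n j)) < selwt A)%N.
  have := wa (lshift n j); have := wa' (rshift n j); rewrite colwtl colwtr.
  have : (j : nat) <> i by move/val_inj => ji; rewrite ji eqxx in hj.
  by have := ltn_ord i; have := ltn_ord j; lia.
by case: lt => /ih h; [apply: (idealMr _ iN h)|apply: (idealMl _ iN h)].
Qed.

(* Among the principal minors of a given weight only one survives modulo the
   coordinates of smaller weight, hence so does the coefficient they sum to. *)
Lemma nil_plucker_principal (X : {set 'I_n}) :
  (forall B : sel, (selwt B < selwt (sel_set X))%N -> nil_mod J (z B)) ->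
  nil_mod J (z (sel_set X)).
Proof.
move=> ih; set A := sel_set X in ih *.
have other Y : setwt Y = setwt X -> Y != X -> nil_mod J (z A ^+ n * z (sel_set Y)).
  move=> wY YX; set B := sel_set Y.
  have wB : selwt B = selwt A by apply: selwt_set.
  apply: (@nil_eq _ (z A * \det (\matrix_(a, b) z (upd A a (B b))))).
    rewrite !reesM reesX rees_det !rees_zvar.
    have -> : map_mx rs (\matrix_(a, b) z (upd A a (B b))) =
      'X *: map_mx polyC (\matrix_(a, b) p (upd A a (B b))).
      by apply/matrixP => a b; rewrite !mxE rees_zvar mulrC.
    rewrite detZ det_map_mx /= exprMn.
    have := congr1 polyC (p_exchange A B).
    rewrite !polyCM rmorphXn /=; move: (\det _) (p A)%:P (p B)%:P => u v w h.
    transitivity (v ^+ n * w * 'X ^+ n * 'X); first by ring.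
    by rewrite -h; ring.
  apply: (idealMl _ iN); apply: ideal_sum => [|s _]; first exact: iN.
  apply: (idealMl _ iN).
  (* If no factor had smaller weight than A, the equality of total weights would force equality
     column by column, hence [s a = a] for all a and Y = X. *)
  have [a lt] : exists a, (selwt (upd A a (B (s a))) < selwt A)%N.
    apply/existsP; apply: contraR YX; rewrite negb_exists => /forallP ge.
    have hle a : (colwt (A a) <= colwt (B (s a)))%N.
      by have := ge a; have := selwt_upd A a (B (s a)); lia.
    have sumE : (\sum_a colwt (A a) = \sum_a colwt (B (s a)))%N.
      by rewrite -[LHS]/(selwt A) -wB /selwt (reindex_inj (@perm_inj _ s)).
    have heq a : colwt (A a) = colwt (B (s a)).
      apply/eqP; rewrite eqn_leq hle /= leqNgt; apply/negP => lt.
      suff : (\sum_a colwt (A a) < \sum_a colwt (B (s a)))%N by rewrite sumE ltnn.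
      rewrite (bigD1 a) //= [X in (_ < X)%N](bigD1 a) //= -addSn leq_add //.
      by apply: leq_sum => b _.
    have sid a : s a = a /\ (a \in Y) = (a \in X).
      have /colwt_inj := heq a; rewrite !ffunE; have la := ltn_ord a; have ls := ltn_ord (s a).
      case: (boolP (a \in X)) => aX; case: (boolP (s a \in Y)) => sY /(congr1 val) /= e.
      - have sa : s a = a by apply/val_inj => /=; lia.
        by move: sY; rewrite sa.
      - by lia.
      - by lia.
      - have sa : s a = a by apply/val_inj => /=; lia.
        by move: sY; rewrite sa => /negPf.
    by apply/eqP/setP => a; have [_ ->] := sid a.
  rewrite (bigD1 a) //= mxE; apply: (idealMr _ iN); exact: ih.
have kd : (setwt X < d.+1)%N by rewrite ltnS setwt_le.
pose g := \sum_(Y : {set 'I_n} | setwt Y == setwt X) (-1) ^+ #|Y| * z (sel_set Y).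
have Jg : J g.
  apply: (@rees_ideal_gen _ _ _ _ _ _ (Ordinal kd)).
  rewrite /g rees_sum /base_coef rmorph_sum mulr_suml; apply: eq_bigr => Y _.
  by rewrite reesM rees_zvar rees_sign rmorphM rmorph_sign mulrA.
apply: (@nil_pow _ n.+1).
(* In z_A^n g all terms but one are nilpotent by [other], and the remaining one is z_A^(n+1) up to
   sign. *)
have -> : z A ^+ n.+1 = (-1) ^+ #|X| * (z A ^+ n * g) -
  (-1) ^+ #|X| * \sum_(Y | (setwt Y == setwt X) && (Y != X)) (-1) ^+ #|Y| * (z A ^+ n * z (sel_set Y)).
  rewrite /g (bigD1 X) //= mulrDr mulrDr addrAC.
  have -> : z A ^+ n * \sum_(Y | (setwt Y == setwt X) && (Y != X)) (-1) ^+ #|Y| * z (sel_set Y) =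
    \sum_(Y | (setwt Y == setwt X) && (Y != X)) (-1) ^+ #|Y| * (z A ^+ n * z (sel_set Y)).
    by rewrite mulr_sumr; apply: eq_bigr => Y _; rewrite mulrCA.
  rewrite -addrA [- _ + _]addrC subrr addr0 mulrCA -/A.
  by rewrite [(-1) ^+ #|X| * _]mulrA -expr2 sqrr_sign mul1r exprSr.
apply: (idealB iN); apply: (idealMl _ iN).
  by apply: J_nil; apply: (idealMl _ iJ).
apply: ideal_sum => [|Y /andP [/eqP wY YX]]; first exact: iN.
apply: (idealMl _ iN).
exact: other.
Qed.

(** Induction on the weight: a selection repeats a column, contains a conjugate pair, or is a
    principal minor up to a permutation. *)
Lemma nil_plucker A : nil_mod J (z A).
Proof.
have [m] := ubnP (selwt A); elim: m A => // m ih A; rewrite ltnS => lem.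
have {}ih B : (selwt B < selwt A)%N -> nil_mod J (z B).
  by move=> lt; apply: ih; apply: leq_trans lt lem.
have [/injectiveP iA|/p_noninj nA] := boolP (injectiveb A); last exact: nil_plucker_zero.
have [[a [a' [i [h h']]]]|nb] := classic (exists a a' i, A a = lshift n i /\ A a' = rshift n i).
  exact: nil_plucker_pair ih h h'.
have [|s [X AE]] := sel_principal iA.
  by move=> a a' i h h'; apply: nb; exists a, a', i.
have wA : selwt A = selwt (sel_set X).
  rewrite AE /selwt; under eq_bigr do rewrite ffunE.
  by rewrite [RHS](reindex_inj (@perm_inj _ s)).
apply: (@nil_eq _ ((-1) ^+ s * z (sel_set X))).
  rewrite reesM !rees_zvar rees_sign AE p_perm polyCM.
  by rewrite rmorph_sign mulrA.
apply: (idealMl _ iN); apply: nil_plucker_principal => B; rewrite -wA; exact: ih.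
Qed.

End BaseNilpotency.

(** * The degree of the base fiber *)

Section WeightFiltration.
Variables (K : fieldType) (N : nat) (w : 'I_N -> nat).
Local Notation R := {mpoly K[N]}.
Hypothesis w0 : forall k, (0 < w k)%N.
Local Notation zero := (fun x : R => x = 0).

Definition wfil m (x : R) : Prop := wle w m x.

Definition monf m (a : mon w m) : R := 'X_[mon_mnm a].

Lemma monf_indep m : indep zero (@monf m).
Proof.
move=> l /(congr1 (mcoeff _)) h a; have := h (mon_mnm a).
rewrite raddf_sum mcoeff0 (bigD1 a) //= mcoeffZ mcoeffX eqxx mulr1 big1 ?addr0 //.
move=> b ba; rewrite mcoeffZ mcoeffX; case: eqP => [/mon_mnm_inj e|_]; last by rewrite mulr0.
by rewrite e eqxx in ba.
Qed.

Lemma monf_spanned m x : wfil m x -> spanned zero (@monf m) x.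
Proof.
move=> hx; rewrite [x]mpolyE big_seq.
have ss : subsp (spanned zero (@monf m)) by apply: spanned_subsp; apply: subsp_eq0.
apply: subsp_sum => // mm /hx /(mon_mnm_surj w0) [a <-].
by apply: subspZ => //; apply: (@spanned_gen _ _ _ zero (@monf m) a (subsp_eq0 _)).
Qed.

Lemma wleZ m a (x : R) : wle w m x -> wle w m (a *: x).
Proof. by move=> hx; rewrite -mul_mpolyC -[m]add0n; apply: wleM => //; apply: wleC. Qed.

Lemma wfil_filtration : filtration wfil.
Proof.
split.
- by move=> m; split; [apply: wle0|move=> a x y hx hy; apply: wleD => //; apply: wleZ].
- by move=> m x; apply: wle_leq.
- by move=> a b x y; apply: wleM.
- by rewrite -mpolyC1; apply: wleC.
- by move=> x; apply: wle_exists.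
move=> m; exists #|{: mon w m}|, (fun k => @monf m (enum_val k)) => x /monf_spanned [l hl].
exists (fun k => l (enum_val k)).
rewrite (_ : \sum_(k < _) _ = \sum_t l t *: @monf m t) //.
by rewrite [RHS](reindex (@enum_val (mon w m) predT)) //; apply: onW_bij; apply: enum_val_bij.
Qed.

(** The substitution X_t -> X_t h^(w t): x is homogeneous of weight e exactly when its image is x
    h^e, and the coefficient of h^j is the component of weight j. *)
Definition wgrade : R -> {poly R} :=
  mmap (polyC \o @mpolyC N K) (fun t => ('X_t)%:P * 'X ^+ w t).
HB.instance Definition _ := GRing.RMorphism.on wgrade.

Lemma wgradeC a : wgrade a%:MP = a%:MP%:P.
Proof. by rewrite /wgrade mmapC. Qed.

Lemma wgradeXU t : wgrade 'X_t = ('X_t)%:P * 'X ^+ w t.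
Proof. by rewrite /wgrade mmapX mmap1U. Qed.

Lemma wgradeX m : wgrade 'X_[m] = ('X_[m])%:P * 'X ^+ wt w m.
Proof.
rewrite /wgrade mmapX /mmap1 mpolyXE_id rmorph_prod /wt -prodrXr -big_split /=.
by apply: eq_bigr => t _; rewrite exprMn -exprM mulnC rmorphXn.
Qed.

Lemma wgradeE x : wgrade x = \sum_(m <- msupp x) (x@_m *: 'X_[m])%:P * 'X ^+ wt w m.
Proof.
rewrite {1}[x]mpolyE rmorph_sum /=; apply: eq_bigr => m _.
by rewrite -mul_mpolyC rmorphM /= wgradeX wgradeC polyCM mulrA.
Qed.

Lemma wgradeM x y : wgrade (x * y) = wgrade x * wgrade y.
Proof. exact: rmorphM. Qed.
Lemma wgradeB x y : wgrade (x - y) = wgrade x - wgrade y.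
Proof. exact: rmorphB. Qed.
Lemma wgrade_sum (T : Type) (r : seq T) (P : pred T) F :
  wgrade (\sum_(i <- r | P i) F i) = \sum_(i <- r | P i) wgrade (F i).
Proof. exact: rmorph_sum. Qed.
Lemma wgrade_sign k : wgrade ((-1) ^+ k) = (-1) ^+ k.
Proof. exact: rmorph_sign. Qed.
Lemma wgrade_det k (M : 'M_k) : wgrade (\det M) = \det (map_mx wgrade M).
Proof. by rewrite det_map_mx. Qed.
Lemma wgrade_nat b : wgrade b%:R = b%:R.
Proof. exact: rmorph_nat. Qed.

Opaque wgrade.

Lemma wgrade_coef x j : (wgrade x)`_j = \sum_(m <- msupp x | wt w m == j) x@_m *: 'X_[m].
Proof.
rewrite wgradeE coef_sum [RHS]big_mkcond /=; apply: eq_bigr => m _.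
by rewrite coefCM coefXn eq_sym; case: eqP; rewrite ?mulr1 ?mulr0.
Qed.

Lemma wgrade_coef_wle x j : wle w j (wgrade x)`_j.
Proof.
rewrite wgrade_coef; apply: wle_sum => m /eqP <-; apply: wleZ.
by move=> m'; rewrite msuppX inE => /eqP ->.
Qed.

Lemma wgrade_coef_gt x j m : wle w m x -> (m < j)%N -> (wgrade x)`_j = 0.
Proof.
move=> hx mj; rewrite wgrade_coef big_seq_cond big1 // => mm /andP [/hx le /eqP e].
by move: le; rewrite e leqNgt mj.
Qed.

Lemma wle_sub_top x m : wle w m.+1 x -> wle w m (x - (wgrade x)`_m.+1).
Proof.
move=> hx; rewrite wgrade_coef {1}[x]mpolyE (bigID (fun mm => wt w mm == m.+1)) /= addrAC subrr add0r.
rewrite big_seq_cond; apply: wle_sum => mm /andP [/hx le ne]; apply: wleZ => m'.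
rewrite msuppX inE => /eqP ->; by rewrite -ltnS ltn_neqAle ne.
Qed.

Lemma wgrade_top x j : wgrade (wgrade x)`_j = ((wgrade x)`_j)%:P * 'X ^+ j.
Proof.
rewrite wgrade_coef wgrade_sum (rmorph_sum polyC) mulr_suml; apply: eq_bigr => m /eqP <-.
by rewrite /= -mul_mpolyC wgradeM wgradeX wgradeC polyCM mulrA.
Qed.

(** For homogeneous c a finite-dimensional quotient is enough. The top component of x is congruent
    modulo (c) to a combination of the v_i, whose weights are at most B0; in weight m + 1 that
    combination disappears from the congruence. *)
Lemma wfil_admissible (c : 'I_N -> R) (e : 'I_N -> nat) (I : finType) (v : I -> R) :
  (forall k, 0 < e k)%N -> (forall k, wgrade (c k) = (c k)%:P * 'X ^+ e k) ->
  (forall x, spanned (idealOf predT c) v x) -> admissible wfil e c.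
Proof.
move=> e0 hom sv; split=> //.
  move=> k; have := @wgrade_coef_wle (c k) (e k).
  by rewrite hom coefCM coefXn eqxx mulr1.
have [B0 hB0] := wle_exists_fin w v.
exists (B0 + \max_k e k)%N; split.
  by move=> k; apply: leq_trans (leq_addl _ _); apply: leq_bigmax.
case=> // m x mB hx; have := @wle_sub_top x m hx; have := @wgrade_top x m.+1.
move: (wgrade x)`_m.+1 => top htop wtop.
have [S [lw hS]] : exists S, wle w B0 S /\ idealOf predT c (top - S).
  have [l hl] := sv top; exists (\sum_i l i *: v i); split=> //.
  by apply: wle_sum => i _; apply: wleZ.
have [y hy] := idealOf_sum hS.
have em k : (e k <= m.+1)%N.
  by apply: leq_trans (leq_bigmax k) _; apply: leq_trans (leq_addl _ _) (ltnW mB).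
exists (x - top), (fun k => (wgrade (y k))`_(m.+1 - e k)); split.
- exact: wtop.
- by move=> k; apply: wgrade_coef_wle.
rewrite -[LHS](subrK top); congr (_ + _).
have := congr1 (fun q : R => (wgrade q)`_m.+1) hy.
have l0 : (wgrade S)`_m.+1 = 0.
  by apply: (wgrade_coef_gt lw); apply: leq_ltn_trans (leq_addr _ _) mB.
rewrite wgradeB coefB [X in _ - X]l0 subr0 htop coefCM coefXn eqxx mulr1 => ->.
rewrite wgrade_sum coef_sum; apply: eq_bigr => k _.
by rewrite wgradeM hom -mulrA coefCM mulrC coefXnM ltnNge em /= mulrC.
Qed.

(** Weighted Bezout: monomials counted by w are compared with r copies of monomials counted by e. *)
Lemma weighted_fiber_degree (c : 'I_N -> R) (e : 'I_N -> nat) r (b : 'I_r -> R) :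
  (forall k, 0 < e k)%N -> (forall k, wgrade (c k) = (c k)%:P * 'X ^+ e k) ->
  indep (idealOf predT c) b -> (forall x, spanned (idealOf predT c) b x) ->
  (r * \prod_k w k = \prod_k e k)%N.
Proof.
move=> e0 hom ib sb; have adm := wfil_admissible e0 hom sb.
have [E hE] := growth_lower wfil_filtration adm ib.
have [E' hE'] := growth_upper wfil_filtration adm sb.
apply: (@cnt_ratio N r e w E E') => // t.
  have [v [iv fv]] := hE t.
  have := indep_card_le (subsp_eq0 _) iv (fun i => monf_spanned (fv i)).
  by rewrite card_prod card_ord.
apply: (hE' _ _ _ (@monf_indep t)) => a mm.
by rewrite msuppX inE => /eqP ->; apply: wt_mon.
Qed.

End WeightFiltration.

Section BaseDegree.
Variables (K : fieldType) (n : nat).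
Local Notation d := ('C(n.+1, 2)).
Local Notation R := {mpoly K[d]}.
Local Notation F := (symX n K).
Local Notation p := (plucker F).

Definition varwt (t : 'I_d) : nat := ((upos t).1 + (upos t).2).+2.

Lemma varwt_vidx i j : varwt (vidx i j) = (i.+1 + j.+1)%N.
Proof. by rewrite /varwt upos_vidx; case: ifP => _ /=; lia. Qed.

(** Replacing F_ij by h^(i+1) F_ij h^(j+1) scales the rows by [D1] and the columns in X by [D2];
    [D3] compensates the row scaling on the identity columns. The resulting degree is twice the sum
    of i + 1 over X. *)
Lemma wgrade_plucker (X : {set 'I_n}) :
  wgrade varwt (p (sel_set X)) = (p (sel_set X))%:P * 'X ^+ (2 * (d - setwt X)).
Proof.
pose M := colsub (sel_set X) (graph_mx F).
pose D1 : 'rV[{poly R}]_n := \row_i 'X ^+ i.+1.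
pose D2 : 'rV[{poly R}]_n := \row_b (if b \in X then 'X ^+ b.+1 else 1).
pose D3 : 'rV[{poly R}]_n := \row_b (if b \in X then 1 else 'X ^+ b.+1).
have eM : map_mx (wgrade varwt) M *m diag_mx D3 = diag_mx D1 *m map_mx polyC M *m diag_mx D2.
  apply/matrixP => i b.
  have Me : M i b = graph_mx F i (sel_set X b) by rewrite mxE.
  have -> : (map_mx (wgrade varwt) M *m diag_mx D3) i b = wgrade varwt (M i b) * D3 0 b.
    by rewrite mul_mx_diag mxE; congr (_ * _); rewrite mxE.
  have -> : (diag_mx D1 *m map_mx polyC M *m diag_mx D2) i b = D1 0 i * (M i b)%:P * D2 0 b.
    rewrite mul_mx_diag mxE; congr (_ * _); rewrite mul_diag_mx mxE; congr (_ * _).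
    by rewrite mxE.
  rewrite Me ffunE [D1 0 i]mxE [D2 0 b]mxE [D3 0 b]mxE; case: ifP => bX.
    by rewrite graph_mx_r mxE wgradeXU varwt_vidx exprD; ring.
  rewrite graph_mx_l wgrade_nat rmorph_nat; case: eqP => [->|_]; rewrite ?mulr1n ?mulr0n; ring.
have dD1 : \det (diag_mx D1) = 'X ^+ d.
  rewrite det_diag; transitivity ('X ^+ (\sum_(i < n) i.+1) : {poly R}); last by rewrite sum_succ.
  by rewrite -prodrXr; apply: eq_bigr => i _; rewrite mxE.
have dD3 : \det (diag_mx D3) = 'X ^+ setwt X.
  rewrite det_diag /setwt -prodrXr [RHS]big_mkcond /=; apply: eq_bigr => i _.
  by rewrite mxE inE; case: ifP.
have dD2 : \det (diag_mx D2) * 'X ^+ setwt X = 'X ^+ d.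
  rewrite -dD3 -dD1 !det_diag -big_split /=; apply: eq_bigr => i _.
  by rewrite !mxE; case: ifP => _; rewrite ?mulr1 ?mul1r.
have := congr1 determinant eM; rewrite !det_mulmx -wgrade_det !det_map_mx dD1 dD3 -/(p _) => h.
have {}h : wgrade varwt (p (sel_set X)) * 'X ^+ (2 * setwt X) =
    (p (sel_set X))%:P * 'X ^+ (2 * (d - setwt X)) * 'X ^+ (2 * setwt X).
  rewrite mul2n -addnn exprD mulrA h -!mulrA dD2 mulrCA -!exprD; congr (_ * 'X ^+ _).
  by have := setwt_le X; lia.
have m0 : 'X ^+ (2 * setwt X) != 0 :> {poly R} by rewrite expf_neq0 ?polyX_eq0.
exact: (mulIf m0 h).
Qed.

Lemma wgrade_base (k : 'I_d) :
  wgrade varwt (base_coef p k) = (base_coef p k)%:P * 'X ^+ (2 * (d - k)).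
Proof.
rewrite /base_coef wgrade_sum (rmorph_sum polyC) mulr_suml; apply: eq_bigr => X /eqP <-.
by rewrite wgradeM wgrade_sign wgrade_plucker rmorphM rmorph_sign mulrA.
Qed.

Lemma prod_weights : (\prod_t varwt t = 2 ^ d * \prod_(i < n) (2 * i + 1) ^ (n - i))%N.
Proof.
rewrite (prod_upos n (fun i j => (i + j).+2)).
transitivity (\prod_(j < n) \prod_(i < j.+1) (i + j).+2)%N.
  apply: eq_bigr => j _; rewrite -(big_mkord xpredT (fun i => (i + j).+2)).
  rewrite -(big_mkord (fun i => i <= j)%N (fun i => (i + j).+2)).
  rewrite (big_cat_nat _ (n := j.+1)) //= [X in (_ * X)%N]big1_seq ?muln1; last first.
    by move=> i /andP [ij]; rewrite mem_index_iota; lia.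
  by rewrite big_nat_cond [RHS]big_nat; apply: eq_bigl => i; rewrite ltnS andbb.
(* This product is (2m+2)!/(m+1)!, that is, 2^(m+1) times the product of the odd numbers up to
   2m+1. *)
have row m : (\prod_(i < m.+1) (i + m).+2 = 2 ^ m.+1 * \prod_(i < m.+1) (2 * i + 1))%N.
  elim: m => [|k ih]; first by rewrite !big_ord1.
  rewrite 2!big_ord_recr [in RHS]big_ord_recr /= expnS.
  rewrite big_ord_recl /= in ih.
  have -> : (\prod_(i < k) (i + k.+1).+2 = \prod_(i < k) (bump 0 i + k).+2)%N.
    by apply: eq_bigr => i _; rewrite /bump /= addnS.
  move: ih; set A := (\prod_(i < k) _)%N; set B := (\prod_(i < k.+1) _)%N; set C := (2 ^ _)%N => ih.
  have -> : ((k.+1 + k.+1).+2 = 2 * (0 + k).+2)%N by lia.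
  have -> : ((k + k.+1).+2 = 2 * k.+1 + 1)%N by lia.
  transitivity ((0 + k).+2 * A * (2 * (2 * k.+1 + 1)))%N; first by ring.
  by rewrite ih; ring.
elim: n => [|m ih]; first by rewrite !big_ord0.
have cm : 'C(m.+2, 2) = ('C(m.+1, 2) + m.+1)%N by rewrite binS bin1.
rewrite big_ord_recr /= ih row cm expnD [in RHS]big_ord_recr /= subSn // subnn expn1.
have -> : (\prod_(i < m) (2 * i + 1) ^ (m.+1 - i) =
    (\prod_(i < m) (2 * i + 1) ^ (m - i)) * \prod_(i < m) (2 * i + 1))%N.
  rewrite -big_split /=; apply: eq_bigr => i _.
  by rewrite subSn ?expnSr // ltnW.
by rewrite big_ord_recr /=; ring.
Qed.

Lemma prod_base_weights : (\prod_(k < d) (2 * (d - k)) = 2 ^ d * d`!)%N.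
Proof.
rewrite big_split /= prod_nat_const card_ord fact_prod; congr (_ * _)%N.
rewrite big_add1 /= big_mkord (reindex_inj rev_ord_inj) /=; apply: eq_bigr => k _.
by have := ltn_ord k; lia.
Qed.

Lemma base_fiber_degree r (b : 'I_r -> R) (c := fun k : 'I_d => base_coef p k) :
  indep (idealOf predT c) b -> (forall x, spanned (idealOf predT c) b x) -> r = dLG n.
Proof.
move=> ib sb; have := @weighted_fiber_degree _ _ varwt _ c (fun k => 2 * (d - k))%N r b _ _ ib sb.
rewrite prod_weights prod_base_weights => h.
have {}h : (r * \prod_(i < n) (2 * i + 1) ^ (n - i) = d`!)%N.
  have : (2 ^ d * (r * \prod_(i < n) (2 * i + 1) ^ (n - i)) = 2 ^ d * d`!)%N.
    rewrite mulnCA; apply: h => // k; first by have := ltn_ord k; lia.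
    exact: wgrade_base.
  by move/eqP; rewrite eqn_pmul2l ?expn_gt0 // => /eqP.
rewrite /dLG -h mulnK // prodn_gt0 // => i; by rewrite expn_gt0 addn1.
Qed.

End BaseDegree.

(** * Openness *)

Section OpenCertificate.
Variables (K : fieldType) (N M d : nat) (I : finType).
Local Notation R := {mpoly K[N]}.
Local Notation Q := {mpoly K[M]}.
Local Notation zero := (fun x : R => x = 0).
Variables (p : I -> R) (i0 : I) (p1 : p i0 = 1).
Variable gam : 'I_d -> I -> Q.

Definition coefs_at (x : 'I_M -> K) (k : 'I_d) : R := \sum_i (gam k i).@[x] *: p i.

(** For fixed B this is a spanning condition in one finite-dimensional space, hence open in c. *)
Definition certificate B (c : 'I_d -> R) :=
  forall x, prodspan p B.+1 x -> exists x0, exists y : 'I_d -> R,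
    [/\ prodspan p B x0, forall k, prodspan p B (y k) & x = x0 + \sum_k c k * y k].

Lemma spanned_eq (T : finType) (v : T -> R) x : spanned zero v x -> exists l, x = \sum_t l t *: v t.
Proof. by move=> [l /eqP]; rewrite subr_eq0 => /eqP ->; exists l. Qed.

(* The c_k times generators of V_B span V_{B+1} at the point x0; this persists
   where a maximal minor that is nonzero at x0 does not vanish. *)
Lemma open_certificate B (x0 : 'I_M -> K) : certificate B (coefs_at x0) ->
  exists P : Q, P.@[x0] != 0 /\ forall x, P.@[x] != 0 -> certificate B (coefs_at x).
Proof.
move=> cert.
have [T0 [v0 [_ sv0]]] := prodspan_fin p B.+1.
have [r [v [vV iv sv]]] := exists_basis_of (subsp_eq0 _) (prodspan_subsp p B.+1) sv0.
have [T [u [uV su]]] := prodspan_fin p B.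
have /fin_all_exists [lam hlam] : forall it : I * T, exists l : 'I_r -> K,
    p it.1 * u it.2 = \sum_s l s *: v s.
  by move=> [i t]; apply: spanned_eq; apply: sv; apply: prodspan_gen.
have /fin_all_exists [mu hmu] : forall t : T, exists l : 'I_r -> K, u t = \sum_s l s *: v s.
  by move=> t; apply: spanned_eq; apply: sv; apply: prodspan_mono p1 _ _ (uV t).
pose E := ('I_d * T + T)%type.
pose zz (x : 'I_M -> K) (e : E) := match e with inl kt => coefs_at x kt.1 * u kt.2 | inr t => u t end.
pose Z : 'M[Q]_(#|{: E}|, r) := \matrix_(a, s)
  match enum_val a with
  | inl kt => \sum_i lam (i, kt.2) s *: gam kt.1 i
  | inr t => (mu t s)%:MP
  end.
pose Zx x := map_mx (meval x) Z.
have zE x a : zz x (enum_val a) = \sum_s Zx x a s *: v s.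
  rewrite /zz; case ea: (enum_val a) => [[k t]|t] /=.
    under eq_bigr do rewrite !mxE ea /= raddf_sum scaler_suml.
    rewrite exchange_big mulr_suml /=; apply: eq_bigr => i _.
    rewrite -scalerAl (hlam (i, t)) scaler_sumr; apply: eq_bigr => s _.
    by rewrite /= mevalZ scalerA mulrC.
  by rewrite hmu; apply: eq_bigr => s _; rewrite !mxE ea /= mevalC.
have [W hW] : exists W : 'M_(r, #|{: E}|), W *m Zx x0 = 1%:M.
  have /fin_all_exists [W hW] : forall s, exists l : E -> K, v s = \sum_e l e *: zz x0 e.
    move=> s; have [y0 [y [/su/spanned_eq [l0 ->] hy ->]]] := cert _ (vV s).
    have /fin_all_exists [l hl] : forall k, exists l : T -> K, y k = \sum_t l t *: u t.
      by move=> k; apply/spanned_eq/su/hy.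
    exists (fun e => match e with inl kt => l kt.1 kt.2 | inr t => l0 t end).
    rewrite big_sumType /= addrC; congr (_ + _).
    rewrite -(pair_bigA _ (fun k t => l k t *: (coefs_at x0 k * u t))) /=.
    apply: eq_bigr => k _; rewrite hl mulr_sumr; apply: eq_bigr => t _.
    by rewrite scalerAr.
  exists (\matrix_(s, a) W s (enum_val a)); apply/matrixP => s s'; rewrite mxE.
  have h : \sum_s1 ((\sum_a W s (enum_val a) * Zx x0 a s1) - (s == s1)%:R) *: v s1 = 0.
    under eq_bigr do rewrite scalerBl; rewrite sumrB.
    have -> : \sum_s1 (s == s1)%:R *: v s1 = v s.
      rewrite (bigD1 s) //= eqxx scale1r big1 ?addr0 // => i /negPf.
      by rewrite eq_sym => ->; rewrite scale0r.
    rewrite [X in _ - X]hW [X in _ - X](reindex (@enum_val E predT)) /=; last first.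
      by apply: onW_bij; apply: enum_val_bij.
    apply/eqP; rewrite subr_eq0; apply/eqP; under eq_bigr do rewrite scaler_suml.
    rewrite exchange_big /=; apply: eq_bigr => a _; rewrite zE scaler_sumr.
    by apply: eq_bigr => s1 _; rewrite scalerA.
  have /eqP := iv _ h s'; rewrite subr_eq0 mxE => /eqP <-.
  by apply: eq_bigr => a _; rewrite mxE.
have full : row_full (Zx x0) by apply/row_fullP; exists W.
pose f := fullrankfun full.
exists (\det (rowsub f Z)).
have mapZ x : (\det (rowsub f Z)).@[x] = \det (rowsub f (Zx x)).
  by rewrite -[LHS]/(meval x _) -det_map_mx; congr (\det _); apply/matrixP => i j; rewrite !mxE.
split.
  by rewrite mapZ -unitfE; apply: fullrowsub_unit.
move=> x Px y hy; have [l ->] := spanned_eq (sv _ hy).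
have un : rowsub f (Zx x) \in unitmx by rewrite unitmxE unitfE -mapZ.
pose V := invmx (rowsub f (Zx x)).
have vz s : v s = \sum_a V s a *: zz x (enum_val (f a)).
  have h : V *m rowsub f (Zx x) = 1%:M by exact: mulVmx.
  transitivity (\sum_s1 (1%:M : 'M[K]_r) s s1 *: v s1).
    rewrite (bigD1 s) //= mxE eqxx scale1r big1 ?addr0 // => i /negPf.
    by rewrite mxE eq_sym => ->; rewrite scale0r.
  rewrite -h; under eq_bigr do rewrite mxE scaler_suml.
  rewrite exchange_big /=; apply: eq_bigr => a _; rewrite zE scaler_sumr.
  by apply: eq_bigr => s1 _; rewrite scalerA [rowsub _ _ _ _]mxE.
pose good w := exists y0, exists y : 'I_d -> R,
    [/\ prodspan p B y0, forall k, prodspan p B (y k) & w = y0 + \sum_k coefs_at x k * y k].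
have sg : subsp good.
  split.
    exists 0, (fun=> 0); split; [exact: prodspan0|by move=> _; apply: prodspan0|].
    by rewrite big1 ?addr0 // => k _; rewrite mulr0.
  move=> a w w' [y0 [y1 [h0 h1 ->]]] [y0' [y1' [h0' h1' ->]]].
  have [_ sub] := prodspan_subsp p B.
  exists (a *: y0 + y0'), (fun k => a *: y1 k + y1' k); split; [exact: sub|by move=> k; apply: sub|].
  rewrite scalerDr addrACA; congr (_ + _); rewrite scaler_sumr -big_split /=.
  by apply: eq_bigr => k _; rewrite mulrDr scalerAr.
suff: good (\sum_t l t *: v t) by [].
apply: subsp_sum => // s _; apply: subspZ => //; rewrite vz.
apply: subsp_sum => // a _; apply: subspZ => //; rewrite /zz.
case: (enum_val (f a)) => [[k t]|t] /=.
  exists 0, (fun k' => if k' == k then u t else 0); split.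
  - exact: prodspan0.
  - by move=> k'; case: eqP => // _; apply: prodspan0.
  - rewrite add0r (bigD1 k) //= eqxx big1 ?addr0 // => k' /negPf ->.
    by rewrite mulr0.
exists (u t), (fun=> 0); split=> //; first by move=> _; apply: prodspan0.
by rewrite big1 ?addr0 // => k _; rewrite mulr0.
Qed.

End OpenCertificate.

Section MultilinearExpansion.
Variables (S : comNzRingType) (n m q : nat).

Lemma det_rows_expand (W : 'M[S]_(n, m)) (Z : 'M[S]_(m, n + q)) (L : 'M[S]_(q, n + q)) :
  \det (col_mx (W *m Z) L) =
  \sum_(f : {ffun 'I_n -> 'I_m}) (\prod_i W i (f i)) * \det (col_mx (rowsub f Z) L).
Proof.
rewrite /determinant.
have E (U : 'M[S]_(n, n + q)) (s : 'S_(n + q)) :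
   \prod_i col_mx U L i (s i) = (\prod_i U i (s (lshift q i))) * \prod_j L j (s (rshift n j)).
  rewrite big_split_ord /=; congr (_ * _); apply: eq_bigr => i _.
    by rewrite col_mxEu.
  by rewrite col_mxEd.
under eq_bigr do rewrite E.
under [RHS]eq_bigr do rewrite mulr_sumr.
rewrite exchange_big /=; apply: eq_bigr => s _.
under eq_bigr do rewrite mxE.
rewrite bigA_distr_bigA mulr_suml mulr_sumr /=; apply: eq_bigr => f _.
rewrite E big_split /= mulrCA -!mulrA; congr (_ * _).
rewrite mulrA [RHS]mulrCA mulrA; congr (_ * _ * _).
by apply: eq_bigr => i _; rewrite mxE.
Qed.

(** Cauchy-Binet summed over all functions: each set of rows occurs once in every order, and the
    signs collect the products into minors of W. This is the origin of the hypothesis that n! is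
    nonzero in K. *)
Lemma det_rows_alternate (W : 'M[S]_(n, m)) (Z : 'M[S]_(m, n + q)) (L : 'M[S]_(q, n + q)) :
  n`!%:R * \det (col_mx (W *m Z) L) =
  \sum_(f : {ffun 'I_n -> 'I_m}) \det (colsub f W) * \det (col_mx (rowsub f Z) L).
Proof.
pose H (f : {ffun 'I_n -> 'I_m}) := \det (col_mx (rowsub f Z) L).
have Hs (f : {ffun 'I_n -> 'I_m}) (s : 'S_n) : H [ffun i => f (s i)] = (-1) ^+ s * H f.
  rewrite /H; have -> : col_mx (rowsub [ffun i => f (s i)] Z) L =
      block_mx (perm_mx s) 0 0 1%:M *m col_mx (rowsub f Z) L.
    rewrite mul_block_col !mul0mx mul1mx addr0 add0r -row_permE; congr col_mx.
    by apply/matrixP => i j; rewrite !mxE ffunE.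
  by rewrite det_mulmx det_ublock det1 mulr1 det_perm.
have -> : n`!%:R * \det (col_mx (W *m Z) L) = \sum_(s : 'S_n) \det (col_mx (W *m Z) L).
  by rewrite sumr_const card_Sn mulr_natl.
under eq_bigr => s _.
  rewrite det_rows_expand (reindex_inj (h := fun f : {ffun 'I_n -> 'I_m} => [ffun i => f (s i)])); last first.
    move=> f g fg; apply/ffunP => i; move/ffunP: fg => /(_ ((s^-1)%g i)).
    by rewrite !ffunE permKV.
  over.
rewrite exchange_big /=; apply: eq_bigr => f _; rewrite mulr_suml; apply: eq_bigr => s _.
rewrite -/(H _) Hs mulrCA mulrA; congr (_ * _ * _).
by apply: eq_bigr => i _; rewrite ffunE mxE.
Qed.

End MultilinearExpansion.

(** * Closed-loop polynomials *)

Section ClosedLoop.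
Variables (S : comNzRingType) (q n : nat).
Implicit Types (A : 'M[S]_q) (B : 'M[S]_(q, n)) (C : 'M[S]_(n, q)) (F : 'M[S]_n).
Local Notation sel := {ffun 'I_n -> 'I_(n + n)}.

(** Chosen so that [I, F] times [cl_sel] is [I, 0, F]; in the determinant below, F enters through
    these n rows only. *)
Definition cl_sel : 'M[{poly S}]_(n + n, n + (q + n)) := block_mx 1%:M 0 0 (row_mx 0 1%:M).

Definition cl_rows A B C : 'M[{poly S}]_(q + n, n + (q + n)) :=
  row_mx (col_mx (- map_mx polyC B) 0) (block_mx (char_poly_mx A) 0 (map_mx polyC C) 1%:M).

Definition cl_minor A B C (f : sel) : {poly S} :=
  \det (col_mx (rowsub f cl_sel) (cl_rows A B C)).

(* Eliminating the n-blocks of [I, 0, F; -B, X - A, 0; 0, C, I] leaves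
   X - A - B F C. *)
Lemma det_closed_loop A B C F :
  \det (col_mx (graph_mx (map_mx polyC F) *m cl_sel) (cl_rows A B C)) =
  char_poly (A + B *m F *m C).
Proof.
set a := map_mx polyC A; set b := map_mx polyC B; set c := map_mx polyC C.
set f := map_mx polyC F.
have -> : graph_mx f *m cl_sel = row_mx 1%:M (row_mx 0 f).
  by rewrite /graph_mx /cl_sel mul_row_block !mulmx0 mulmx1 addr0 add0r mul_mx_row mulmx0 mulmx1.
have -> : col_mx (row_mx 1%:M (row_mx 0 f)) (cl_rows A B C) =
    block_mx 1%:M (row_mx 0 f) (col_mx (- b) 0) (block_mx (char_poly_mx A) 0 c 1%:M).
  by rewrite /cl_rows block_mxEv.
have e1 : block_mx 1%:M (row_mx 0 f) (col_mx (- b) 0) (block_mx (char_poly_mx A) 0 c 1%:M) *m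
   block_mx 1%:M (- row_mx 0 f) 0 1%:M =
   block_mx 1%:M 0 (col_mx (- b) 0) (block_mx (char_poly_mx A) (b *m f) c 1%:M).
  rewrite mulmx_block !mulmx1 !mulmx0 !addr0 mulmxN mul1mx addNr; congr block_mx.
  rewrite mulmxN mul_col_row !mulmx0 !mul0mx mulNmx opp_block_mx add_block_mx.
  by rewrite !oppr0 opprK !add0r addr0.
have e2 : block_mx (char_poly_mx A) (b *m f) c 1%:M *m block_mx 1%:M 0 (- c) 1%:M =
   block_mx (char_poly_mx A - b *m f *m c) (b *m f) 0 1%:M.
  by rewrite mulmx_block !mulmx1 !mulmx0 !add0r mulmxN mulmxN mul1mx subrr.
have := congr1 determinant e1; rewrite det_mulmx det_ublock !det1 !mulr1 => ->.
rewrite det_lblock det1 mul1r.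
have := congr1 determinant e2; rewrite det_mulmx det_lblock !det1 !mulr1 => ->.
rewrite det_ublock det1 mulr1 /char_poly; congr (\det _).
by rewrite /char_poly_mx raddfD /= !map_mxM opprD addrA.
Qed.

Lemma plucker_map (S' : comNzRingType) (g : {rmorphism S -> S'}) F (f : sel) :
  plucker (map_mx g F) f = g (plucker F f).
Proof.
rewrite /plucker -det_map_mx; congr (\det _); apply/matrixP => i j.
rewrite !mxE; case: split => k; rewrite !mxE //.
by rewrite rmorph_nat.
Qed.

Lemma char_poly_closed_loop A B C F :
  n`!%:R * char_poly (A + B *m F *m C) = \sum_(f : sel) (plucker F f)%:P * cl_minor A B C f.
Proof.
rewrite -det_closed_loop det_rows_alternate; apply: eq_bigr => f _; congr (_ * _).
by rewrite -plucker_map.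
Qed.

End ClosedLoop.

Lemma cl_minor_map (S S' : comNzRingType) (g : {rmorphism S -> S'}) q n
    (A : 'M[S]_q) (B : 'M[S]_(q, n)) (C : 'M[S]_(n, q)) f :
  cl_minor (map_mx g A) (map_mx g B) (map_mx g C) f = map_poly g (cl_minor A B C f).
Proof.
rewrite /cl_minor -[RHS]/((map_poly g : {rmorphism _ -> _}) _) -det_map_mx; congr (\det _).
rewrite map_col_mx; congr col_mx.
  rewrite map_mxsub /cl_sel map_block_mx map_row_mx !map_mx1 !map_mx0 //.
rewrite /cl_rows map_row_mx map_col_mx map_block_mx map_mx1 !map_mx0 map_mxN.
rewrite -!map_mx_comp map_char_poly_mx; congr row_mx.
  by congr col_mx; congr (- _); apply: eq_map_mx => x /=; rewrite map_polyC.
by congr block_mx; apply: eq_map_mx => x /=; rewrite map_polyC.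
Qed.

Section GenericRealization.
Variables (K : fieldType) (q n : nat).
Local Notation M := (q * q + q * n + n * q)%N.
Local Notation Q := {mpoly K[M]}.

(** The universal realization, with its variables placed as in [real_pt]. *)
Definition gA : 'M[Q]_q := \matrix_(i, j) 'X_(lshift _ (lshift _ (mxvec_index i j))).
Definition gB : 'M[Q]_(q, n) := \matrix_(i, j) 'X_(lshift _ (rshift _ (mxvec_index i j))).
Definition gC : 'M[Q]_(n, q) := \matrix_(i, j) 'X_(rshift _ (mxvec_index i j)).

Lemma gA_eval A (B : 'M_(q, n)) (C : 'M_(n, q)) : map_mx (meval (real_pt A B C)) gA = A.
Proof. by apply/matrixP => i j; rewrite !mxE mevalXU /real_pt !row_mxEl mxvecE. Qed.

Lemma gB_eval A (B : 'M_(q, n)) (C : 'M_(n, q)) : map_mx (meval (real_pt A B C)) gB = B.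
Proof. by apply/matrixP => i j; rewrite !mxE mevalXU /real_pt row_mxEl row_mxEr mxvecE. Qed.

Lemma gC_eval A (B : 'M_(q, n)) (C : 'M_(n, q)) : map_mx (meval (real_pt A B C)) gC = C.
Proof. by apply/matrixP => i j; rewrite !mxE mevalXU /real_pt row_mxEr mxvecE. Qed.

Definition generic_coef (k : nat) (f : {ffun 'I_n -> 'I_(n + n)}) : Q :=
  (n`!%:R)^-1 *: (cl_minor gA gB gC f)`_k.

Lemma closed_loop_coef N (A : 'M[K]_q) (B : 'M[K]_(q, n)) (C : 'M[K]_(n, q))
    (F : 'M[{mpoly K[N]}]_n) k : n`!%:R != 0 :> K ->
  (char_poly (map_mx (@mpolyC N K) A + map_mx (@mpolyC N K) B *m F *m map_mx (@mpolyC N K) C))`_k =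
  \sum_f (generic_coef k f).@[real_pt A B C] *: plucker F f.
Proof.
move=> n0; set c := char_poly _.
have h : n`!%:R *: c`_k = \sum_f (cl_minor A B C f)`_k *: plucker F f.
  have := congr1 (fun p : {poly {mpoly K[N]}} => p`_k)
    (char_poly_closed_loop (map_mx (@mpolyC N K) A) (map_mx (@mpolyC N K) B) (map_mx (@mpolyC N K) C) F).
  rewrite -/c mulr_natl coefMn scaler_nat => ->; rewrite coef_sum.
  apply: eq_bigr => f _.
  by rewrite coefCM cl_minor_map coef_map mulrC mul_mpolyC.
rewrite -[LHS]scale1r -(mulVf n0) -scalerA h scaler_sumr; apply: eq_bigr => f _.
rewrite scalerA /generic_coef mevalZ; congr (_ * _ *: _).
by rewrite -(coef_map (meval (real_pt A B C))) -cl_minor_map gA_eval gB_eval gC_eval.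
Qed.

End GenericRealization.

Section ChainRealization.
Variables (S : comNzRingType) (n : nat) (u : 'I_n -> nat).
Hypothesis u0 : forall i, (0 < u i)%N.

(* One chain of length [u i] for each input-output pair i; its transfer function
   is diag (X^-(u i)). *)
Definition chain := {i : 'I_n & 'I_(u i)}.
HB.instance Definition _ := Finite.on chain.
Local Notation q := #|{: chain}|.

Lemma card_chain : q = (\sum_i u i)%N.
Proof.
rewrite card_tagged sumnE big_map big_enum /=; apply: eq_bigr => i _.
by rewrite card_ord.
Qed.

Definition cpos (x : 'I_q) : 'I_n := tag (enum_val x).
Definition clev (x : 'I_q) : nat := tagged (enum_val x).

Lemma clev_lt x : (clev x < u (cpos x))%N.
Proof. exact: ltn_ord. Qed.

Lemma cpos_clev_inj x y : cpos x = cpos y -> clev x = clev y -> x = y.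
Proof.
move=> hp hl; apply: enum_val_inj; move: hp hl; rewrite /cpos /clev.
case: (enum_val x) => i a; case: (enum_val y) => j b /= ij; subst j => /val_inj.
by move=> /= ->.
Qed.

Lemma cmk i a : (a < u i)%N -> exists x, cpos x = i /\ clev x = a.
Proof.
move=> h; exists (enum_rank (existT (fun i => 'I_(u i)) i (Ordinal h) : chain)).
by rewrite /cpos /clev enum_rankK.
Qed.

Definition chA : 'M[S]_q := \matrix_(x, y) ((cpos x == cpos y) && (clev y == (clev x).+1))%:R.
Definition chB : 'M[S]_(q, n) := \matrix_(x, j) ((cpos x == j) && ((clev x).+1 == u j))%:R.
Definition chC : 'M[S]_(n, q) := \matrix_(j, x) ((cpos x == j) && (clev x == 0))%:R.

(** Together with [chD] it gives the polynomial factorization (X - A)^-1 B = V D^-1, with C V =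
    1. *)
Definition chV : 'M[{poly S}]_(q, n) := \matrix_(x, j) ((cpos x == j)%:R * 'X ^+ clev x).
Definition chD : 'M[{poly S}]_n := diag_mx (\row_j 'X ^+ u j).

Lemma sum_at (T : nzRingType) (P : pred 'I_q) (G : 'I_q -> T) x :
  P x -> (forall y, P y -> y = x) -> \sum_y (P y)%:R * G y = G x.
Proof.
move=> Px uP; rewrite (bigD1 x) //= Px mul1r big1 ?addr0 // => y yx.
case Py: (P y); last by rewrite mul0r.
by rewrite (uP y Py) eqxx in yx.
Qed.

Lemma sum_none (T : nzRingType) (P : pred 'I_q) (G : 'I_q -> T) :
  (forall y, ~~ P y) -> \sum_y (P y)%:R * G y = 0.
Proof. by move=> h; rewrite big1 // => y _; rewrite (negPf (h y)) mul0r. Qed.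

Lemma chA_mul (T : nzRingType) (G : 'I_q -> T) x y :
  cpos y = cpos x -> clev y = (clev x).+1 ->
  \sum_z ((cpos x == cpos z) && (clev z == (clev x).+1))%:R * G z = G y.
Proof.
move=> hp hl; apply: sum_at; first by rewrite hp hl !eqxx.
move=> z /andP [/eqP hz /eqP lz]; apply: cpos_clev_inj; first by rewrite -hz hp.
by rewrite lz hl.
Qed.

Lemma chA_mul_last (T : nzRingType) (G : 'I_q -> T) x : (clev x).+1 = u (cpos x) ->
  \sum_z ((cpos x == cpos z) && (clev z == (clev x).+1))%:R * G z = 0.
Proof.
move=> hl; apply: sum_none => z; apply/negP => /andP [/eqP hz /eqP lz].
by have := clev_lt z; rewrite -hz lz hl ltnn.
Qed.

Lemma chain_next x : (clev x).+1 = u (cpos x) \/ exists y, cpos y = cpos x /\ clev y = (clev x).+1.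
Proof.
have := clev_lt x; rewrite leq_eqVlt => /orP [/eqP ->|/cmk [y hy]]; [by left|by right; exists y].
Qed.

Lemma chZV : char_poly_mx chA *m chV = map_mx polyC chB *m chD.
Proof.
apply/matrixP => x j; rewrite mulmxBl mul_scalar_mx mul_mx_diag !mxE.
under eq_bigr do rewrite !mxE rmorph_nat.
rewrite rmorph_nat.
have [hl|[y [hp hl]]] := chain_next x.
  rewrite chA_mul_last // subr0 mulrCA -exprS hl.
  by have [<-|ne] := eqVneq (cpos x) j; rewrite ?eqxx // !mul0r.
rewrite (chA_mul (fun z => (cpos z == j)%:R * 'X ^+ clev z) hp hl) hp hl exprS mulrCA subrr.
case: eqP => [e|_]; last by rewrite mul0r.
by have := clev_lt y; rewrite hp hl e => /ltn_eqF ->; rewrite mul0r.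
Qed.

Lemma chCV : map_mx polyC chC *m chV = 1%:M.
Proof.
apply/matrixP => i j; rewrite !mxE.
under eq_bigr do rewrite !mxE rmorph_nat.
have [x [hp hl]] := cmk (u0 i).
rewrite (@sum_at _ (fun z => (cpos z == i) && (clev z == 0)%N)
  (fun z => (cpos z == j)%:R * 'X ^+ clev z) x).
- by rewrite hp hl expr0 mulr1.
- by rewrite hp hl !eqxx.
by move=> z /andP [/eqP hz /eqP lz]; apply: cpos_clev_inj; rewrite ?hp ?hl.
Qed.

(** A nonzero off-diagonal entry of X - A raises the level by one, and a permutation preserves the
    sum of the levels, so only the identity contributes to the determinant. *)
Lemma char_poly_chA : char_poly chA = 'X ^+ q.
Proof.
rewrite /char_poly /determinant (bigD1 1%g) //= [X in _ + X]big1 ?addr0.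
  rewrite odd_perm1 mul1r; transitivity (\prod_(i < q) ('X : {poly S})).
    apply: eq_bigr => x _; rewrite perm1 !mxE eqxx mulr1n.
    by rewrite (ltn_eqF (ltnSn _)) andbF polyC0 subr0.
  by rewrite prodr_const card_ord.
move=> s s1; have [x hx] : exists x,
    (s x != x) && ~~ ((cpos x == cpos (s x)) && (clev (s x) == (clev x).+1)).
  apply/existsP; apply: contraR s1; rewrite negb_exists => /forallP h.
  have hle x : (clev x <= clev (s x))%N.
    have := h x; rewrite negb_and !negbK => /orP [/eqP ->//|/andP [_ /eqP ->]]; exact: leqnSn.
  have heq x : clev x = clev (s x).
    apply/eqP; rewrite eqn_leq hle /= leqNgt; apply/negP => lt.
    have : (\sum_y clev y < \sum_y clev (s y))%N.
      rewrite (bigD1 x) //= [X in (_ < X)%N](bigD1 x) //= -addSn leq_add //.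
      by apply: leq_sum.
    by rewrite [X in (X < _)%N](reindex_inj (@perm_inj _ s)) ltnn.
  apply/eqP/permP => x; rewrite perm1; have := h x; rewrite negb_and !negbK.
  by move=> /orP [/eqP|/andP [_]] //; rewrite -heq (ltn_eqF (ltnSn _)).
have [sx nx] := andP hx.
by rewrite (bigD1 x) //= !mxE eq_sym (negPf sx) (negPf nx) mulr0n polyC0 subr0 mul0r mulr0.
Qed.

(** Two factorizations of one block matrix give det(X - A - B F C) det(-D) = det(X - A) det(F - D),
    where det D = det(X - A) = X^q. *)
Lemma char_poly_chain (F : 'M[S]_n) :
  char_poly (chA + chB *m F *m chC) = \det (chD - map_mx polyC F).
Proof.
set b := map_mx polyC chB; set c := map_mx polyC chC; set f := map_mx polyC F.
set Z := char_poly_mx chA.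
have e1 : block_mx Z b (f *m c) 1%:M *m block_mx 1%:M chV 0 (- chD) =
    block_mx Z 0 (f *m c) (f - chD).
  rewrite mulmx_block !mulmx1 !mulmx0 !addr0 chZV mulmxN subrr -mulmxA chCV mulmx1.
  by rewrite mul1mx.
have e2 : block_mx Z b (f *m c) 1%:M *m block_mx 1%:M 0 (- (f *m c)) 1%:M =
    block_mx (Z - b *m f *m c) b 0 1%:M.
  rewrite mulmx_block !mulmx1 !mulmx0 !add0r mul1mx subrr mulmxN.
  by rewrite -!mulmxA.
have := congr1 determinant e2; rewrite det_mulmx det_lblock det_ublock !det1 !mulr1 => d2.
have := congr1 determinant e1; rewrite det_mulmx det_lblock det_ublock !det1 d2 mul1r.
have -> : Z - b *m f *m c = char_poly_mx (chA + chB *m F *m chC).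
  by rewrite /Z /char_poly_mx raddfD /= !map_mxM opprD addrA.
rewrite -/(char_poly _) -/(char_poly chA) char_poly_chA.
have -> : f - chD = (-1) *: (chD - f) by rewrite scaleN1r opprB.
have -> : - chD = (-1) *: chD by rewrite scaleN1r.
rewrite !detZ det_diag.
have -> : \prod_i (\row_j 'X ^+ u j) 0 i = 'X ^+ q :> {poly S}.
  by rewrite card_chain -prodrXr; apply: eq_bigr => i _; rewrite mxE.
rewrite mulrCA [RHS]mulrCA => /(congr1 ( *%R ((-1) ^+ n))).
rewrite !mulrA -!expr2 sqrr_sign !mul1r [RHS]mulrC => /polyP h.
(* Over an arbitrary ring the factor X^q is cancelled by shifting coefficients. *)
by apply/polyP => k; have := h (k + q)%N; rewrite !coefMXn ltnNge leq_addl addnK.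
Qed.

Lemma chain_powB k y j :
  (chA ^+ k *m chB) y j = ((cpos y == j) && (clev y + k.+1 == u j)%N)%:R.
Proof.
elim: k y => [|k ih] y; first by rewrite expr0 mul1mx mxE addn1.
rewrite exprS -[chA * _]/(chA *m _) -mulmxA mxE.
under eq_bigr do rewrite ih mxE.
have [hl|[z [hp hl]]] := chain_next y.
  rewrite chA_mul_last //; case: eqP => // <- /=.
  by have -> : (clev y + k.+2 == u (cpos y))%N = false by apply/eqP; lia.
rewrite (chA_mul (fun z => ((cpos z == j) && (clev z + k.+1 == u j)%N)%:R) hp hl) hp hl.
by rewrite addSnnS.
Qed.

Lemma chain_powC k y j :
  (chA^T ^+ k *m chC^T) y j = ((cpos y == j) && (clev y == k))%:R.
Proof.
elim: k y => [|k ih] y; first by rewrite expr0 mul1mx !mxE.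
rewrite exprS -[chA^T * _]/(chA^T *m _) -mulmxA mxE.
under eq_bigr do rewrite ih !mxE.
case: (posnP (clev y)) => [y0|y0].
  rewrite y0 andbF; apply: sum_none => z.
  by rewrite andbF.
have [|z [hp hl]] := @cmk (cpos y) (clev y).-1.
  by apply: leq_ltn_trans (leq_pred _) (clev_lt y).
rewrite (@sum_at _ (fun z => (cpos z == cpos y) && (clev y == (clev z).+1))
  (fun z => ((cpos z == j) && (clev z == k))%:R) z).
- by rewrite hp hl -eqSS prednK.
- by rewrite hp hl prednK // !eqxx.
move=> w /andP [/eqP hw /eqP lw]; apply: cpos_clev_inj; first by rewrite hw hp.
by rewrite hl lw.
Qed.

End ChainRealization.

Section ChainField.
Variables (K : fieldType) (n : nat) (u : 'I_n -> nat).
Hypothesis u0 : forall i, (0 < u i)%N.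
Local Notation A := (chA K u).
Local Notation B := (chB K u).
Local Notation C := (chC K u).
Local Notation q := #|{: chain u}|.

Lemma chain_clev_q (x : 'I_q) : (u (cpos x) <= q)%N.
Proof. by rewrite card_chain (bigD1 (cpos x)) //= leq_addr. Qed.

(** Each basis vector is itself a column of A^k B, with k its distance to the end of its chain, and
    a column of (A^T)^k C^T, with k its level. *)
Lemma chain_minimal : minimal_real A B C.
Proof.
apply/andP; split; apply/row_subP => x.
  have lt : (u (cpos x) - (clev x).+1 < q)%N.
    apply: leq_trans (chain_clev_q x); have := clev_lt x; lia.
  apply: (submx_trans _ (sumsmx_sup (Ordinal lt) _ (submx_refl _))) => //.
  rewrite genmxE; apply: (eq_row_sub (cpos x)); apply/rowP => y.
  rewrite 2![LHS]mxE 2![RHS]mxE chain_powB /=; congr ((nat_of_bool _)%:R); have lx := clev_lt x.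
  apply/idP/eqP => [/andP [/eqP hp /eqP hl]|<-].
    by apply: cpos_clev_inj => //; lia.
  by rewrite eqxx /=; apply/eqP; lia.
have lt : (clev x < q)%N by apply: leq_trans (clev_lt x) (chain_clev_q x).
apply: (submx_trans _ (sumsmx_sup (Ordinal lt) _ (submx_refl _))) => //.
rewrite genmxE; apply: (eq_row_sub (cpos x)); apply/rowP => y.
rewrite 2![LHS]mxE 2![RHS]mxE chain_powC /=; congr ((nat_of_bool _)%:R).
apply/idP/eqP => [/andP [/eqP hp /eqP hl]|<-]; last by rewrite !eqxx.
exact: cpos_clev_inj.
Qed.

Lemma chain_tf i j : (tf_num A B C) i j = (i == j)%:R * 'X ^+ (q - u j).
Proof.
have h : tf_num A B C *m chD K u = ('X ^+ q)%:M.
  rewrite /tf_num -mulmxA -chZV mulmxA -[X in X *m _]mulmxA mul_adj_mx.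
  rewrite -/(char_poly A) char_poly_chA mul_mx_scalar -scalemxAl chCV //.
  by rewrite scalemx1.
have uq : (u j <= q)%N by rewrite card_chain (bigD1 j) //= leq_addr.
move: (tf_num A B C) h => T h.
have := congr1 (fun M : 'M[{poly K}]_n => M i j) h; rewrite mul_mx_diag !mxE.
move=> /polyP e; apply/polyP => k; have {e} e := e (k + u j)%N.
rewrite coefMXn ltnNge leq_addl addnK /= in e; rewrite e.
by case: eqP => _; rewrite ?mulr1n ?mulr0n ?mul1r ?mul0r ?coef0 // !coefXn; congr (_ %:R); lia.
Qed.

Lemma chain_sym : sym_tf A B C.
Proof.
apply/matrixP => i j; rewrite mxE !chain_tf //.
by have [->|ij] := eqVneq i j; rewrite ?eqxx // !mul0r.
Qed.

Lemma poly_refl_Xn k : poly_refl ('X ^+ k : {poly K}) = (-1) ^+ k * 'X ^+ k.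
Proof. by rewrite /poly_refl comp_Xn_poly; apply: exprNn. Qed.

Lemma chain_ham : (forall i, ~~ odd (u i)) -> ham_tf A B C.
Proof.
move=> ev; have qe : ~~ odd q.
  rewrite card_chain; elim/big_ind: _ => // x y; rewrite oddD => /negPf -> /negPf ->.
  by [].
rewrite /ham_tf char_poly_chA; have := chain_tf; move: (tf_num A B C) => T ct.
apply/matrixP => i j; rewrite !mxE !ct poly_refl_Xn.
rewrite -signr_odd (negPf qe) mul1r.
have [->|ij] := eqVneq i j; last by rewrite !mul0r /poly_refl comp_poly0 mul0r.
rewrite !mul1r poly_refl_Xn -signr_odd oddB; last by rewrite card_chain (bigD1 j) //= leq_addr.
by rewrite (negPf qe) (negPf (ev j)) mul1r.
Qed.

Lemma chain_map (S : comNzRingType) (g : {rmorphism K -> S}) :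
  [/\ map_mx g A = chA S u, map_mx g B = chB S u & map_mx g C = chC S u].
Proof. by split; apply/matrixP => x y; rewrite !mxE rmorph_nat. Qed.

End ChainField.

(** * Evenness in the Hamiltonian case *)

Section Markov.
Variables (K : fieldType) (q n : nat).
Implicit Types (A : 'M[K]_q) (B : 'M[K]_(q, n)) (C : 'M[K]_(n, q)) (F : 'M[K]_n).

Lemma size_det_linear m (M : 'M[{poly K}]_m) :
  (forall i j, size (M i j) <= 2)%N -> (size (\det M) <= m.+1)%N.
Proof.
move=> h; apply: (leq_trans (size_sum _ _ _)); apply/bigmax_leqP => s _.
rewrite -signr_odd -polyC1 -polyCN -rmorphXn /= mul_polyC.
apply: (leq_trans (size_scale_leq _ _)); apply: (leq_trans (size_prod_leq _ _)).
rewrite leq_subLR card_ord; apply: (@leq_trans (\sum_(i < m) 2).+1).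
  by rewrite ltnS; apply: leq_sum => i _.
by rewrite sum_nat_const card_ord; lia.
Qed.

Lemma size_char_poly_mx A i j : (size (char_poly_mx A i j) <= 2)%N.
Proof.
rewrite !mxE; apply: (leq_trans (size_polyD _ _)); rewrite size_polyN geq_max.
by apply/andP; split; [case: eqP => _; rewrite ?mulr1n ?mulr0n ?size_polyX ?size_poly0|
  apply: (leq_trans (size_polyC_leq1 _))].
Qed.

Lemma size_adj_char A i j : (size (\adj (char_poly_mx A) i j) <= q)%N.
Proof.
rewrite mxE /cofactor -signr_odd -polyC1 -polyCN -rmorphXn /= mul_polyC.
apply: (leq_trans (size_scale_leq _ _)).
have q0 : (q.-1.+1 <= q)%N by case: (q) i => [[]|].
apply: leq_trans q0; apply: size_det_linear => r s; rewrite 2!mxE; exact: size_char_poly_mx.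
Qed.

(** Numerator of C (X - A)^-1 A^k B; passing from k to k + 1 peels off one Markov parameter. *)
Definition tf_shift A B C k := map_mx polyC C *m \adj (char_poly_mx A) *m map_mx polyC (A ^+ k *m B).

Lemma size_tf_shift A B C k i j : (size (tf_shift A B C k i j) <= q)%N.
Proof.
rewrite mxE; apply: (leq_trans (size_sum _ _ _)); apply/bigmax_leqP => y _.
rewrite [X in _ * X]mxE mulrC mul_polyC; apply: (leq_trans (size_scale_leq _ _)).
rewrite mxE; apply: (leq_trans (size_sum _ _ _)); apply/bigmax_leqP => z _.
by rewrite [X in X * _]mxE mul_polyC; apply: (leq_trans (size_scale_leq _ _)); apply: size_adj_char.
Qed.

Lemma tf_shiftS A B C k i j :
  tf_shift A B C k.+1 i j =
  'X * tf_shift A B C k i j - char_poly A * ((C *m (A ^+ k *m B)) i j)%:P.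
Proof.
set c := map_mx polyC C; set b := map_mx polyC (A ^+ k *m B); set Z := char_poly_mx A.
have e : tf_shift A B C k.+1 = 'X *: tf_shift A B C k - char_poly A *: (c *m b).
  rewrite /tf_shift exprS -[A * _]/(A *m _) -(mulmxA A) map_mxM /= -/c -/b -/Z.
  have -> : map_mx polyC A = 'X%:M - Z by rewrite /Z /char_poly_mx opprB addrC subrK.
  rewrite mulmxBl mulmxBr mul_scalar_mx -scalemxAr; congr (_ - _).
  by rewrite !mulmxA -[X in X *m _]mulmxA mul_adj_mx mul_mx_scalar -scalemxAl.
by rewrite e /c /b -map_mxM !mxE.
Qed.

(** A comparison of degrees: all numerators have degree below q, so a nonzero difference of Markov
    parameters would give a polynomial of degree 2q equal to one of smaller degree. *)
Lemma markov_eq A B C A' B' C' :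
  (forall i j, char_poly A' * tf_num A B C i j = char_poly A * tf_num A' B' C' i j) ->
  forall k, C *m (A ^+ k *m B) = C' *m (A' ^+ k *m B').
Proof.
move=> h.
have alg (a a' t t' x y y' : {poly K}) : a' * t = a * t' ->
    a * a' * (y - y') = a * (x * t' - a' * y') - a' * (x * t - a * y).
  by move=> e; ring: e.
have step k :
    (forall i j, char_poly A' * tf_shift A B C k i j = char_poly A * tf_shift A' B' C' k i j) ->
    C *m (A ^+ k *m B) = C' *m (A' ^+ k *m B').
  move=> hk; apply/matrixP => i j; apply/eqP; rewrite -subr_eq0; apply/negPn/negP.
  set m := (X in X - _); set m' := (X in _ - X) => ne.
  have e : char_poly A * char_poly A' * (m - m')%:P =
      char_poly A * tf_shift A' B' C' k.+1 i j - char_poly A' * tf_shift A B C k.+1 i j.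
    by rewrite (tf_shiftS A B) (tf_shiftS A' B') polyCB; exact: alg (hk i j).
  have m0 : (m - m')%:P != 0 :> {poly K} by rewrite polyC_eq0.
  have mA := char_poly_monic A; have mA' := char_poly_monic A'.
  have : size (char_poly A * char_poly A' * (m - m')%:P) = (q + q).+1.
    rewrite mulrC mul_polyC size_scale // size_monicM ?monic_neq0 //.
    by rewrite !size_char_poly addSn addnS.
  rewrite e; apply/eqP; rewrite neq_ltn ltnS; apply/orP; left.
  have bd (X Y : {poly K}) : size X = q.+1 -> (size Y <= q)%N -> (size (X * Y)%R <= q + q)%N.
    by move=> sX sY; apply: (leq_trans (size_polyMleq _ _)); rewrite sX addSn /= leq_add2l.
  apply: (leq_trans (size_polyD _ _)); rewrite size_polyN geq_max.
  by rewrite !bd ?size_char_poly ?size_tf_shift.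
suff hk k : forall i j, char_poly A' * tf_shift A B C k i j = char_poly A * tf_shift A' B' C' k i j.
  by move=> k; apply: step; apply: hk.
elim: k => [|k ih] i j; first by have := h i j; rewrite /tf_shift /tf_num !expr0 !mul1mx.
rewrite (tf_shiftS A B) (tf_shiftS A' B') (step _ ih).
apply/eqP; rewrite eq_sym -subr_eq0 -(alg _ _ _ _ _ _ _ (ih i j)) subrr mulr0.
by [].
Qed.

(* Kalman's uniqueness of minimal realizations. *)
Lemma minimal_real_similar A B C A' B' C' : minimal_real A B C ->
  (forall k, C *m (A ^+ k *m B) = C' *m (A' ^+ k *m B')) ->
  exists T, [/\ T \in unitmx, T *m A = A' *m T, T *m B = B' & C' *m T = C].
Proof.
move=> /andP [/sub_sumsmxP [U hU] /sub_sumsmxP [W hW]] h.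
have {}hU : exists U' : 'I_q -> 'M[K]_(n, q), \sum_(k < q) A ^+ k *m B *m U' k = 1%:M.
  have g k : exists D, <<(A ^+ k *m B)^T>>%MS = D *m (A ^+ k *m B)^T.
    by apply/submxP; rewrite genmxE.
  have [D hD] := fin_all_exists (fun k : 'I_q => g k).
  exists (fun k => (U k *m D k)^T); apply: trmx_inj; rewrite trmx1 hU raddf_sum /=.
  by apply: eq_bigr => k _; rewrite trmx_mul trmxK hD mulmxA.
have {}hW : exists W' : 'I_q -> 'M[K]_(q, n), \sum_(k < q) W' k *m (C *m A ^+ k) = 1%:M.
  have g k : exists D, <<(A^T ^+ k *m C^T)^T>>%MS = D *m (C *m A ^+ k).
    have -> : C *m A ^+ k = (A^T ^+ k *m C^T)^T.
      rewrite trmx_mul trmxK; congr (_ *m _).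
      by elim: k => [|k ih]; rewrite ?trmx1 // exprSr exprS [RHS]trmx_mul trmxK -ih.
    by apply/submxP; rewrite genmxE.
  have [D hD] := fin_all_exists (fun k : 'I_q => g k).
  by exists (fun k => W k *m D k); rewrite hW; apply: eq_bigr => k _; rewrite hD -mulmxA.
case: hU => U' hU; case: hW => W' hW.
(* The only possible T, since T A^k B has to be A'^k B'. Its inverse [L] is built likewise from
   observability. *)
pose T := \sum_(k < q) A' ^+ k *m B' *m U' k.
have hCT k j : C *m (A ^+ (k + j) *m B) = C' *m A' ^+ j *m (A' ^+ k *m B').
  by rewrite h addnC exprD -[_ ^+ _ * _]/(_ *m _) !mulmxA.
pose L := \sum_(j < q) W' j *m (C' *m A' ^+ j).
have pw (M : 'M[K]_q) k j : M ^+ (k + j) = M ^+ k *m M ^+ j by rewrite exprD.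
have CT j : C' *m A' ^+ j *m T = C *m A ^+ j.
  rewrite -[RHS]mulmx1 -hU /T !mulmx_sumr; apply: eq_bigr => k _.
  by rewrite !mulmxA -(mulmxA _ (A' ^+ k)) -hCT addnC pw !mulmxA.
have LT : L *m T = 1%:M.
  rewrite /L mulmx_suml -hW; apply: eq_bigr => j _.
  by rewrite -mulmxA CT.
have TL : T *m L = 1%:M by exact: mulmx1C.
have LB k : L *m (A' ^+ k *m B') = A ^+ k *m B.
  rewrite -[RHS]mul1mx -hW /L !mulmx_suml; apply: eq_bigr => j _.
  by rewrite -!mulmxA [A ^+ j *m _]mulmxA -pw addnC hCT !mulmxA.
have uT : T \in unitmx by case/mulmx1_unit: TL.
have TAB k : T *m (A ^+ k *m B) = A' ^+ k *m B' by rewrite -LB mulmxA TL mul1mx.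
exists T; split => //.
- rewrite -[LHS]mulmx1 -hU [in RHS]/T !mulmx_sumr; apply: eq_bigr => k _.
  have := TAB k.+1; rewrite !exprS -[A * _]/(A *m _) -[A' * _]/(A' *m _) => e.
  transitivity (T *m (A *m A ^+ k *m B) *m U' k); first by rewrite !mulmxA.
  by rewrite e !mulmxA.
- by have := TAB 0%N; rewrite !expr0 !mul1mx.
by have := CT 0%N; rewrite !expr0 !mulmx1.
Qed.

End Markov.

Section HamiltonianEven.
Variables (K : fieldType) (q n : nat).
Implicit Types (A : 'M[K]_q) (B : 'M[K]_(q, n)) (C : 'M[K]_(n, q)) (F : 'M[K]_n).

Lemma map_poly_refl_char_mx A :
  map_mx (@poly_refl K) (char_poly_mx A) = -1 *: (char_poly_mx (- A^T))^T.
Proof.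
rewrite scaleN1r.
apply/matrixP => i j; rewrite !mxE /poly_refl.
rewrite raddfB /= comp_polyC raddfMn /= comp_polyX polyCN opprK opprD mulNrn.
by rewrite eq_sym.
Qed.

Lemma poly_refl_char A : poly_refl (char_poly A) = (-1) ^+ q * char_poly (- A^T).
Proof.
rewrite /char_poly -[poly_refl _]/(comp_poly (- 'X) _) -det_map_mx /=.
by rewrite -[map_mx _ _]/(map_mx (@poly_refl K) _) map_poly_refl_char_mx detZ det_tr.
Qed.

(** The dual triple (-A^T, C^T, -B^T) realizes G(-s)^t. *)
Lemma tf_num_dual A B C i j :
  tf_num (- A^T) C^T (- B^T) i j = (-1) ^+ q * poly_refl (tf_num A B C j i).
Proof.
have refl_map m p r (M : 'M[{poly K}]_(m, p)) (M' : 'M_(p, r)) :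
    map_mx (@poly_refl K) (M *m M') = map_mx (@poly_refl K) M *m map_mx (@poly_refl K) M'.
  exact: (map_mxM (comp_poly (- 'X))).
have reflC m p (M : 'M[K]_(m, p)) : map_mx (@poly_refl K) (map_mx polyC M) = map_mx polyC M.
  by apply/matrixP => x y; rewrite !mxE /poly_refl comp_polyC.
suff e : tf_num (- A^T) C^T (- B^T) = (-1) ^+ q *: (map_mx (@poly_refl K) (tf_num A B C))^T.
  by rewrite e !mxE.
(* For q = 0 the sign exponent below, with its truncated q - 1, would have the wrong parity; both
   sides are then zero. *)
case: (posnP q) => [q0|q0].
  have z m p (M : 'M[{poly K}]_(m, q)) (M' : 'M_(q, p)) : M *m M' = 0.
    by apply/matrixP => x y; rewrite !mxE big1 // => k; have := ltn_ord k; rewrite {2}q0.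
  rewrite /tf_num -[LHS]mulmxA (z _ _ (map_mx polyC (- B^T))) -[X in map_mx _ X]mulmxA z.
  by apply/matrixP => x y; rewrite !mxE /poly_refl comp_poly0 mulr0.
rewrite /tf_num !refl_map !reflC.
have -> : map_mx (@poly_refl K) (\adj (char_poly_mx A)) = \adj (map_mx (@poly_refl K) (char_poly_mx A)).
  by apply: (map_mx_adj (comp_poly (- 'X))).
rewrite map_poly_refl_char_mx adjZ -trmx_adj -scalemxAr -scalemxAl.
rewrite [in RHS]linearZ /= scalerA -exprD addnC -subn1.
have -> : (q - 1 + q = (q - 1).*2.+1)%N by lia.
rewrite !trmx_mul trmxK -!map_trmx -signr_odd /= odd_double expr1 scaleN1r.
have -> : map_mx polyC (- B^T) = - (map_mx polyC B)^T.
  by apply/matrixP => x y; rewrite !mxE polyCN.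
by rewrite 2!mulNmx mulmxA.
Qed.

(** The triple and its dual realize the same function, so some invertible T satisfies T A = -A^T T,
    T B = C^T and -B^T T = C. For symmetric F it conjugates A + B F C into its negative
    transpose. *)
Lemma ham_char_poly_refl A B C F : minimal_real A B C -> ham_tf A B C -> F^T = F ->
  poly_refl (char_poly (A + B *m F *m C)) = (-1) ^+ q * char_poly (A + B *m F *m C).
Proof.
move=> hm hh hF.
have [|T [uT TA TB CT]] := @minimal_real_similar _ _ _ A B C (- A^T) C^T (- B^T) hm.
  apply: markov_eq => i j; rewrite tf_num_dual.
  have := congr1 (fun M : 'M[{poly K}]_n => M i j) hh.
  rewrite [LHS]mxE [RHS]mxE [X in poly_refl X * _]mxE poly_refl_char.
  move: (char_poly A) (char_poly _) (tf_num A B C i j) (poly_refl _) => a a' t t' e.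
  have s1 : (-1) ^+ q * (-1) ^+ q = 1 :> {poly K} by rewrite -expr2 sqrr_sign.
  apply: (@mulfI _ ((-1) ^+ q)); first by rewrite signr_eq0.
  rewrite mulrA mulrC e (mulrCA a) [RHS]mulrA.
  by rewrite s1 mul1r mulrC.
set Y := A + _; rewrite poly_refl_char; congr (_ * _).
have TY : T *m Y = - Y^T *m T.
  rewrite /Y mulmxDr TA !mulmxA TB -[X in C^T *m _ *m X]CT linearD /= !trmx_mul hF.
  by rewrite opprD mulmxDl !mulmxA mulmxN mulNmx.
have e : map_mx polyC T *m char_poly_mx Y = char_poly_mx (- Y^T) *m map_mx polyC T.
  rewrite /char_poly_mx mulmxBr mulmxBl -!map_mxM /= TY.
  by rewrite scalar_mxC.
have := congr1 determinant e; rewrite !det_mulmx mulrC.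
move=> ed; apply/esym; apply: mulIf ed; rewrite det_map_mx polyC_eq0 -unitfE.
by rewrite -unitmxE.
Qed.

End HamiltonianEven.

(** * Generic fibers *)

Section DiagonalExpansion.
Variables (S : comNzRingType) (n : nat) (u : 'I_n -> nat).

(** Each column contributes either its diagonal term X^(u j) or its part in -F; the set X records
    the choice. *)
Lemma det_diag_sub (F : 'M[S]_n) :
  \det (chD S u - map_mx polyC F) =
  \sum_(X : {set 'I_n}) ((-1) ^+ #|X| * plucker F (sel_set X))%:P * 'X ^+ (\sum_(i in ~: X) u i)%N.
Proof.
rewrite -det_tr /determinant.
pose G (s : 'S_n) (X : {set 'I_n}) : {poly S} :=
  \prod_j (if j \in X then - (F (s j) j)%:P else (s j == j)%:R * 'X ^+ u j).
transitivity (\sum_(s : 'S_n) (-1) ^+ s * \sum_X G s X).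
  apply: eq_bigr => s _; congr (_ * _); rewrite -bigA_distr; apply: eq_bigr => j _.
  rewrite !mxE addrC; congr (_ + _).
  by case: eqP => [->|_]; rewrite ?mulr1n ?mul1r ?mulr0n ?mul0r.
under eq_bigr do rewrite mulr_sumr; rewrite exchange_big; apply: eq_bigr => X _.
rewrite /plucker -[\det (colsub _ _)]det_tr /determinant rmorphM rmorphXn rmorphN1 rmorph_sum /=.
rewrite mulr_sumr mulr_suml; apply: eq_bigr => s _.
rewrite rmorphM rmorphXn rmorphN1 rmorph_prod /= mulrCA -!mulrA; congr (_ * _).
have -> : (\sum_(i in ~: X) u i = \sum_j (if j \in X then 0 else u j))%N.
  by rewrite [LHS]big_mkcond; apply: eq_bigr => i _; rewrite inE; case: (i \in X).
have -> : (-1) ^+ #|X| = \prod_j (if j \in X then -1 else 1) :> {poly S}.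
  by rewrite -big_mkcond prodr_const.
rewrite -prodrXr -!big_split /=; apply: eq_bigr => j _.
rewrite [_^T _ _]mxE [colsub _ _ _ _]mxE ffunE; case: ifP => jX.
  by rewrite graph_mx_r expr0 mulr1 mulN1r.
by rewrite graph_mx_l mul1r rmorph_nat.
Qed.

End DiagonalExpansion.

Section BaseRealization.
Variables (K : fieldType) (n : nat).
Local Notation p := (plucker (symX n K)).

Lemma base_closed_loop (m : nat) (u : 'I_n -> nat) k : (0 < m)%N -> (forall i, u i = (m * i.+1)%N) ->
  (char_poly (chA _ u + chB _ u *m symX n K *m chC _ u))`_(m * k) = base_coef p k.
Proof.
move=> m0 hu; rewrite char_poly_chain ?det_diag_sub; last by move=> i; rewrite hu muln_gt0 m0.
rewrite coef_sum /base_coef [RHS]big_mkcond /=; apply: eq_bigr => X _.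
have -> : (\sum_(i in ~: X) u i = m * setwt X)%N.
  by rewrite /setwt big_distrr; apply: eq_bigr => i _.
rewrite coefCM coefXn eqn_mul2l eqn0Ngt m0 /= eq_sym.
by case: eqP; rewrite ?mulr1 ?mulr0.
Qed.

Lemma symX_certificate : exists B, certificate p B (fun k : 'I_('C(n.+1, 2)) => base_coef p k).
Proof.
have hn := nil_plucker (fun A a a' => plucker_lagrange A a a' (symX_sym n K))
  (plucker_exchange (symX n K)) (@plucker_noninj _ _ (symX n K)) (plucker_perm (symX n K)).
have [B hB] := nilpotent_admissible hn.
(* The coefficient of index d is 1, so its multiplier becomes the lower-order term. *)
exists B => x /hB [y [hy ->]]; exists (y ord_max), (fun k => y (widen_ord (leqnSn _) k)).
split=> //; rewrite big_ord_recr /= (base_coef_lead (plucker_id _)) mul1r addrC.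
by congr (_ + _).
Qed.

Lemma symX_filtration : filtration (prodspan p).
Proof.
apply: (prodspan_filtration (plucker_id (symX n K))) => t; exists 1%N.
have -> : 'X_t = p (upd (sel_id n) (upos t).1 (rshift n (upos t).2)).
  by rewrite plucker_entry mxE vidx_upos.
exact: prodspan1.
Qed.

End BaseRealization.

Section GenericFiber.
Variables (K : closedFieldType) (n q : nat) (kap : 'I_('C(n.+1, 2)) -> nat).
Local Notation d := ('C(n.+1, 2)).
Local Notation R := {mpoly K[d]}.
Local Notation p := (plucker (symX n K)).

Definition sym_loop (A : 'M[K]_q) (B : 'M[K]_(q, n)) (C : 'M[K]_(n, q)) : {poly R} :=
  char_poly (map_mx (@mpolyC d K) A + map_mx (@mpolyC d K) B *m symX n K *m map_mx (@mpolyC d K) C).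

(** Comparison with the base fiber in both directions, in the same filtration and with all degrees
    equal to 1. *)
Lemma fiber_codim c phi : (exists B, certificate p B c) -> (forall k, prodspan p 1 (c k)) ->
  codim (idealOf predT (fun k : 'I_d => c k - (phi k)%:MP)) (dLG n).
Proof.
move=> [B hB] hc; have hF := symX_filtration K n.
have adm : admissible (prodspan p) (fun=> 1%N) c by exact: prodspan_admissible hc hB.
have [B0 hB0] := symX_certificate K n.
have adm0 : admissible (prodspan p) (fun=> 1%N) (fun k : 'I_d => base_coef p k).
  by apply: prodspan_admissible hB0 => k; exact: prodspan_base.
have adm1 := admissible_shift phi hF adm.
have basis c' phi' : admissible (prodspan p) (fun=> 1%N) c' ->
    exists r, codim (idealOf predT (fun k : 'I_d => c' k - (phi' k)%:MP)) r.
  move=> ha; have [r [v hv]] := fiber_spanned phi' hF ha.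
  have iJ := idealOf_ideal predT (fun k : 'I_d => c' k - (phi' k)%:MP).
  have [||r' [b [_ ib sb]]] := @exists_basis_of _ _ _ (fun _ => True) _ v (ideal_subsp iJ).
  - by split.
  - by move=> x _; exact: hv.
  by exists r', b; split => // x; apply: sb.
have [r [b [ib sb]]] := basis _ phi adm.
have [r0] := basis _ (fun=> 0) adm0.
have -> : idealOf predT (fun k : 'I_d => base_coef p k - (0 : K)%:MP) =
    idealOf predT (fun k : 'I_d => base_coef p k).
  by congr (idl _); apply: eq_map => k; rewrite mpolyC0 subr0.
move=> [b0 [ib0 sb0]]; have r0E := base_fiber_degree ib0 sb0.
suff -> : dLG n = r by exists b.
apply/eqP; rewrite -r0E eqn_leq (fiber_degree_le hF adm0 adm1 ib0 sb).
exact: (fiber_degree_le hF adm1 adm0 ib sb0).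
Qed.

Lemma generic_fiber_codim (A0 : 'M[K]_q) B0 C0 : n`!%:R != 0 :> K ->
  (forall k, (sym_loop A0 B0 C0)`_(kap k) = base_coef p k) ->
  exists P : {mpoly K[q * q + q * n + n * q]},
    P.@[real_pt A0 B0 C0] != 0 /\ forall A B C, P.@[real_pt A B C] != 0 -> forall phi : 'I_d -> K,
      codim (idealOf predT (fun k => (sym_loop A B C)`_(kap k) - (phi k)%:MP)) (dLG n).
Proof.
move=> n0 base; pose gam (k : 'I_d) := @generic_coef K q n (kap k).
have gamE A B C k : coefs_at p gam (real_pt A B C) k = (sym_loop A B C)`_(kap k).
  by apply/esym; apply: (closed_loop_coef A B C (symX n K) (kap k) n0).
have [B hB] := symX_certificate K n.
have hB0 : certificate p B (coefs_at p gam (real_pt A0 B0 C0)).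
  move=> x /hB [x0 [y [hx hy ->]]]; exists x0, y; split => //.
  by congr (_ + _); apply: eq_bigr => k _; rewrite gamE base.
have [P [P0 hP]] := open_certificate (plucker_id (symX n K)) hB0.
exists P; split=> // A B' C /hP hc phi.
suff : codim (idealOf predT (fun k => coefs_at p gam (real_pt A B' C) k - (phi k)%:MP)) (dLG n).
  have -> // : idealOf predT (fun k => coefs_at p gam (real_pt A B' C) k - (phi k)%:MP) =
    idealOf predT (fun k => (sym_loop A B' C)`_(kap k) - (phi k)%:MP).
  by congr (idl _); apply: eq_map => k; rewrite gamE.
apply: fiber_codim; first by exists B.
move=> k; apply: prodspan_sum => f _; apply: subspZ; first exact: prodspan_subsp.
exact: prodspan1.
Qed.

End GenericFiber.

(** * Transfer to the matrix coordinates of the statement *)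

Section IdealMembership.
Variables (K : fieldType) (N : nat).
Local Notation S := {mpoly K[N]}.
Implicit Types (gs : seq S) (J : S -> Prop).

Lemma in_ideal_ideal gs : ideal (in_ideal gs).
Proof.
split.
- by exists (nseq (size gs) 0); rewrite size_nseq big1 // => i _; rewrite nth_nseq if_same mul0r.
- move=> x y [q [_ ->]] [r [_ ->]]; exists (mkseq (fun i => q`_i + r`_i) (size gs)).
  rewrite size_mkseq -big_split; split=> //; apply: eq_bigr => i _.
  by rewrite nth_mkseq // mulrDl.
move=> a x [q [_ ->]]; exists (mkseq (fun i => a * q`_i) (size gs)).
rewrite size_mkseq mulr_sumr; split=> //; apply: eq_bigr => i _.
by rewrite nth_mkseq // mulrA.
Qed.

Lemma in_ideal_mem gs g : g \in gs -> in_ideal gs g.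
Proof.
move=> /(nthP 0) [i hi <-]; exists (mkseq (fun j => (j == i)%:R) (size gs)).
rewrite size_mkseq (bigD1 (Ordinal hi)) //= nth_mkseq // eqxx mul1r big1 ?addr0 //.
by move=> j ji; rewrite nth_mkseq // (negPf (_ : val j != i)) ?mul0r.
Qed.

Lemma in_ideal_least gs J x : ideal J -> (forall g, g \in gs -> J g) -> in_ideal gs x -> J x.
Proof.
move=> iJ hJ [q [_ ->]]; apply: ideal_sum => [|i _]; first exact: iJ.
by apply: idealMl => //; apply: hJ; rewrite mem_nth.
Qed.

Lemma ideal_rmorph_id J (f : {rmorphism S -> S}) : ideal J ->
  (forall c, f c%:MP = c%:MP) -> (forall k, J ('X_k - f 'X_k)) -> forall x, J (x - f x).
Proof.
move=> iJ hC hX; elim/mpoly_ring_ind => [c|k|x y hx hy|x y hx hy].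
- by rewrite hC subrr; apply: ideal0.
- exact: hX.
- by rewrite rmorphD opprD addrACA; apply: idealD.
have -> : x * y - f (x * y) = y * (x - f x) + f x * (y - f y).
  by rewrite rmorphM mulrBr mulrBr addrA [y * x]mulrC [y * f x]mulrC subrK.
by apply: idealD => //; apply: idealMl.
Qed.

End IdealMembership.

Section SymmetricCoordinates.
Variables (K : closedFieldType) (n : nat).
Local Notation d := ('C(n.+1, 2)).
Local Notation S := {mpoly K[n * n]}.
Local Notation R := {mpoly K[d]}.

(** Multiplicities are defined in n * n variables with the equations X_ij = X_ji. [to_sym] and
    [of_sym] identify the quotient by these with the ring in which there are as many variables as
    coefficient equations. *)
Definition to_sym : S -> R := mmap (@mpolyC d K) (fun k => mxvec (symX n K) 0 k).
HB.instance Definition _ := GRing.RMorphism.on to_sym.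

Definition of_sym : R -> S :=
  mmap (@mpolyC (n * n) K) (fun t => 'X_(mxvec_index (upos t).1 (upos t).2)).
HB.instance Definition _ := GRing.RMorphism.on of_sym.

Lemma to_symC c : to_sym c%:MP = c%:MP. Proof. by rewrite /to_sym mmapC. Qed.
Lemma of_symC c : of_sym c%:MP = c%:MP. Proof. by rewrite /of_sym mmapC. Qed.
Lemma to_symX i j : to_sym 'X_(mxvec_index i j) = 'X_(vidx i j).
Proof. by rewrite /to_sym mmapX mmap1U mxvecE mxE. Qed.
Lemma of_symX t : of_sym 'X_t = 'X_(mxvec_index (upos t).1 (upos t).2).
Proof. by rewrite /of_sym mmapX mmap1U. Qed.

Lemma of_symK : cancel of_sym to_sym.
Proof.
apply: (@mpoly_rmorph_ext _ _ _ (to_sym \o of_sym : {rmorphism _ -> _}) idfun) => [c|t] /=.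
  by rewrite of_symC to_symC.
by rewrite of_symX to_symX vidx_upos.
Qed.

Lemma to_symK (J : S -> Prop) x : ideal J -> (forall g, g \in sym_eqs K n -> J g) ->
  J (x - of_sym (to_sym x)).
Proof.
move=> iJ hJ; apply: (@ideal_rmorph_id _ _ J (of_sym \o to_sym : {rmorphism _ -> _})) => // [c|k] /=.
  by rewrite to_symC of_symC.
case/mxvec_indexP: k => i j; rewrite to_symX of_symX upos_vidx.
case: ifP => _ /=; first by rewrite subrr; apply: ideal0.
by apply: hJ; apply/mapP; exists (i, j); rewrite ?mem_enum.
Qed.

Lemma sym_eqs_to_sym g : g \in sym_eqs K n -> to_sym g = 0.
Proof.
move=> /mapP [[i j] _ ->] /=; rewrite raddfB /=.
by rewrite !to_symX vidxC subrr.
Qed.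

Lemma codim_to_sym gs (J : R -> Prop) D : ideal J ->
  (forall g, g \in gs -> J (to_sym g)) ->
  (forall c, J c -> in_ideal (sym_eqs K n ++ gs) (of_sym c)) ->
  codim J D -> codim (in_ideal (sym_eqs K n ++ gs)) D.
Proof.
move=> iJ hg hJ [b [ib sb]]; set I := in_ideal _; have iI : ideal I by exact: in_ideal_ideal.
have IJ x : I x -> J (to_sym x).
  apply: (in_ideal_least (J := fun x => J (to_sym x))).
    split; first by rewrite raddf0; apply: ideal0.
      by move=> y z hy hz; rewrite raddfD; apply: idealD.
    by move=> a y hy; rewrite rmorphM; apply: idealMl.
  move=> g; rewrite mem_cat => /orP [/sym_eqs_to_sym ->|]; first exact: ideal0.
  exact: hg.
have ofZ a x : of_sym (a *: x) = a *: of_sym x by rewrite /of_sym mmapZ mul_mpolyC.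
have toZ a x : to_sym (a *: x) = a *: to_sym x by rewrite /to_sym mmapZ mul_mpolyC.
exists (fun i => of_sym (b i)); split.
  move=> l /IJ; rewrite raddf_sum /= => h; apply: ib.
  suff <- : \sum_i to_sym (l i *: of_sym (b i)) = \sum_i l i *: b i by [].
  by apply: eq_bigr => i _; rewrite toZ of_symK.
move=> x; have [l hl] := sb (to_sym x); exists l.
have hK : I (x - of_sym (to_sym x)).
  by apply: to_symK => // g hgs; apply: in_ideal_mem; rewrite mem_cat hgs.
move: (to_sym x) hK hl => y hK /hJ; rewrite raddfB /= => h.
have := idealD iI hK h; rewrite addrA subrK.
have -> // : of_sym (\sum_i l i *: b i) = \sum_i l i *: of_sym (b i).
by rewrite [LHS](raddf_sum of_sym); apply: eq_bigr => i _; apply: ofZ.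
Qed.

Lemma clpoly_to_sym q (A : 'M[K]_q) B C k : to_sym (clpoly A B C)`_k = (sym_loop A B C)`_k.
Proof.
have toC m m' (M : 'M[K]_(m, m')) : map_mx to_sym (map_mx (fun a => a%:MP) M) = map_mx (@mpolyC d K) M.
  by apply/matrixP => i j; rewrite !mxE to_symC.
have toX : map_mx to_sym (Xmx K n) = symX n K.
  by apply/matrixP => i j; rewrite !mxE to_symX.
by rewrite -[LHS](coef_map to_sym) /clpoly map_char_poly map_mxD !map_mxM /= !toC toX.
Qed.

Lemma clpoly_eval q (A : 'M[K]_q) B C (F : 'M[K]_n) k :
  ((clpoly A B C)`_k).@[mx_pt F] = (char_poly (A + B *m F *m C))`_k.
Proof.
have evC m m' (M : 'M[K]_(m, m')) : map_mx (meval (mx_pt F)) (map_mx (fun a => a%:MP) M) = M.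
  by apply/matrixP => i j; rewrite !mxE mevalC.
have evX : map_mx (meval (mx_pt F)) (Xmx K n) = F.
  by apply/matrixP => i j; rewrite !mxE mevalXU /mx_pt mxvecE.
by rewrite -[LHS](coef_map (meval (mx_pt F))) /clpoly map_char_poly map_mxD !map_mxM /= !evC evX.
Qed.

Lemma count_codim (P : 'M[K]_n -> Prop) gs D : codim (in_ideal gs) D ->
  (forall F, P F <-> forall g, g \in gs -> g.@[mx_pt F] = 0) -> count_with_mult P gs D.
Proof.
move=> hD hP; have [s [us hs [mu [hmu sm]]]] := local_decomposition (in_ideal_ideal gs) hD.
have van v : vanish (in_ideal gs) v <-> forall g, g \in gs -> g.@[v] = 0.
  split=> [h g hg|h p]; first by apply: h; apply: in_ideal_mem.
  apply: (in_ideal_least (J := fun x => x.@[v] = 0)) => //; split; first by rewrite meval0.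
    by move=> x y hx hy; rewrite mevalD hx hy addr0.
  by move=> a x hx; rewrite mevalM hx mulr0.
exists (map vec_mx s); split; first by rewrite map_inj_uniq //; apply: can_inj vec_mxK.
have mem F : F \in map vec_mx s <-> mxvec F \in s.
  by rewrite -{1}[F]mxvecK mem_map //; apply: can_inj vec_mxK.
split; first by move=> F; rewrite mem hs van hP.
exists (fun F => mu (mxvec F)); split; first by move=> F /mem; apply: hmu.
by rewrite big_map; under eq_bigr do rewrite vec_mxK.
Qed.

End SymmetricCoordinates.

Lemma coef_poly_refl (K : fieldType) (p : {poly K}) k : (poly_refl p)`_k = (-1) ^+ k * p`_k.
Proof.
rewrite /poly_refl comp_polyE; have -> : \sum_(i < size p) p`_i *: (- 'X) ^+ i =
    \poly_(i < size p) ((-1) ^+ i * p`_i).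
  by rewrite poly_def; apply: eq_bigr => i _; rewrite -scaleN1r exprZn scalerA mulrC.
by rewrite coef_poly; case: ltnP => // h; rewrite (nth_default _ h) mulr0.
Qed.

Lemma even_poly_odd_coef (K : fieldType) (p : {poly K}) k :
  (2%:R : K) != 0 -> poly_refl p = p -> odd k -> p`_k = 0.
Proof.
move=> two hp ok; have := coef_poly_refl p k; rewrite hp -signr_odd ok expr1 mulN1r.
move=> /eqP; rewrite -addr_eq0 -mulr2n -mulr_natl mulf_eq0 (negPf two) => /eqP.
by [].
Qed.

Lemma char_poly_eq_coefs (K : fieldType) q (M : 'M[K]_q) (phi : {poly K}) :
  phi \is monic -> size phi = q.+1 ->
  (forall k, (k < q)%N -> (char_poly M)`_k = phi`_k) -> char_poly M = phi.
Proof.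
move=> mphi sphi h; apply/polyP => k; case: (ltngtP k q) => [|kq|->]; first exact: h.
  by rewrite !nth_default ?sphi ?size_char_poly.
have := monicP mphi; have := monicP (char_poly_monic M).
by rewrite !lead_coefE sphi size_char_poly /= => -> ->.
Qed.

Section LoopFibers.
Variables (K : closedFieldType) (n q : nat) (kap : nat -> nat).
Local Notation d := ('C(n.+1, 2)).

(** Serves both cases: [kap] is the identity in the symmetric one and doubling in the Hamiltonian
    one. *)
Definition loop_eqs (A : 'M[K]_q) (B : 'M[K]_(q, n)) (C : 'M[K]_(n, q)) (phi : {poly K}) :=
  sym_eqs K n ++ [seq (clpoly A B C)`_(kap k) - (phi`_(kap k))%:MP | k <- iota 0 d].

Lemma loop_eqs_vanish A B C phi F :
  (forall g, g \in loop_eqs A B C phi -> g.@[mx_pt F] = 0) <->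
  F^T = F /\ forall k, (k < d)%N -> (char_poly (A + B *m F *m C))`_(kap k) = phi`_(kap k).
Proof.
split=> [h|[hF hk] g].
  split.
    apply/matrixP => i j; rewrite mxE; apply/esym/eqP; rewrite -subr_eq0; apply/eqP.
    have <- : ('X_(mxvec_index i j) - 'X_(mxvec_index j i)).@[mx_pt F] = F i j - F j i.
      by rewrite mevalB !mevalXU /mx_pt !mxvecE.
    by apply: h; rewrite mem_cat; apply/orP; left; apply/mapP; exists (i, j); rewrite ?mem_enum.
  move=> k kd; apply/eqP; rewrite -subr_eq0 -clpoly_eval -(mevalC (mx_pt F) (phi`_(kap k))) -mevalB.
  apply/eqP/h; rewrite mem_cat; apply/orP; right; apply/mapP; exists k => //.
  by rewrite mem_iota.
rewrite mem_cat => /orP [/mapP [[i j] _ ->] /=|/mapP [k]].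
  by rewrite mevalB !mevalXU /mx_pt !mxvecE -{1}hF mxE subrr.
by rewrite mem_iota => kd ->; rewrite mevalB clpoly_eval mevalC hk // subrr.
Qed.

Lemma loop_fiber_count (A0 : 'M[K]_q) B0 C0 : n`!%:R != 0 :> K ->
  (forall k : 'I_d, (sym_loop A0 B0 C0)`_(kap k) = base_coef (plucker (symX n K)) k) ->
  exists P : {mpoly K[q * q + q * n + n * q]},
    P.@[real_pt A0 B0 C0] != 0 /\
    forall A B C, P.@[real_pt A B C] != 0 -> forall (phi : {poly K}) (Q : 'M[K]_n -> Prop),
      (forall F, Q F <-> F^T = F /\
        forall k, (k < d)%N -> (char_poly (A + B *m F *m C))`_(kap k) = phi`_(kap k)) ->
      count_with_mult Q (loop_eqs A B C phi) (dLG n).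
Proof.
move=> n0 base; have [P [P0 hP]] := generic_fiber_codim n0 base.
exists P; split=> // A B C PA phi Q hQ; apply: count_codim; last first.
  by move=> F; rewrite hQ -loop_eqs_vanish.
have hc := hP A B C PA (fun k => phi`_(kap k)).
have iJ := idealOf_ideal predT (fun k : 'I_d => (sym_loop A B C)`_(kap k) - (phi`_(kap k))%:MP).
have toE k : to_sym ((clpoly A B C)`_(kap k) - (phi`_(kap k))%:MP) =
    (sym_loop A B C)`_(kap k) - (phi`_(kap k))%:MP.
  by rewrite raddfB /= clpoly_to_sym to_symC.
apply: (codim_to_sym iJ) hc => [g /mapP [k]|c].
  rewrite mem_iota => kd ->; rewrite toE.
  exact: (idealOf_mem
    (fun k : 'I_d => (sym_loop A B C)`_(kap k) - (phi`_(kap k))%:MP) (i := Ordinal kd)).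
set gs := [seq _ | k <- _]; have iI := in_ideal_ideal (sym_eqs K n ++ gs).
apply: (idealOf_least (J := fun c => in_ideal (sym_eqs K n ++ gs) (of_sym c))) => [|k _].
  split; first by rewrite raddf0; apply: ideal0.
    by move=> y z hy hz; rewrite raddfD; apply: idealD.
  by move=> a y hy; rewrite rmorphM; apply: idealMl.
set g := (clpoly A B C)`_(kap k) - (phi`_(kap k))%:MP.
have hg : in_ideal (sym_eqs K n ++ gs) g.
  apply: in_ideal_mem; rewrite mem_cat; apply/orP; right; apply/mapP.
  by exists (val k); rewrite // mem_iota add0n ltn_ord.
have hK : in_ideal (sym_eqs K n ++ gs) (g - of_sym (to_sym g)).
  by apply: to_symK => // h hh; apply: in_ideal_mem; rewrite mem_cat hh.
by rewrite -toE -[of_sym _](subKr g); apply: idealB.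
Qed.

End LoopFibers.

Lemma base_realization (K : closedFieldType) n m q : (0 < m)%N -> q = (m * 'C(n.+1, 2))%N ->
  exists (A : 'M[K]_q) (B : 'M[K]_(q, n)) (C : 'M[K]_(n, q)),
    [/\ minimal_real A B C, sym_tf A B C, ~~ odd m -> ham_tf A B C &
    forall k, (sym_loop A B C)`_(m * k) = base_coef (plucker (symX n K)) k].
Proof.
move=> m0 qE; pose u (i : 'I_n) := (m * i.+1)%N.
have u0 i : (0 < u i)%N by rewrite muln_gt0 m0.
have : #|{: chain u}| = q by rewrite card_chain qE -sum_succ big_distrr.
(* The chain realization has dimension [#|{: chain u}|], which is substituted for q. *)
move=> {qE}; case: q /; exists (chA K u), (chB K u), (chC K u); split.
- exact: chain_minimal.
- exact: chain_sym.
- by move=> me; apply: chain_ham => // i; rewrite oddM (negPf me).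
move=> k; have [eA eB eC] := chain_map u (mpolyC 'C(n.+1, 2) (R := K) : {rmorphism K -> _}).
by rewrite /sym_loop eA eB eC; apply: base_closed_loop.
Qed.

Lemma mulnS_bin n : (n * n.+1 = 2 * 'C(n.+1, 2))%N.
Proof.
rewrite bin2 /= mulnC mul2n -[LHS]odd_double_half oddM /= andNb.
by [].
Qed.

(** The open set is the locus p != 0 on minimal realizations; chains of lengths i + 1, respectively
    2(i + 1), lie in it. *)
Theorem mainTheorem6 (n : nat) :
  (* symmetric case, delta = binom(n+1,2) *)
  (let d := 'C(n.+1, 2) in
   exists p : {mpoly CC[d * d + d * n + n * d]},
     (exists (A : 'M[CC]_d) (B : 'M[CC]_(d, n)) (C : 'M[CC]_(n, d)),
        [/\ minimal_real A B C, sym_tf A B C & p.@[real_pt A B C] != 0]) /\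
     forall (A : 'M[CC]_d) (B : 'M[CC]_(d, n)) (C : 'M[CC]_(n, d)),
       minimal_real A B C -> sym_tf A B C -> p.@[real_pt A B C] != 0 ->
       forall phi : {poly CC}, phi \is monic -> size phi = d.+1 ->
         count_with_mult
           (fun F : 'M[CC]_n => F^T = F /\ char_poly (A + B *m F *m C) = phi)
           (sym_fiber_eqs A B C phi) (dLG n))
  /\
  (* Hamiltonian case, delta = n(n+1) *)
  (let d := (n * n.+1)%N in
   exists p : {mpoly CC[d * d + d * n + n * d]},
     (exists (A : 'M[CC]_d) (B : 'M[CC]_(d, n)) (C : 'M[CC]_(n, d)),
        [/\ minimal_real A B C, ham_tf A B C & p.@[real_pt A B C] != 0]) /\
     forall (A : 'M[CC]_d) (B : 'M[CC]_(d, n)) (C : 'M[CC]_(n, d)),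
       minimal_real A B C -> ham_tf A B C -> p.@[real_pt A B C] != 0 ->
       forall phi : {poly CC}, phi \is monic -> size phi = d.+1 ->
         poly_refl phi = phi ->
         count_with_mult
           (fun F : 'M[CC]_n => F^T = F /\ char_poly (A + B *m F *m C) = phi)
           (ham_fiber_eqs A B C phi) (dLG n)).
Proof.
have nz k : (0 < k)%N -> k%:R != 0 :> CC.
  by move=> k0; change ((k%:R : complex Rdefinitions.R) != 0); rewrite pnatr_eq0 -lt0n.
have n0 := nz _ (fact_gt0 n).
split=> d.
  have [A0 [B0 [C0 [m0 s0 _ base]]]] := @base_realization CC n 1 d isT (esym (mul1n _)).
  have [k|P [P0 hP]] := @loop_fiber_count CC n d id A0 B0 C0 n0.
    by rewrite -base mul1n.
  exists P; split; first by exists A0, B0, C0.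
  move=> A B C _ _ /hP hc phi mphi sphi; apply: (hc phi) => F.
  split=> [[-> ->] //|[hF hk]]; split=> //.
  exact: (char_poly_eq_coefs mphi sphi hk).
have dE : d = (2 * 'C(n.+1, 2))%N := mulnS_bin n.
have [A0 [B0 [C0 [m0 _ h0 base]]]] := @base_realization CC n 2 d isT dE.
have [k|P [P0 hP]] := @loop_fiber_count CC n d double A0 B0 C0 n0.
  by rewrite -base mul2n.
exists P; split; first by exists A0, B0, C0; split=> //; apply: h0.
move=> A B C hm hh /hP hc phi mphi sphi ephi.
have -> : ham_fiber_eqs A B C phi = loop_eqs double A B C phi.
  have dh : d./2 = 'C(n.+1, 2) by rewrite dE mul2n doubleK.
  by rewrite /ham_fiber_eqs dh.
apply: (hc phi) => F; split=> [[-> ->] //|[hF hk]]; split=> //.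
apply: (char_poly_eq_coefs mphi sphi) => k kd.
(* Both polynomials are even, the closed-loop one because d is even, so their odd coefficients
   vanish and the even ones are those imposed. *)
have two := nz 2%N isT; case ok: (odd k).
  rewrite !even_poly_odd_coef // (ham_char_poly_refl hm hh hF) -signr_odd [odd d](_ : _ = false) ?mul1r //.
  by rewrite dE mul2n odd_double.
rewrite -[k]odd_double_half ok add0n; apply: hk.
by have := kd; rewrite dE -[k in (k < _)%N]odd_double_half ok mul2n ltn_double.
Qed.
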